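(* Let $V_1,V_2,V_3$ be distinct points of $\mathbb{P}^1$ over $\mathbb{C}$, and let $(t_1,t_2,t_3)$ be a triple of positive integers that is $(2,2,m)$ with $m\ge 2$, or $(2,3,m)$ with $3\le m\le 5$. Set $$D = \frac{s_1}{t_1}V_1+\frac{s_2}{t_2}V_2+\frac{s_3}{t_3}V_3,$$ where each $s_i$ is a positive integer coprime to $t_i$. Then the ring $\varGamma_*(\mathbb{P}^1,D)$ arises, up to rescaling of the grading, as an invariant ring $S^G$ for a finite group $G$ acting on a polynomial ring $S$, and $b(S^G)>0$.
   Context: For a $\mathbb{Q}$-divisor $D=\sum n_iV_i$ (a $\mathbb{Q}$-linear combination of distinct codimension one irreducible subvarieties) on a normal projective variety $X$ with function field $K(X)$, set $\lfloor D\rfloor = \sum\lfloor n_i\rfloor V_i$ and $\mathcal{O}_X(D)=\mathcal{O}_X(\lfloor D\rfloor)$, so $H^0(X,\mathcal{O}_X(D))=\{f\in K(X)\mid \mathrm{div}(f)+D\ge 0\}$. For $D$ ample (some positive multiple $ND$ is an ample Cartier divisor), the generalized section ring is the $\mathbb{N}$-graded ring $\varGamma_*(X,D)=\bigoplus_{n\ge 0}H^0(X,\mathcal{O}_X(nD))T^n$, where $T$ has degree $1$ and is transcendental over $K(X)$. The polynomial ring $S$ is over $\mathbb{C}$ and standard-graded, $G$ acts by degree-preserving $\mathbb{C}$-algebra automorphisms, and $S^G$ carries the inherited grading. ''Up to rescaling of the grading'' means that there are a positive number $r$ and a $\mathbb{C}$-algebra isomorphism $\varGamma_*(\mathbb{P}^1,D)\cong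 S^G$ taking the degree $n$ component onto the degree $rn$ component for each $n\ge 0$. For a normal $\mathbb{N}$-graded ring $R$, finitely generated over a field $[R]_0$, with graded canonical module $\omega_R$, one sets $\omega_R^{-1}=\mathrm{Hom}_R(\omega_R,R)$ and $b(R)=\min\{i\in\mathbb{Z}\mid[\omega_R^{-1}]_i\neq 0\}$. *)

(* Defs.v *)
From HB Require Import structures.
From mathcomp Require Import all_boot all_order fingroup all_algebra.
From mathcomp Require Import complex zify.
From mathcomp Require Import boolp classical_sets functions reals.
From mathcomp Require Import freeg mpoly generic_quotient.

Set Implicit Arguments.
Unset Strict Implicit.
Unset Printing Implicit Defensive.

Import Order.TTheory GRing.Theory Num.Theory.

Local Open Scope ring_scope.

(** * The projective line and its function field *)

(* [Some a] is the point [a : 1] and [None] is the point at infinity [1 : 0]. *)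
Definition P1 (k : fieldType) : Type := option k.

HB.instance Definition _ (k : fieldType) := Choice.on (P1 k).

Notation function_field k := {fraction {poly k}}.

Notation Qdivisor k := {freeg (P1 k) / rat}.

Definition poly_ord (k : fieldType) (P : P1 k) (p : {poly k}) : int :=
  if P is Some a then (mup a p)%:Z else - (size p).-1%:Z.

(* The order of vanishing at [P], only meaningful for [f != 0]; it does not
   depend on the fraction chosen to represent [f] (lemma [aordE] below). *)
Definition ord (k : fieldType) (P : P1 k) (f : function_field k) : int :=
  poly_ord P \n_(repr f) - poly_ord P \d_(repr f).

(* H^0(P^1, O(D)) = {f | div f + D >= 0}, where by convention 0 belongs. *)
Definition H0 (k : fieldType) (D : Qdivisor k) (f : function_field k) : Prop :=
  f <> 0 -> forall P, 0 <= (ord P f)%:~R + coeff P D.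

Section PolyOrd.
Variable k : fieldType.
Implicit Types (P : P1 k) (p q : {poly k}).

Lemma poly_ordM P p q : p != 0 -> q != 0 ->
  poly_ord P (p * q) = poly_ord P p + poly_ord P q.
Proof.
case: P => [a|] p0 q0 /=; first by rewrite mupM // PoszD.
rewrite size_mul // -opprD -PoszD; congr (- Posz _).
by move: p0 q0; rewrite -!size_poly_gt0; case: (size p) => // m;
  case: (size q) => // n _ _; rewrite addSn addnS.
Qed.

Lemma poly_ordD P p q (m : int) : p != 0 -> q != 0 -> p + q != 0 ->
  m <= poly_ord P p -> m <= poly_ord P q -> m <= poly_ord P (p + q).
Proof.
move=> p0 q0 pq0; case: P => [a|] /=.
  case: m => m; last by move=> _ _; apply: (@le_trans _ _ 0).
  by rewrite !lez_nat !mup_geq //; apply: dvdp_add.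
rewrite !(lerNr m) => pm qm.
have le_max : (maxn (size p).-1 (size q).-1)%:Z <= - m.
  by rewrite /maxn; case: ifP.
apply: le_trans le_max; rewrite lez_nat.
have := size_polyD p q; move: p0 q0; rewrite -!size_poly_gt0.
by case: (size p) => // a; case: (size q) => // b _ _; case: (size (p + q)) => //= c;
  rewrite maxnSS ltnS.
Qed.

End PolyOrd.

(* The closure properties of [H0] are proved for an abstract field [F] of
   fractions of [{poly k}]: unification gets lost in [{fraction {poly k}}]. *)
Section AbstractOrd.
Variables (k : fieldType) (F : fieldType) (i : {rmorphism {poly k} -> F}).
Variables (nu de : F -> {poly k}).
Hypothesis i_eq0 : forall p, (i p == 0) = (p == 0).
Hypothesis de0 : forall f, de f != 0.
Hypothesis nudeE : forall f, f * i (de f) = i (nu f).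
Implicit Types (P : P1 k) (p q : {poly k}) (f g : F).

Local Notation aord P f := (poly_ord P (nu f) - poly_ord P (de f)).

Lemma nu_neq0 f : f != 0 -> nu f != 0.
Proof. by move=> f0; rewrite -i_eq0 -nudeE mulf_neq0 // i_eq0. Qed.

Lemma aordE P f p q : f != 0 -> q != 0 -> f * i q = i p ->
  aord P f = poly_ord P p - poly_ord P q.
Proof.
move=> f0 q0 fq.
have p0 : p != 0 by rewrite -i_eq0 -fq mulf_neq0 // i_eq0.
have e : nu f * q = p * de f.
  apply/eqP; rewrite -subr_eq0 -i_eq0 rmorphB !rmorphM /= -fq -nudeE.
  by rewrite mulrAC subrr.
have := congr1 (poly_ord P) e.
rewrite !poly_ordM ?nu_neq0 // => h; apply/eqP.
by rewrite subr_eq -addrA [X in _ + X]addrC addrA eq_sym subr_eq h.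
Qed.

Lemma aordM P f g : f != 0 -> g != 0 -> aord P (f * g) = aord P f + aord P g.
Proof.
move=> f0 g0; rewrite (@aordE P (f * g) (nu f * nu g) (de f * de g)) ?mulf_neq0 //.
  by rewrite !poly_ordM ?nu_neq0 // opprD addrACA.
by rewrite !rmorphM /= mulrACA !nudeE.
Qed.

Lemma aordD P f g (m : int) : f != 0 -> g != 0 -> f + g != 0 ->
  m <= aord P f -> m <= aord P g -> m <= aord P (f + g).
Proof.
move=> f0 g0 fg0; have a0 := nu_neq0 f0; have c0 := nu_neq0 g0.
have e : (f + g) * i (de f * de g) = i (nu f * de g + nu g * de f).
  by rewrite rmorphD !rmorphM /= -!nudeE mulrDl mulrA [i (de f) * _]mulrC mulrA.
have n0 : nu f * de g + nu g * de f != 0.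
  by rewrite -i_eq0 -e mulf_neq0 // i_eq0 mulf_neq0.
rewrite (aordE P fg0 _ e) ?mulf_neq0 // poly_ordM // !lerBrDr => mf mg.
apply: poly_ordD; rewrite ?mulf_neq0 // poly_ordM //.
  by rewrite addrA lerD2r.
by rewrite [X in m + X]addrC addrA lerD2r.
Qed.

Lemma aordC P (c : k) : c != 0 -> aord P (i c%:P) = 0.
Proof.
move=> c0; rewrite (@aordE P _ c%:P 1) ?oner_eq0 ?i_eq0 ?polyC_eq0 //.
  case: P => [a|] /=; last by rewrite size_polyC c0 size_poly1.
  by rewrite !mupNroot ?root1 ?rootC.
by rewrite rmorph1 mulr1.
Qed.

Local Notation aH0 D f :=
  (f <> 0 -> forall P, 0 <= (aord P f)%:~R + coeff P D).

Lemma aH0D (D : Qdivisor k) f g : aH0 D f -> aH0 D g -> aH0 D (f + g).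
Proof.
have [->|f0] := eqVneq f 0; first by rewrite add0r.
have [->|g0] := eqVneq g 0; first by rewrite addr0.
move=> hf hg /eqP fg0 P; have {}hf := hf (elimN eqP f0) P.
have {}hg := hg (elimN eqP g0) P.
wlog le_fg : f g f0 g0 hf hg fg0 / aord P f <= aord P g.
  move=> w; case/orP: (le_total (aord P f) (aord P g)); first exact: w.
  by rewrite [f + g]addrC; apply: w => //; rewrite addrC.
by apply: le_trans hf _; rewrite lerD2r ler_int; apply: aordD.
Qed.

Lemma aH0M (D E : Qdivisor k) f g : aH0 D f -> aH0 E g -> aH0 (D + E) (f * g).
Proof.
move=> hf hg /eqP; rewrite mulf_eq0 negb_or => /andP[f0 g0] P.
rewrite aordM // coeffD rmorphD /= addrACA.
by rewrite addr_ge0 ?hf ?hg //; apply/eqP.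
Qed.

Lemma aH0C (c : k) : aH0 (0 : Qdivisor k) (i c%:P).
Proof.
move=> /eqP; rewrite i_eq0 polyC_eq0 => c0 P.
by rewrite aordC // coeff0 addr0.
Qed.

End AbstractOrd.

Section Sections.
Variable k : fieldType.
Implicit Types (D E : Qdivisor k) (f g : function_field k).
Local Notation "x %:F" := (tofrac x).

Lemma fracE f : f * (\d_(repr f))%:F = (\n_(repr f))%:F.
Proof.
transitivity (\pi_({fraction {poly k}})%qT (repr f) * (\d_(repr f))%:F).
  by rewrite reprK.
move: (repr f) => x.
unlock tofrac; rewrite -[LHS]FracField.pi_mul; apply/eqmodP.
rewrite /= FracField.equivfE /FracField.mulf.
by rewrite !numden_Ratio ?mulr1 ?oner_eq0 ?denom_ratioP // mulrC.
Qed.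

Let i_eq0 (p : {poly k}) : (p%:F == 0) = (p == 0).
Proof. exact: tofrac_eq0. Qed.

Let de0 f : \d_(repr f) != 0.
Proof. exact: denom_ratioP. Qed.

Lemma H0_0 D : H0 D 0. Proof. by move=> /eqP; rewrite eqxx. Qed.

Lemma H0D D f g : H0 D f -> H0 D g -> H0 D (f + g).
Proof. exact: (aH0D i_eq0 de0 fracE). Qed.

Lemma H0M D E f g : H0 D f -> H0 E g -> H0 (D + E) (f * g).
Proof. exact: (aH0M i_eq0 de0 fracE). Qed.

Lemma H0C (c : k) : H0 0 (c%:P)%:F.
Proof. exact: (aH0C i_eq0 de0 fracE). Qed.

Lemma H0N D f : H0 D f -> H0 D (- f).
Proof.
move=> hf; have := H0M (@H0C (-1)) hf.
by rewrite add0r !rmorphN !rmorph1 mulN1r.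
Qed.

End Sections.

(** * Graded algebras *)

Record grading (k : fieldType) (A : comAlgType k) := Grading {
  piece :> nat -> set A;
  piece_lin : forall n (c : k) a b, piece n a -> piece n b ->
    piece n (c *: a + b);
  piece0 : forall n, piece n 0;
  piece1 : piece 0%N 1;
  pieceM : forall m n a b, piece m a -> piece n b -> piece (m + n)%N (a * b);
  piece_dec : forall a, exists (N : nat) (c : nat -> A),
    (forall n, piece n (c n)) /\ a = \sum_(n < N) c n;
  piece_dir : forall (N : nat) (c : nat -> A), (forall n, piece n (c n)) ->
    \sum_(n < N) c n = 0 -> forall n, (n < N)%N -> c n = 0
}.

(** * Section rings of Q-divisors on the projective line *)

Section SectionRing.
Variables (k : fieldType) (D : Qdivisor k).
Local Notation K := (function_field k).
Local Notation "x %:F" := (tofrac x).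

(* The variable of [{poly K}] plays the role of T. *)
Definition section_pred : {pred {poly K}} :=
  [pred p : {poly K} | `[< forall n, H0 (D *+ n) p`_n >]].

Lemma section_subring : subring_closed section_pred.
Proof.
split.
- apply/asboolP => n; rewrite coef1; case: n => [|n]; last exact: H0_0.
  by have := @H0C k 1; rewrite mulr0n !rmorph1.
- move=> p q /asboolP hp /asboolP hq; apply/asboolP => n.
  by rewrite coefB; apply: H0D => //; apply: H0N.
- move=> p q /asboolP hp /asboolP hq; apply/asboolP => n.
  rewrite coefM; apply: (big_ind (H0 (D *+ n))) => [|f g|i _].
  + exact: H0_0.
  + exact: H0D.
  + by rewrite -[in D *+ n](subnKC (ltn_ord i : i <= n)%N) mulrnDr; apply: H0M.
Qed.

HB.instance Definition _ :=
  GRing.isSubringClosed.Build {poly K} section_pred section_subring.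

Record section_ring := SectionRing {
  section_val :> {poly K};
  section_valP : section_val \in section_pred }.

HB.instance Definition _ := [isSub for section_val].
HB.instance Definition _ := [Choice of section_ring by <:].
HB.instance Definition _ := [SubChoice_isSubComNzRing of section_ring by <:].

Lemma section_scale_subproof (c : k) (a : section_ring) :
  (c%:P)%:F *: val a \in section_pred.
Proof.
apply/asboolP => n; rewrite coefZ -[D *+ n]add0r; apply: H0M; first exact: H0C.
by have /asboolP := section_valP a; apply.
Qed.

Definition section_scale (c : k) (a : section_ring) : section_ring :=
  SectionRing (section_scale_subproof c a).

Lemma section_scaleA c d a :
  section_scale c (section_scale d a) = section_scale (c * d) a.
Proof. by apply: val_inj; rewrite /= scalerA -!rmorphM. Qed.

Lemma section_scale1 : left_id 1 section_scale.
Proof. by move=> a; apply: val_inj; rewrite /= !rmorph1 scale1r. Qed.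

Lemma section_scaleDr : right_distributive section_scale +%R.
Proof. by move=> c a b; apply: val_inj; apply: scalerDr. Qed.

Lemma section_scaleDl a : {morph section_scale^~ a : c d / c + d}.
Proof. by move=> c d; apply: val_inj; rewrite /= !rmorphD /= scalerDl. Qed.

HB.instance Definition _ := GRing.Zmodule_isLmodule.Build k section_ring
  section_scaleA section_scale1 section_scaleDr section_scaleDl.

Lemma section_scaleAl (c : k) (a b : section_ring) : c *: (a * b) = (c *: a) * b.
Proof. by apply: val_inj; apply: scalerAl. Qed.

HB.instance Definition _ := GRing.Lmodule_isLalgebra.Build k section_ring
  section_scaleAl.
HB.instance Definition _ := GRing.Lalgebra_isComAlgebra.Build k section_ring.

Definition section_piece (n : nat) : set section_ring :=
  [set a | exists f : K, val a = f *: 'X^n].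

Lemma section_piece_lin n (c : k) a b : section_piece n a ->
  section_piece n b -> section_piece n (c *: a + b).
Proof.
move=> [f ef] [g eg]; exists ((c%:P)%:F * f + g).
by rewrite scalerDl -scalerA -ef -eg.
Qed.

Lemma section_piece0 n : section_piece n 0.
Proof. by exists 0; rewrite scale0r. Qed.

Lemma section_piece1 : section_piece 0 1.
Proof. by exists 1; rewrite scale1r expr0. Qed.

Lemma section_pieceM m n a b : section_piece m a -> section_piece n b ->
  section_piece (m + n)%N (a * b).
Proof.
move=> [f ef] [g eg]; exists (f * g).
transitivity ((f *: 'X^m) * (g *: 'X^n)); first by rewrite -ef -eg.
by rewrite -scalerAl -scalerAr scalerA exprD.
Qed.

Lemma section_comp_subproof (a : section_ring) n :
  (val a)`_n *: 'X^n \in section_pred.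
Proof.
apply/asboolP => m; rewrite coefZ coefXn; have [->|_] := eqVneq m n.
  by rewrite mulr1; have /asboolP := section_valP a; apply.
by rewrite mulr0; apply: H0_0.
Qed.

Lemma section_piece_dec a : exists (N : nat) (c : nat -> section_ring),
  (forall n, section_piece n (c n)) /\ a = \sum_(n < N) c n.
Proof.
exists (size (val a)), (fun n => SectionRing (section_comp_subproof a n)).
split=> [n|]; first by exists (val a)`_n.
by apply: val_inj; rewrite -[LHS]coefK poly_def raddf_sum.
Qed.

Lemma section_piece_dir (N : nat) (c : nat -> section_ring) :
  (forall n, section_piece n (c n)) ->
  \sum_(n < N) c n = 0 -> forall n, (n < N)%N -> c n = 0.
Proof.
move=> hc s0 n ltnN; apply: val_inj; rewrite [RHS]raddf0.
have [f ef] := hc n; rewrite ef.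
have /(congr1 val) := s0; rewrite raddf_sum raddf0 => /(congr1 (fun p : {poly K} => p`_n)).
rewrite coef0 coef_sum (bigD1 (Ordinal ltnN)) //= big1 => [|i ne_in].
  by rewrite ef coefZ coefXn eqxx mulr1 addr0 => ->; rewrite scale0r.
have [g ->] := hc i; rewrite coefZ coefXn.
have -> : (n == i :> nat) = false.
  by apply/negbTE; apply: contraNneq ne_in => e; apply/eqP/val_inj.
by rewrite mulr0.
Qed.

Definition section_grading : grading section_ring :=
  Grading section_piece_lin section_piece0 section_piece1 section_pieceM
    section_piece_dec section_piece_dir.

End SectionRing.

(** * Invariant rings of finite groups *)

Record graded_action (k : fieldType) (d : nat) (gT : finGroupType) :=
  GradedAction {
    action_fun :> gT -> {lrmorphism {mpoly k[d]} -> {mpoly k[d]}};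
    action1 : forall f, action_fun 1%g f = f;
    actionM : forall g h f, action_fun (g * h)%g f = action_fun g (action_fun h f);
    action_homog : forall g n f, f \is n.-homog -> action_fun g f \is n.-homog
  }.

Section InvariantRing.
Variables (k : fieldType) (d : nat) (gT : finGroupType).
Variable act : graded_action k d gT.
Local Notation S := {mpoly k[d]}.

Definition invariant_pred : {pred S} := [pred f : S | [forall g, act g f == f]].

Lemma invariantP (f : S) : reflect (forall g, act g f = f) (f \in invariant_pred).
Proof. by apply: (iffP forallP) => h g; apply/eqP. Qed.

Lemma invariant_subalg : GRing.subalg_closed invariant_pred.
Proof.
split=> [|c f h /invariantP hf /invariantP hh|f h /invariantP hf /invariantP hh];
  apply/invariantP => g; first by rewrite rmorph1.
  by rewrite linearP /= hf hh.
by rewrite rmorphM /= hf hh.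
Qed.

HB.instance Definition _ :=
  GRing.isSubalgClosed.Build k S invariant_pred invariant_subalg.

Record invariant_ring := InvariantRing {
  invariant_val :> S;
  invariant_valP : invariant_val \in invariant_pred }.

HB.instance Definition _ := [isSub for invariant_val].
HB.instance Definition _ := [Choice of invariant_ring by <:].
HB.instance Definition _ := [SubChoice_isSubComNzRing of invariant_ring by <:].
HB.instance Definition _ := [SubZmodule_isSubLmodule of invariant_ring by <:].
HB.instance Definition _ :=
  [SubNzRing_SubLmodule_isSubLalgebra of invariant_ring by <:].
HB.instance Definition _ := GRing.Lalgebra_isComAlgebra.Build k invariant_ring.

Definition invariant_piece (n : nat) : set invariant_ring :=
  [set f | val f \is n.-homog].

Lemma act_pihomog g n (f : S) :
  act g (pihomog mdeg n f) = pihomog mdeg n (act g f).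
Proof.
pose N := maxn (mmeasure mdeg f) n.+1.
rewrite [in RHS](@pihomog_partitionE _ _ mdeg N f) ?leq_maxl //.
have ltnN : (n < N)%N by rewrite leq_max ltnSn orbT.
set p := LHS; rewrite !raddf_sum (bigD1 (Ordinal ltnN)) //= big1 => [|i ne_in].
  by rewrite addr0 [RHS]pihomog_dE //; apply/action_homog/pihomogP.
apply: (@pihomog_ne0 _ _ mdeg i); last exact/action_homog/pihomogP.
by apply: contraNneq ne_in => e; apply/eqP/val_inj.
Qed.

Lemma invariant_piece_lin n (c : k) a b : invariant_piece n a ->
  invariant_piece n b -> invariant_piece n (c *: a + b).
Proof. by move=> ha hb; apply: rpredD => //; apply: rpredZ. Qed.

Lemma invariant_piece0 n : invariant_piece n 0.
Proof. exact: rpred0. Qed.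

Lemma invariant_piece1 : invariant_piece 0 1.
Proof. exact: dhomog1. Qed.

Lemma invariant_pieceM m n a b : invariant_piece m a -> invariant_piece n b ->
  invariant_piece (m + n)%N (a * b).
Proof. exact: dhomogM. Qed.

Lemma invariant_comp_subproof (a : invariant_ring) n :
  pihomog mdeg n (val a) \in invariant_pred.
Proof.
apply/invariantP => g; rewrite act_pihomog; congr pihomog.
by have /invariantP := invariant_valP a; apply.
Qed.

Lemma invariant_piece_dec a : exists (N : nat) (c : nat -> invariant_ring),
  (forall n, invariant_piece n (c n)) /\ a = \sum_(n < N) c n.
Proof.
exists (mmeasure mdeg (val a)), (fun n => InvariantRing (invariant_comp_subproof a n)).
split=> [n|]; first exact: pihomogP.
apply: val_inj; rewrite raddf_sum.
exact: (pihomog_partitionE (leqnn (mmeasure mdeg (val a)))).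
Qed.

Lemma invariant_piece_dir (N : nat) (c : nat -> invariant_ring) :
  (forall n, invariant_piece n (c n)) ->
  \sum_(n < N) c n = 0 -> forall n, (n < N)%N -> c n = 0.
Proof.
move=> hc s0 n ltnN; apply: val_inj; rewrite [RHS]raddf0.
have e : \sum_(i < N) val (c i) = 0 :> S by rewrite -raddf_sum s0.
have := congr1 (pihomog mdeg n) e; rewrite pihomog0 {e}.
rewrite raddf_sum (bigD1 (Ordinal ltnN)) //= big1 => [|i ne_in].
  by rewrite addr0 pihomog_dE //; apply: hc.
apply: (@pihomog_ne0 _ _ mdeg i); last exact: hc.
by apply: contraNneq ne_in => e; apply/eqP/val_inj.
Qed.

Definition invariant_grading : grading invariant_ring :=
  Grading invariant_piece_lin invariant_piece0 invariant_piece1 invariant_pieceM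
    invariant_piece_dec invariant_piece_dir.

End InvariantRing.

(** * The graded canonical module and the invariant b *)

(* A homogeneous system of parameters: algebraically independent homogeneous
   elements of positive degree over which the algebra is module-finite. *)
Record hsop (k : fieldType) (A : comAlgType k) (gr : grading A) := Hsop {
  hs_dim : nat;
  hs_elt :> 'I_hs_dim -> A;
  hs_deg : 'I_hs_dim -> nat;
  hs_deg_gt0 : forall i, (0 < hs_deg i)%N;
  hs_homog : forall i, gr (hs_deg i) (hs_elt i);
  hs_indep : forall p : {mpoly k[hs_dim]},
    mmap (GRing.in_alg A) hs_elt p = 0 -> p = 0;
  hs_finite : exists (m : nat) (b : 'I_m -> A), forall a,
    exists c : 'I_m -> {mpoly k[hs_dim]},
      a = \sum_i mmap (GRing.in_alg A) hs_elt (c i) * b i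
}.

Arguments hs_elt {k A gr} h i.
Arguments hs_deg {k A gr} h i.

Section CanonicalModule.
Variables (k : fieldType) (A : comAlgType k) (gr : grading A) (x : hsop gr).

Definition hs_total_deg : nat := \sum_i hs_deg x i.
Local Notation delta := hs_total_deg.

(* For A of dimension d with A_0 = k, the graded canonical module is the graded
   k-dual of
     H^d_m(A) = colim_n A/(x_1^n, ..., x_d^n),
   the transition maps being multiplication by x_1 ... x_d.  The class of a in
   A/(x_1^n, ..., x_d^n) stands for the class of a/(x_1 ... x_d)^n in the Cech
   complex, so it has degree deg a - n * delta.  A functional on H^d_m(A) is a
   compatible family of functionals [l n] on A vanishing on (x_1^n, ..., x_d^n);
   it belongs to the graded dual when it vanishes outside finitely many
   degrees. *)
Definition omega_pred : {pred (nat -> A -> k)} :=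
  [pred l : nat -> A -> k | `[< [/\
    forall n (c : k) a b, l n (c *: a + b) = c * l n a + l n b,
    forall n i a, l n (x i ^+ n * a) = 0,
    forall n a, l n.+1 ((\prod_i x i) * a) = l n a
  & exists N : nat, forall n m a, gr m a ->
      N%:Z < `|m%:Z - (n * delta)%:Z| -> l n a = 0] >]].

Lemma omega_zmod : zmod_closed omega_pred.
Proof.
split.
  by apply/asboolP; split=> [n c a b||n a|] //; [rewrite mulr0 addr0|exists 0%N].
move=> l1 l2 /asboolP[lin1 van1 com1 [N1 deg1]] /asboolP[lin2 van2 com2 [N2 deg2]].
have E n a : (l1 - l2) n a = l1 n a - l2 n a by [].
apply/asboolP; split=> [n c a b|n i a|n a|].
- by rewrite !E lin1 lin2 mulrDr mulrN opprD addrACA.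
- by rewrite !E van1 van2 subrr.
- by rewrite !E com1 com2.
- exists (N1 + N2)%N => n m a hm hN; rewrite E.
  rewrite (deg1 n m) ?(deg2 n m) ?subrr //; apply: le_lt_trans hN.
    by rewrite lez_nat leq_addl.
  by rewrite lez_nat leq_addr.
Qed.

HB.instance Definition _ :=
  GRing.isZmodClosed.Build (nat -> A -> k) omega_pred omega_zmod.

Record omega := Omega {
  omega_val :> nat -> A -> k;
  omega_valP : omega_val \in omega_pred }.

HB.instance Definition _ := [isSub for omega_val].
HB.instance Definition _ := [Choice of omega by <:].
HB.instance Definition _ := [SubChoice_isSubZmodule of omega by <:].

Lemma omega_scale_subproof (a : A) (l : omega) :
  (fun n b => l n (a * b)) \in omega_pred.
Proof.
have /asboolP[lin van com [N hN]] := omega_valP l.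
apply/asboolP; split=> [n c b b'|n i b|n b|].
- by rewrite mulrDr -scalerAr lin.
- by rewrite mulrCA van.
- by rewrite mulrCA com.
have [M [c [hc ->]]] := piece_dec gr a; exists (N + M)%N => n m b hb hm.
have ladd u v : l n (u + v) = l n u + l n v by rewrite -[u]scale1r lin mul1r scale1r.
have l0 : l n 0 = 0 by apply: (@addIr _ (l n 0)); rewrite -ladd !add0r.
rewrite mulr_suml; elim/big_ind: _ => [//|u v|i _]; first by rewrite ladd => -> ->; rewrite addr0.
apply: (hN n (i + m)%N); first exact: pieceM.
have := ltn_ord i; move: hm; lia.
Qed.

Definition omega_scale (a : A) (l : omega) : omega := Omega (omega_scale_subproof a l).

Lemma omega_scaleA a b l : omega_scale a (omega_scale b l) = omega_scale (a * b) l.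
Proof.
apply: val_inj; apply/funext => n; apply/funext => c /=.
by rewrite mulrCA mulrA.
Qed.

Lemma omega_scale1 : left_id 1 omega_scale.
Proof.
by move=> l; apply: val_inj; apply/funext => n; apply/funext => c /=; rewrite mul1r.
Qed.

Lemma omega_scaleDr : right_distributive omega_scale +%R.
Proof. by move=> a l1 l2; apply: val_inj. Qed.

Lemma omega_scaleDl l : {morph omega_scale^~ l : a b / a + b}.
Proof.
have /asboolP[lin _ _ _] := omega_valP l.
move=> a b; apply: val_inj; apply/funext => n; apply/funext => c.
have := lin n 1 (a * c) (b * c).
by rewrite scale1r mul1r -mulrDl.
Qed.

HB.instance Definition _ := GRing.Zmodule_isLmodule.Build A omega
  omega_scaleA omega_scale1 omega_scaleDr omega_scaleDl.

(* [omega]_i is the dual of [H^d_m(A)]_{-i}. *)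
Definition omega_piece (i : int) : set omega :=
  [set l | forall n m a, gr m a -> m%:Z - (n * delta)%:Z != - i ->
     omega_val l n a = 0].

Definition zpiece (i : int) : set A :=
  if i is Posz n then gr n else [set 0].

Definition omega_inv_piece (i : int) : set {linear omega -> A^o} :=
  [set phi | forall j l, omega_piece j l -> zpiece (i + j) (phi l)].

Definition omega_inv_piece_neq0 (i : int) : Prop :=
  exists2 phi, omega_inv_piece i phi & exists l, phi l != 0.

End CanonicalModule.

(* b is the least degree of a nonzero homogeneous element of
   omega^{-1} = Hom_A(omega, A).  Up to graded isomorphism [omega x] does not
   depend on [x]. *)
Definition is_b (k : fieldType) (A : comAlgType k) (gr : grading A) (b : int) :
    Prop :=
  exists x : hsop gr, omega_inv_piece_neq0 x b /\
    forall i, omega_inv_piece_neq0 x i -> b <= i.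

(* Main.v *)
(* Let (F_i) be the special forms of the binary polyhedral group of type (t_i): up to
   scalars they satisfy F_0^t_0 + F_1^t_1 + F_2^t_2 = 0, and their powers F_i^t_i span a
   pencil with basis (X, Y), normalized so that F_i^t_i is the member of the pencil
   attached to V_i.  Let G be the finite group of the matrices that fix the pencil up to
   a scalar, scale each F_i, and fix the product of the F_i^s_i.  A nonzero homogeneous
   invariant of G has degree n d, where d is the degree of that product, and has the
   form (prod F_i^(n s_i mod t_i)) q(X, Y), where q is any binary form of degree
   sum floor(n s_i / t_i), that is, the numerator of a section of n D.  Hence the section
   ring is the invariant ring, with the grading scaled by d.

   The degree m d part of the canonical module consists of the sections of
   K + ceil(m D), and it vanishes for m <= 0.  As no s_i / t_i is an integer, the part with m = 1
   consists of the forms of degree e + 1 with e = deg floor(D), whereas the invariants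
   of degree at most d correspond to forms of degree at most e.  A homogeneous map phi
   from the canonical module of degree at most 0 sends the sections 1 and z^(e+1) to
   forms r_0 and r_1 with r_1 = z^(e+1) r_0, so r_0 = 0, and phi vanishes because the
   canonical module has rank one. *)
Require Import Defs.
From HB Require Import structures.
From mathcomp Require Import all_boot all_order fingroup all_algebra.
From mathcomp Require Import complex ring zify separable cyclotomic.
From mathcomp Require Import boolp classical_sets reals.
From mathcomp Require Import freeg mpoly generic_quotient.

Set Implicit Arguments.
Unset Strict Implicit.
Unset Printing Implicit Defensive.

Import Order.TTheory GRing.Theory Num.Theory.

Local Open Scope classical_set_scope.
Local Open Scope ring_scope.

(** * Binary forms *)

(** The polyhedral group is never identified as a group. All that is used is a list of [h] matrices,
    pairwise not proportional, that stabilize the special forms, where [h] is the degree of the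
    pencil: a generic orbit under the list has [h] points, as many as the zeros of a member of the
    pencil, which is what forces invariants to be forms in X and Y. That G contains the scalar d-th
    roots of unity confines its invariants to degrees divisible by d. The obstacle for b is that the
    canonical module consists of functionals on local cohomology. A product tau of the t_i makes tau
    D integral of some degree N, and X^N, Y^N serve as parameters. A functional at level n is then
    the coefficient of z^(nN-1) in a product with a fixed polynomial, a residue on the projective
    line; this attaches to each functional its polynomials, one for each positive m. Multiplying
    these by a fixed section embeds the canonical module in the ring. The embedding makes the
    rank-one argument explicit, and being itself a nonzero element of the dual it shows that b
    exists. *)

Section Homogenization.
Variables (K : fieldType) (B : comAlgType K) (X Y : B).
Implicit Types p q : {poly K}.

(** This is Y^e q(X/Y). Coefficients of index above [e] are dropped, hence the size hypotheses
    below. The target is any algebra: [B] is the ring of forms, or the field itself when a form is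
    evaluated. *)
Definition hm (e : nat) (q : {poly K}) : B :=
  \sum_(i < e.+1) q`_i *: (X ^+ i * Y ^+ (e - i)).

Lemma hm_is_linear e : linear (hm e).
Proof.
move=> c p q; rewrite /hm scaler_sumr -big_split /=; apply: eq_bigr => i _.
by rewrite coefD coefZ scalerDl scalerA.
Qed.

HB.instance Definition _ e :=
  GRing.isLinear.Build K {poly K} B _ (hm e) (hm_is_linear e).

Lemma hmXn e i : (i <= e)%N -> hm e 'X^i = X ^+ i * Y ^+ (e - i).
Proof.
move=> ie; have ie' : (i < e.+1)%N by [].
rewrite /hm (bigD1 (Ordinal ie')) //= coefXn eqxx scale1r big1 ?addr0 // => j.
rewrite -val_eqE /= coefXn => /negbTE ->; exact: scale0r.
Qed.

Lemma polyE_size n p : (size p <= n)%N -> p = \sum_(i < n) p`_i *: 'X^i.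
Proof.
move=> sp; rewrite -poly_def; apply/polyP => i; rewrite coef_poly.
by case: ltnP => // ni; rewrite nth_default // (leq_trans sp).
Qed.

Lemma hmM e f p q : (size p <= e.+1)%N -> (size q <= f.+1)%N ->
  hm (e + f) (p * q) = hm e p * hm f q.
Proof.
move=> /polyE_size -> /polyE_size ->; rewrite mulr_suml !linear_sum mulr_suml.
apply: eq_bigr => i _; rewrite mulr_sumr !linear_sum mulr_sumr.
apply: eq_bigr => j _; have [hi hj] := (ltn_ord i, ltn_ord j).
rewrite -scalerAl -scalerAr scalerA !linearZ /= -exprD !hmXn //; last by lia.
rewrite -scalerAl -scalerAr scalerA; congr (_ *: _).
rewrite mulrACA -!exprD; congr (_ * _ ^+ _); lia.
Qed.

Lemma hm_one e : hm e 1 = Y ^+ e.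
Proof. by rewrite -(expr0 'X) hmXn // expr0 mul1r subn0. Qed.

Lemma hm_linear a b : hm 1 (a *: 'X + b%:P) = a *: X + b *: Y.
Proof.
rewrite linearD linearZ /= -[in 'X](expr1 'X) hmXn // -[b%:P]mulr1 mul_polyC linearZ /=.
by rewrite hm_one !expr1 expr0 mulr1.
Qed.

Lemma hm0C c : hm 0 c%:P = c%:A.
Proof. by rewrite /hm big_ord1 coefC eqxx !expr0 mul1r. Qed.

End Homogenization.

Lemma rmorph_hm (K : fieldType) (B B' : comAlgType K) (f : {lrmorphism B -> B'})
  (X Y : B) e q : f (hm X Y e q) = hm (f X) (f Y) e q.
Proof.
rewrite /hm linear_sum; apply: eq_bigr => i _.
by rewrite linearZ /= rmorphM !rmorphXn.
Qed.

Section BinaryForms.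
Variable (K : closedFieldType).
Local Notation S := {mpoly K[2]}.
Implicit Types (f g X Y : S) (p q : {poly K}).

(** Over an algebraically closed field [q] splits, so its homogenization is a nonzero constant times
    a product of factors X - aY and Y. Independence of X and Y makes each factor nonzero, and forms
    have no zero divisors. *)
Lemma hm_eq0 X Y e q :
  (forall a b, a *: X + b *: Y = 0 -> a = 0 /\ b = 0) ->
  (size q <= e.+1)%N -> hm X Y e q = 0 -> q = 0.
Proof.
move=> XY sq; apply: contra_eq => q0.
have Y0 : Y != 0.
  apply/eqP => Y0; have [_ /eqP] := XY 0 1 ltac:(by rewrite Y0 scaler0 scale0r addr0).
  by rewrite oner_eq0.
have lin0 a : X - a *: Y != 0.
  apply/eqP => h; have [] := XY 1 (- a); first by rewrite scale1r scaleNr.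
  by move/eqP; rewrite oner_eq0.
have [r Dq] := closed_field_poly_normal q.
have sr : (size r <= e)%N.
  by move: sq; rewrite Dq size_scale ?lead_coef_eq0 // size_prod_XsubC.
rewrite Dq linearZ /= scaler_eq0 lead_coef_eq0 (negbTE q0) /= {Dq sq q0 q}.
elim: r e sr => [|a r IH] e sr.
  by rewrite big_nil hm_one expf_neq0.
case: e sr => [//|e] sr; rewrite big_cons -[e.+1]add1n hmM ?size_XsubC //; last first.
  by rewrite size_prod_XsubC.
rewrite mulf_neq0 ?IH //.
have -> : 'X - a%:P = 1 *: 'X + (- a)%:P by rewrite scale1r polyCN.
by rewrite hm_linear scale1r scaleNr.
Qed.

Definition fx : S := 'X_ord0.
Definition fy : S := 'X_ord_max.

Definition dehom : S -> {poly K} :=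
  mmap (@polyC K) (fun i : 'I_2 => if i == ord0 then 'X else 1).

Lemma dehom_is_linear : linear dehom.
Proof. by move=> c f g; rewrite /dehom mmapD mmapZ mul_polyC. Qed.
HB.instance Definition _ :=
  GRing.isLinear.Build K S {poly K} _ dehom dehom_is_linear.
Lemma dehom_is_multiplicative : multiplicative dehom.
Proof. exact: mmap_is_multiplicative. Qed.
HB.instance Definition _ :=
  GRing.isMultiplicative.Build S {poly K} dehom dehom_is_multiplicative.

Lemma dehomx : dehom fx = 'X. Proof. by rewrite /dehom mmapX mmap1U. Qed.
Lemma dehomy : dehom fy = 1. Proof. by rewrite /dehom mmapX mmap1U. Qed.

Lemma mpolyX2 (m : 'X_{1..2}) : 'X_[K, m] = fx ^+ (m ord0) * fy ^+ (m ord_max).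
Proof.
rewrite mpolyXE_id big_ord_recl big_ord1.
by have -> : fintype.lift ord0 ord0 = ord_max :> 'I_2 by apply/val_inj.
Qed.

Lemma homog_deg n f m : f \is n.-homog -> m \in msupp f ->
  n = (m ord0 + m ord_max)%N.
Proof.
move=> hf mf; have <- : mdeg m = n := dhomog_mf hf mf.
rewrite mdegE big_ord_recl big_ord1.
by have -> : fintype.lift ord0 ord0 = ord_max :> 'I_2 by apply/val_inj.
Qed.

Lemma homogE n f : f \is n.-homog ->
  f = \sum_(m <- msupp f) f@_m *: (fx ^+ (m ord0) * fy ^+ (n - m ord0)).
Proof.
move=> hf; rewrite {1}[f]mpolyE; apply: eq_big_seq => m mf.
by rewrite mpolyX2 (homog_deg hf mf) addKn.
Qed.

Lemma homog_le n f m : f \is n.-homog -> m \in msupp f -> (m ord0 <= n)%N.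
Proof.
by move=> hf mf; rewrite (homog_deg hf mf) leq_addr.
Qed.

Lemma dehomE n f : f \is n.-homog -> dehom f = \sum_(m <- msupp f) f@_m *: 'X^(m ord0).
Proof.
move/homogE => {1}->; rewrite linear_sum; apply: eq_bigr => m _.
by rewrite linearZ /= rmorphM !rmorphXn /= dehomx dehomy expr1n mulr1.
Qed.

Lemma size_dehom n f : f \is n.-homog -> (size (dehom f) <= n.+1)%N.
Proof.
move=> hf; rewrite (dehomE hf); apply: leq_trans (size_sum _ _ _) _.
apply/bigmax_leqP_seq => m mf _; apply: leq_trans (size_scale_leq _ _) _.
by rewrite size_polyXn ltnS (homog_le hf).
Qed.

Lemma hm_dehom n f : f \is n.-homog -> hm fx fy n (dehom f) = f.
Proof.
move=> hf; rewrite (dehomE hf) linear_sum [RHS](homogE hf).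
by apply: eq_big_seq => m mf; rewrite linearZ /= hmXn // (homog_le hf).
Qed.

Lemma dehom_inj n f : f \is n.-homog -> dehom f = 0 -> f = 0.
Proof. by move=> hf f0; rewrite -(hm_dehom hf) f0 linear0. Qed.

Lemma hm_homog X Y h e q : X \is h.-homog -> Y \is h.-homog ->
  hm X Y e q \is (h * e).-homog.
Proof.
move=> hX hY; apply: rpred_sum => i _; apply: rpredZ.
have {1}-> : (h * e = h * i + h * (e - i))%N by have := ltn_ord i; nia.
by rewrite dhomogM // dhomogMn.
Qed.

Lemma homog_root n f : (0 < n)%N -> f \is n.-homog ->
  exists v : 'I_2 -> K, (exists i, v i != 0) /\ f.@[v] = 0.
Proof.
move=> n0 hf; rewrite -(hm_dehom hf).
have E (v : 'I_2 -> K) q : (hm fx fy n q).@[v] = \sum_(i < n.+1) q`_i * (v ord0 ^+ i * v ord_max ^+ (n - i)).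
  rewrite /hm raddf_sum /=; apply: eq_bigr => i _.
  by rewrite mevalZ mevalM !rmorphXn /= !mevalXU.
(* If the dehomogenization is constant, [f] is a multiple of y^n and vanishes at [1 : 0]; otherwise
   a root gives a zero at finite distance. *)
have [s1|s1] := leqP (size (dehom f)) 1.
  exists (fun i => (i == ord0)%:R); split; first by exists ord0; rewrite eqxx oner_eq0.
  rewrite E big1 // => i _; have := ltn_ord i; rewrite ltnS leq_eqVlt => /orP[/eqP ->|lt_in].
    by rewrite nth_default ?mul0r // (leq_trans s1).
  by rewrite [X in _ * (_ * X)]expr0n subn_eq0 leqNgt lt_in !mulr0.
have [a /rootP ra] := closed_rootP (dehom f) (negbT (gtn_eqF s1)).
exists (fun i => if i == ord0 then a else 1); split.
  by exists ord_max; rewrite oner_eq0.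
rewrite E -[RHS]ra (horner_coef_wide _ (size_dehom hf)).
by apply: eq_bigr => i _; rewrite expr1n mulr1.
Qed.

End BinaryForms.

(** * Polyhedral groups and their special forms *)

(* Row-vector convention: [(sub g f)(v) = f(v g)], which makes [sub] a left action.
   Locked because unification would otherwise unfold it to a sum. *)
HB.lock Definition sub (K : fieldType) (g : 'M[K]_2) : {mpoly K[2]} -> {mpoly K[2]} :=
  comp_mpoly [tuple \sum_j g j i *: 'X_j | i < 2].
Canonical sub_unlockable := Unlockable sub.unlock.
Arguments sub {K} g f.

Section Substitution.
Variable K : fieldType.
Local Notation S := {mpoly K[2]}.
Implicit Types (g : 'M[K]_2) (f : S).

Lemma sub_is_linear (g : 'M[K]_2) : linear (@sub K g).
Proof. by rewrite unlock; apply: linearP. Qed.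
HB.instance Definition _ g := GRing.isLinear.Build K S S _ (@sub K g) (sub_is_linear g).
Lemma sub_is_multiplicative (g : 'M[K]_2) : multiplicative (@sub K g).
Proof. by rewrite unlock; apply: comp_mpoly_is_multiplicative. Qed.
HB.instance Definition _ g :=
  GRing.isMultiplicative.Build S S (@sub K g) (sub_is_multiplicative g).

Lemma subX g f n : sub g (f ^+ n) = sub g f ^+ n. Proof. exact: rmorphXn. Qed.
Lemma sub_mul g f f' : sub g (f * f') = sub g f * sub g f'. Proof. exact: rmorphM. Qed.
Lemma subD g f f' : sub g (f + f') = sub g f + sub g f'. Proof. exact: raddfD. Qed.
Lemma subN g f : sub g (- f) = - sub g f. Proof. exact: raddfN. Qed.
Lemma subZ g c f : sub g (c *: f) = c *: sub g f. Proof. exact: linearZ. Qed.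
Lemma subC g c : sub g c%:MP = c%:MP. Proof. by rewrite unlock; apply: comp_mpolyC. Qed.
Lemma sub_sum g I r (P : pred I) (f : I -> S) :
  sub g (\sum_(i <- r | P i) f i) = \sum_(i <- r | P i) sub g (f i).
Proof. exact: linear_sum. Qed.
Lemma sub_prod g I r (P : pred I) (f : I -> S) :
  sub g (\prod_(i <- r | P i) f i) = \prod_(i <- r | P i) sub g (f i).
Proof. exact: rmorph_prod. Qed.

Lemma sub_X g i : sub g 'X_i = \sum_j g j i *: 'X_j.
Proof. by rewrite unlock comp_mpolyXU -tnth_nth tnth_mktuple. Qed.

Lemma sub1 f : sub 1 f = f.
Proof.
rewrite unlock -[RHS]comp_mpoly_id; congr comp_mpoly; apply: eq_from_tnth => i.
rewrite !tnth_mktuple (bigD1 i) //= mxE eqxx scale1r big1 ?addr0 // => j ne.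
by rewrite mxE (negbTE ne) scale0r.
Qed.

Lemma meval_sub g f v : (sub g f).@[v] = f.@[fun i => \sum_j v j * g j i].
Proof.
rewrite unlock comp_mpoly_meval; apply: meval_eq => i.
rewrite tnth_mktuple raddf_sum; apply: eq_bigr => j _.
by rewrite /= mevalZ mevalXU mulrC.
Qed.

Lemma subM g g' f : sub g (sub g' f) = sub (g * g') f.
Proof.
rewrite [f]mpolyE !sub_sum.
apply: eq_bigr => m _; rewrite !subZ; congr (_ *: _).
rewrite mpolyXE_id !sub_prod.
apply: eq_bigr => i _; rewrite !subX; congr (_ ^+ _).
rewrite !sub_X sub_sum.
under eq_bigr => j _ do rewrite subZ sub_X scaler_sumr.
rewrite exchange_big /=; apply: eq_bigr => l _.
rewrite -[g * g']/(g *m g') mxE scaler_suml; apply: eq_bigr => j _.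
by rewrite scalerA mulrC.
Qed.

Lemma sub_homog g n f : f \is n.-homog -> sub g f \is n.-homog.
Proof.
move=> hf; rewrite [f]mpolyE sub_sum big_seq; apply: rpred_sum => m mf.
rewrite subZ; apply: rpredZ; rewrite mpolyXE_id sub_prod.
have <- : mdeg m = n := dhomog_mf hf mf.
rewrite mdegE; elim/big_rec2: _ => [|i p q _ hq]; first exact: dhomog1.
rewrite dhomogM // subX -[X in X.-homog]mul1n dhomogMn // sub_X.
by apply: rpred_sum => j _; apply: rpredZ; rewrite dhomogX; apply/eqP; exact: mdeg1.
Qed.

End Substitution.

Section PolyhedralForms.
Variable K : numClosedFieldType.
Local Notation S := {mpoly K[2]}.
Local Notation x := (@fx K).
Local Notation y := (@fy K).

(** The constant [C] is common to the three indices, so that [g] scales the whole pencil spanned by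
    the powers F_i^t_i. *)
Definition semi_invariant (t : 'I_3 -> nat) (F : 'I_3 -> S) (g : 'M[K]_2) : Prop :=
  exists c C, forall i, sub g (F i) = c i *: F i /\ c i ^+ t i = C.

Lemma semi_invariantM t F g g' :
  semi_invariant t F g -> semi_invariant t F g' -> semi_invariant t F (g * g').
Proof.
move=> [c [C hc]] [c' [C' hc']]; exists (fun i => c' i * c i), (C' * C) => i.
have [[e <-] [e' <-]] := (hc i, hc' i).
by rewrite -subM e' subZ e scalerA exprMn.
Qed.

Definition mx2 (q : K * K * K * K) : 'M[K]_2 :=
  let: (a, b, c, d) := q in
  \matrix_(i, j) if i == ord0 then (if j == ord0 then a else b)
                 else (if j == ord0 then c else d).

Lemma sub_mx2x a b c d : sub (mx2 (a, b, c, d)) x = a%:MP * x + c%:MP * y.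
Proof.
rewrite sub_X big_ord_recl big_ord1 !mxE /= !mul_mpolyC.
by have -> : fintype.lift ord0 ord0 = ord_max :> 'I_2 by apply/val_inj.
Qed.

Lemma sub_mx2y a b c d : sub (mx2 (a, b, c, d)) y = b%:MP * x + d%:MP * y.
Proof.
rewrite sub_X big_ord_recl big_ord1 !mxE /= !mul_mpolyC.
by have -> : fintype.lift ord0 ord0 = ord_max :> 'I_2 by apply/val_inj.
Qed.

Lemma unitmx2 a b c d : (mx2 (a, b, c, d) \in unitmx) = (a * d - b * c != 0).
Proof.
rewrite unitmxE (expand_det_row _ ord0) big_ord_recl big_ord1 /cofactor !det_mx11 !mxE /= unitfE.
by rewrite expr0 expr1 mul1r mulN1r mulrN.
Qed.

Definition tri T (a b c : T) (i : 'I_3) : T :=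
  match val i with 0%N => a | 1%N => b | _ => c end.

Lemma unity_roots m : (0 < m)%N ->
  exists zs : seq K, [/\ uniq zs, size zs = m & forall z, z \in zs -> z ^+ m = 1].
Proof.
move=> m0; have [zs Dz] := closed_field_poly_normal ('X^m - 1 : {poly K}).
have {}Dz : 'X^m - 1 = \prod_(z <- zs) ('X - z%:P) :> {poly K}.
  by move: Dz; rewrite (monicP (monic_Xn_sub_1 _ m0)) scale1r.
exists zs; split.
- rewrite -separable_prod_XsubC -Dz; apply: separable_Xn_sub_1.
  by rewrite pnatr_eq0 -lt0n.
- have := congr1 (fun p : {poly K} => size p) Dz.
  by rewrite size_XnsubC // size_prod_XsubC => -[].
move=> z hz; apply/eqP; rewrite -subr_eq0.
have : root ('X^m - 1) z by rewrite Dz root_prod_XsubC.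
by rewrite /root !hornerE.
Qed.

(* The group is given by one matrix per point of the orbit of [1 : 0] and per
   element [diag(1, z)] of the stabilizer of that point. *)
Definition coset_mx (z : K) (q : K * K * K * K) : K * K * K * K :=
  let: (a, b, c, d) := q in (a, b, z * c, z * d).

Lemma coset_mxE z q : mx2 (coset_mx z q) = mx2 (1, 0, 0, z) * mx2 q.
Proof.
case: q => [[[a b] c] d]; apply/matrixP => i j.
rewrite -[_ * _]/(_ *m _) !mxE big_ord_recl big_ord1 !mxE /=.
by case: (i == ord0); case: (j == ord0); rewrite ?mul1r ?mul0r ?addr0 ?add0r.
Qed.

Definition polyhedral (t : 'I_3 -> nat) : Prop :=
  exists (F : 'I_3 -> S) (hd : 'I_3 -> nat) (h : nat) (ms : seq 'M[K]_2),
  [/\ forall i, [/\ F i \is (hd i).-homog, (0 < hd i)%N & (hd i * t i = h)%N],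
      \sum_i F i ^+ t i = 0,
      forall v, (forall i, (F i).@[v] = 0) -> forall j, v j = 0,
      uniq ms /\ size ms = h
    & (forall g, g \in ms -> g \in unitmx /\ semi_invariant t F g) /\
      (forall g g' a, g \in ms -> g' \in ms -> g = a *: g' -> g = g')].

(** With row vectors, the image of [1 : 0] is the first row, and multiplication by diag(1, z) on the
    left does not change it. The last hypothesis therefore says that the matrices in [qs] send
    [1 : 0] to distinct points; the second row then separates the values of [z]. *)
Lemma polyhedral_intro (t : 'I_3 -> nat) (F : 'I_3 -> S) (hd : 'I_3 -> nat) (h : nat)
    (zs : seq K) (qs : seq (K * K * K * K)) :
  (forall i, [/\ F i \is (hd i).-homog, (0 < hd i)%N & (hd i * t i = h)%N]) ->
  \sum_i F i ^+ t i = 0 ->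
  (forall v, (forall i, (F i).@[v] = 0) -> forall j, v j = 0) ->
  uniq zs -> uniq qs -> (size zs * size qs = h)%N ->
  {in zs, forall z, z != 0} ->
  {in zs, forall z, semi_invariant t F (mx2 (1, 0, 0, z))} ->
  {in qs, forall q, semi_invariant t F (mx2 q)} ->
  {in qs, forall q, let: (a, b, c, d) := q in a * d - b * c != 0} ->
  {in qs &, forall q q', let: (a, b, c, d) := q in let: (a', b', c', d') := q' in
     a * b' = b * a' -> q = q'} ->
  polyhedral t.
Proof.
move=> hF rel nz uz uq sz z0 iz iq dq nq.
have inj z z' q q' k : z \in zs -> z' \in zs -> q \in qs -> q' \in qs ->
    mx2 (coset_mx z q) = k *: mx2 (coset_mx z' q') -> z = z' /\ q = q'.
  move=> hz hz' hq hq' /matrixP e.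
  have e00 := e ord0 ord0; have e01 := e ord0 ord_max.
  have e10 := e ord_max ord0; have e11 := e ord_max ord_max.
  have eq : q = q'.
    move: (nq _ _ hq hq') e00 e01; case: q q' {hq hq' e e10 e11} => [[[a b] c] d] [[[a' b'] c'] d'].
    by rewrite !mxE /= => H ea eb; apply: H; rewrite ea eb; ring.
  split=> //; move: e00 e01 e10 e11 (dq _ hq'); rewrite eq.
  case: q' {hq hq' e eq} => [[[a b] c] d]; rewrite !mxE /= => ea eb ec ed D.
  have k1 : k = 1.
    have [a0|a0] := eqVneq a 0; last by apply: (mulIf a0); rewrite mul1r -ea.
    have b0 : b != 0 by apply: contraNneq D => b0; rewrite a0 b0 !mul0r subrr.
    by apply: (mulIf b0); rewrite mul1r -eb.
  move: ec ed; rewrite k1 !mul1r => ec ed.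
  have [c0|c0] := eqVneq c 0; last exact: (mulIf c0).
  have d0 : d != 0 by apply: contraNneq D => d0; rewrite c0 d0 !mulr0 subrr.
  exact: (mulIf d0).
exists F, hd, h, [seq mx2 (coset_mx z q) | z <- zs, q <- qs]; split=> //; split.
- apply: allpairs_uniq => // -[z q] [z' q'] /allpairsP[[u v] [/= hu hv [-> ->]]]
    /allpairsP[[u' v'] [/= hu' hv' [-> ->]]] e.
  have := @inj u u' v v' 1 hu hu' hv hv'; rewrite scale1r => /(_ e)[-> ->].
  by [].
- by rewrite size_allpairs.
- move=> g /allpairsP[[z q] [/= hz hq ->]]; split; last first.
    by rewrite coset_mxE; apply: semi_invariantM; [apply: iz|apply: iq].
  rewrite coset_mxE unitmx_mul; apply/andP; split.
    by rewrite unitmx2 mulr0 subr0 mul1r z0.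
  by have := dq _ hq; case: q {hq} => [[[a b] c] d]; rewrite unitmx2.
- move=> g g' a /allpairsP[[z q] [/= hz hq ->]] /allpairsP[[z' q'] [/= hz' hq' ->]] e.
  by have [-> ->] := inj _ _ _ _ _ hz hz' hq hq' e.
Qed.

End PolyhedralForms.

(** * Klein's forms, their relations and their behaviour under the generators *)

Section KleinForms.
Variable B : comNzRingType.
Implicit Types x y u v s w : B.

(** The zeros of these forms on the sphere are: for [tet_t] the vertices of an octahedron; for
    [tet_phi] with s^2 = -3 the vertices of a tetrahedron, the sign of s giving its dual; for
    [oct_w], the product of these two, the vertices of a cube; for [oct_k] its edge midpoints; for
    [ico_f], [ico_h] and [ico_t] the vertices, face centres and edge midpoints of an icosahedron. *)
Definition tet_t x y : B := x * y * (x ^+ 4 - y ^+ 4).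
Definition tet_phi s x y : B := x ^+ 4 + 2 * s * x ^+ 2 * y ^+ 2 + y ^+ 4.
Definition oct_w x y : B := x ^+ 8 + 14 * x ^+ 4 * y ^+ 4 + y ^+ 8.
Definition oct_k x y : B := x ^+ 12 - 33 * x ^+ 8 * y ^+ 4 - 33 * x ^+ 4 * y ^+ 8 + y ^+ 12.
Definition ico_f x y : B := x * y * (x ^+ 10 + 11 * x ^+ 5 * y ^+ 5 - y ^+ 10).
Definition ico_h x y : B := - (x ^+ 20 + y ^+ 20)
  + 228 * (x ^+ 15 * y ^+ 5 - x ^+ 5 * y ^+ 15) - 494 * x ^+ 10 * y ^+ 10.
Definition ico_t x y : B := x ^+ 30 + y ^+ 30
  + 522 * (x ^+ 25 * y ^+ 5 - x ^+ 5 * y ^+ 25)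
  - 10005 * (x ^+ 20 * y ^+ 10 + x ^+ 10 * y ^+ 20).

Lemma tet_rel s x y : s ^+ 2 = -3 ->
  tet_phi s x y ^+ 3 - tet_phi (- s) x y ^+ 3 = 12 * s * tet_t x y ^+ 2.
Proof.
move=> s2; pose p := x ^+ 4 + y ^+ 4; pose q := 2 * x ^+ 2 * y ^+ 2.
(* A difference of cubes of p + sq and p - sq. With s^2 = -3 the last factor is 3(p^2 - q^2), and
   p^2 - q^2 is the square of x^4 - y^4. *)
have -> : tet_phi s x y ^+ 3 - tet_phi (- s) x y ^+ 3
    = 2 * s * q * (3 * p ^+ 2 + s ^+ 2 * q ^+ 2) by rewrite /tet_phi /p /q; ring.
rewrite s2 /p /q /tet_t; ring.
Qed.

Lemma oct_rel x y : oct_w x y ^+ 3 - oct_k x y ^+ 2 = 108 * tet_t x y ^+ 4.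
Proof. by rewrite /oct_w /oct_k /tet_t; ring. Qed.

Lemma ico_rel x y : ico_t x y ^+ 2 + ico_h x y ^+ 3 = 1728 * ico_f x y ^+ 5.
Proof.
(* In terms of the fifth powers the identity has degree 12 instead of 60. *)
pose a := x ^+ 5; pose b := y ^+ 5.
have -> : ico_f x y ^+ 5 = a * b * (a ^+ 2 + 11 * a * b - b ^+ 2) ^+ 5.
  by rewrite /ico_f /a /b; ring.
have -> : ico_h x y = - (a ^+ 4 + b ^+ 4) + 228 * (a ^+ 3 * b - a * b ^+ 3) - 494 * a ^+ 2 * b ^+ 2.
  by rewrite /ico_h /a /b; ring.
have -> : ico_t x y = a ^+ 6 + b ^+ 6 + 522 * (a ^+ 5 * b - a * b ^+ 5)
    - 10005 * (a ^+ 4 * b ^+ 2 + a ^+ 2 * b ^+ 4).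
  by rewrite /ico_t /a /b; ring.
ring.
Qed.

Lemma tet_t_mix u v x y : u ^+ 4 = 1 -> v ^+ 4 = 1 ->
  tet_t (x + v * y) (u * (x - v * y)) = 8 * u * v * tet_t x y.
Proof.
move=> u4 v4; rewrite /tet_t [(u * _) ^+ 4]exprMn u4.
transitivity (8 * u * v * (x * y * (x ^+ 4 - v ^+ 4 * y ^+ 4))); first by ring.
by rewrite v4; ring.
Qed.

(** The sign in v^2 = - u^2 selects the rotations of the tetrahedron among those of the octahedron:
    with v^2 = u^2 the form would go to a multiple of [tet_phi (- s)]. *)
Lemma tet_phi_mix s u v x y : s ^+ 2 = -3 -> u ^+ 4 = 1 -> v ^+ 2 = - u ^+ 2 ->
  tet_phi s (x + v * y) (u * (x - v * y)) = (2 + 2 * s * u ^+ 2) * tet_phi s x y.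
Proof.
move=> s2 u4 v2; rewrite /tet_phi [(u * _) ^+ 4]exprMn u4.
transitivity (2 * x ^+ 4 + 12 * x ^+ 2 * v ^+ 2 * y ^+ 2 + 2 * (v ^+ 2) ^+ 2 * y ^+ 4
  + 2 * s * u ^+ 2 * (x ^+ 2 - v ^+ 2 * y ^+ 2) ^+ 2); first by ring.
rewrite v2; transitivity (2 * x ^+ 4 + 2 * u ^+ 4 * y ^+ 4 - 12 * u ^+ 2 * x ^+ 2 * y ^+ 2
  + 2 * s * (u ^+ 2 * x ^+ 4 + 2 * u ^+ 4 * x ^+ 2 * y ^+ 2 + u ^+ 4 * u ^+ 2 * y ^+ 4)).
  by ring.
rewrite u4; transitivity ((x ^+ 4 + y ^+ 4) * (2 + 2 * s * u ^+ 2)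
  + (x ^+ 2 * y ^+ 2) * (4 * s - 3 * (4 * u ^+ 2))); first by ring.
rewrite -[- (3 * _)]mulNr -s2; ring.
Qed.

Lemma oct_w_mix u x y : u ^+ 4 = 1 -> oct_w (x + y) (u * (x - y)) = 16 * oct_w x y.
Proof.
move=> u4; have u8 : u ^+ 8 = 1 by rewrite (exprM u 4 2) u4 expr1n.
by rewrite /oct_w !exprMn u4 u8; ring.
Qed.

Lemma oct_k_mix u x y : u ^+ 4 = 1 -> oct_k (x + y) (u * (x - y)) = - 64 * oct_k x y.
Proof.
move=> u4; have u8 : u ^+ 8 = 1 by rewrite (exprM u 4 2) u4 expr1n.
have u12 : u ^+ 12 = 1 by rewrite (exprM u 4 3) u4 expr1n.
by rewrite /oct_k !exprMn u4 u8 u12; ring.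
Qed.

(* Elements of [B] of the form [p.1 + w p.2] where [w] is the golden ratio. *)
Definition gmul (p q : B * B) : B * B :=
  (p.1 * q.1 + p.2 * q.2, p.1 * q.2 + p.2 * q.1 + p.2 * q.2).
Definition gval w (p : B * B) : B := p.1 + w * p.2.

Lemma gvalM w p q : w ^+ 2 = w + 1 -> gval w (gmul p q) = gval w p * gval w q.
Proof.
move=> w2; rewrite /gval /gmul /=.
transitivity (p.1 * q.1 + w * (p.1 * q.2 + p.2 * q.1) + w ^+ 2 * (p.2 * q.2)); last by ring.
by rewrite w2; ring.
Qed.

Definition ico_a1 x y : B :=
  y ^+ 5 + 10 * y ^+ 3 * x ^+ 2 - 10 * y ^+ 2 * x ^+ 3 + 10 * y * x ^+ 4 - 3 * x ^+ 5.
Definition ico_a2 x y : B :=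
  - 5 * y ^+ 4 * x + 10 * y ^+ 3 * x ^+ 2 - 20 * y ^+ 2 * x ^+ 3 + 15 * y * x ^+ 4 - 5 * x ^+ 5.
Definition ico_b1 x y : B :=
  x ^+ 5 + 10 * x ^+ 3 * y ^+ 2 + 10 * x ^+ 2 * y ^+ 3 + 10 * x * y ^+ 4 + 3 * y ^+ 5.
Definition ico_b2 x y : B :=
  5 * x ^+ 4 * y + 10 * x ^+ 3 * y ^+ 2 + 20 * x ^+ 2 * y ^+ 3 + 15 * x * y ^+ 4 + 5 * y ^+ 5.

Lemma golden_pow w : w ^+ 2 = w + 1 ->
  [/\ w ^+ 3 = 2 * w + 1, w ^+ 4 = 3 * w + 2, w ^+ 5 = 5 * w + 3,
      w ^+ 6 = 8 * w + 5 & w ^+ 10 = 55 * w + 34].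
Proof.
move=> w2; have w3 : w ^+ 3 = 2 * w + 1.
  transitivity (w * w ^+ 2); [by ring|rewrite w2].
  by transitivity (w ^+ 2 + w); [ring|rewrite w2; ring].
have w4 : w ^+ 4 = 3 * w + 2.
  transitivity (w * w ^+ 3); [by ring|rewrite w3].
  by transitivity (2 * w ^+ 2 + w); [ring|rewrite w2; ring].
have w5 : w ^+ 5 = 5 * w + 3.
  transitivity (w * w ^+ 4); [by ring|rewrite w4].
  by transitivity (3 * w ^+ 2 + 2 * w); [ring|rewrite w2; ring].
split=> //.
  transitivity (w * w ^+ 5); [by ring|rewrite w5].
  by transitivity (5 * w ^+ 2 + 3 * w); [ring|rewrite w2; ring].
rewrite (exprM w 5 2) w5.
by transitivity (25 * w ^+ 2 + 30 * w + 9); [ring|rewrite w2; ring].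
Qed.

Lemma ico_aE w x y : w ^+ 2 = w + 1 -> (- w * x + y) ^+ 5 = gval w (ico_a1 x y, ico_a2 x y).
Proof.
move=> w2; have [w3 w4 w5 _ _] := golden_pow w2; rewrite /gval /ico_a1 /ico_a2 /=.
transitivity (y ^+ 5 - 5 * w * y ^+ 4 * x + 10 * w ^+ 2 * y ^+ 3 * x ^+ 2
  - 10 * w ^+ 3 * y ^+ 2 * x ^+ 3 + 5 * w ^+ 4 * y * x ^+ 4 - w ^+ 5 * x ^+ 5); first by ring.
by rewrite w2 w3 w4 w5; ring.
Qed.

Lemma ico_bE w x y : w ^+ 2 = w + 1 -> (x + w * y) ^+ 5 = gval w (ico_b1 x y, ico_b2 x y).
Proof.
move=> w2; have [w3 w4 w5 _ _] := golden_pow w2; rewrite /gval /ico_b1 /ico_b2 /=.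
transitivity (x ^+ 5 + 5 * w * x ^+ 4 * y + 10 * w ^+ 2 * x ^+ 3 * y ^+ 2
  + 10 * w ^+ 3 * x ^+ 2 * y ^+ 3 + 5 * w ^+ 4 * x * y ^+ 4 + w ^+ 5 * y ^+ 5); first by ring.
by rewrite w2 w3 w4 w5; ring.
Qed.

(** Since [ring] cannot use w^2 = w + 1, the fifth powers are first reduced to the shape p + w q and
    multiplied in that shape with [gmul]; the remaining identity is linear in [w] and polynomial. *)
Lemma ico_f_mix w x y : w ^+ 2 = w + 1 ->
  ico_f (- w * x + y) (x + w * y) = 125 * w ^+ 6 * ico_f x y.
Proof.
move=> w2; have [w3 w4 w5 w6 _] := golden_pow w2.
pose a := (ico_a1 x y, ico_a2 x y); pose b := (ico_b1 x y, ico_b2 x y).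
transitivity ((- w * x + y) * (x + w * y) * (gval w a ^+ 2 + 11 * gval w a * gval w b - gval w b ^+ 2)).
  by rewrite -ico_aE // -ico_bE // /ico_f; ring.
have -> : (- w * x + y) * (x + w * y) = w * (y ^+ 2 - x * y - x ^+ 2).
  transitivity (- w * x ^+ 2 + (1 - w ^+ 2) * x * y + w * y ^+ 2); first by ring.
  by rewrite w2; ring.
rewrite [gval w a ^+ 2]expr2 [gval w b ^+ 2]expr2 -mulrA -!gvalM //.
(* The octic is the quotient of x^10 + 11 x^5 y^5 - y^10 by x^2 + x y - y^2, the factor supplied, up
   to sign, by the product of the two linear forms. *)
have -> : gval w (gmul a a) + 11 * gval w (gmul a b) - gval w (gmul b b)
    = - 125 * w ^+ 5 * (x * y * (x ^+ 8 - x ^+ 7 * y + 2 * x ^+ 6 * y ^+ 2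
      - 3 * x ^+ 5 * y ^+ 3 + 5 * x ^+ 4 * y ^+ 4 + 3 * x ^+ 3 * y ^+ 5
      + 2 * x ^+ 2 * y ^+ 6 + x * y ^+ 7 + y ^+ 8)).
  by rewrite w5 /gval /gmul /a /b /= /ico_a1 /ico_a2 /ico_b1 /ico_b2; ring.
by rewrite /ico_f (exprS w 5); ring.
Qed.

Lemma ico_h_mix w x y : w ^+ 2 = w + 1 ->
  ico_h (- w * x + y) (x + w * y) = 3125 * w ^+ 10 * ico_h x y.
Proof.
move=> w2; have [w3 w4 w5 w6 w10] := golden_pow w2.
pose a := (ico_a1 x y, ico_a2 x y); pose b := (ico_b1 x y, ico_b2 x y).
pose a2 := gmul a a; pose b2 := gmul b b; pose c := gmul a b.
transitivity (- gval w (gmul a2 a2) - gval w (gmul b2 b2)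
    + 228 * (gval w (gmul a2 c) - gval w (gmul c b2)) - 494 * gval w (gmul c c)).
  by rewrite !gvalM // -ico_aE // -ico_bE // /ico_h; ring.
by rewrite w10 /gval /gmul /a2 /b2 /c /gmul /a /b /ico_h /= /ico_a1 /ico_a2 /ico_b1 /ico_b2; ring.
Qed.

Lemma tet_t_diag u x y : u ^+ 4 = 1 -> tet_t x (u * y) = u * tet_t x y.
Proof. by move=> h; rewrite /tet_t exprMn h; ring. Qed.

Lemma tet_phi_diag s u x y : u ^+ 2 = 1 -> tet_phi s x (u * y) = tet_phi s x y.
Proof.
move=> h; have h4 : u ^+ 4 = 1 by rewrite (exprM u 2 2) h expr1n.
by rewrite /tet_phi !exprMn h h4; ring.
Qed.

Lemma oct_w_diag u x y : u ^+ 4 = 1 -> oct_w x (u * y) = oct_w x y.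
Proof.
move=> h; have h8 : u ^+ 8 = 1 by rewrite (exprM u 4 2) h expr1n.
by rewrite /oct_w !exprMn h h8; ring.
Qed.

Lemma oct_k_diag u x y : u ^+ 4 = 1 -> oct_k x (u * y) = oct_k x y.
Proof.
move=> h; have h8 : u ^+ 8 = 1 by rewrite (exprM u 4 2) h expr1n.
have h12 : u ^+ 12 = 1 by rewrite (exprM u 4 3) h expr1n.
by rewrite /oct_k !exprMn h h8 h12; ring.
Qed.

Lemma ico_f_diag u x y : u ^+ 5 = 1 -> ico_f x (u * y) = u * ico_f x y.
Proof.
move=> h; have h10 : u ^+ 10 = 1 by rewrite (exprM u 5 2) h expr1n.
by rewrite /ico_f !exprMn h h10; ring.
Qed.

Lemma ico_h_diag u x y : u ^+ 5 = 1 -> ico_h x (u * y) = ico_h x y.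
Proof.
move=> h; have h' n : u ^+ (5 * n) = 1 by rewrite exprM h expr1n.
by rewrite /ico_h !exprMn h (h' 2) (h' 3) (h' 4); ring.
Qed.

Lemma ico_t_diag u x y : u ^+ 5 = 1 -> ico_t x (u * y) = ico_t x y.
Proof.
move=> h; have h' n : u ^+ (5 * n) = 1 by rewrite exprM h expr1n.
by rewrite /ico_t !exprMn h (h' 2) (h' 4) (h' 5) (h' 6); ring.
Qed.

Lemma tet_rel0 s x y : s ^+ 2 = -3 -> - (12 * s) * tet_t x y ^+ 2
  + tet_phi s x y ^+ 3 + - tet_phi (- s) x y ^+ 3 = 0.
Proof. by move=> h; rewrite -addrA tet_rel // mulNr addNr. Qed.

Lemma oct_rel0 x y : - oct_k x y ^+ 2 + oct_w x y ^+ 3 + - 108 * tet_t x y ^+ 4 = 0.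
Proof. by rewrite mulNr -oct_rel; ring. Qed.

Lemma ico_rel0 x y : ico_t x y ^+ 2 + ico_h x y ^+ 3 + - 1728 * ico_f x y ^+ 5 = 0.
Proof. by rewrite ico_rel mulNr subrr. Qed.

End KleinForms.

Section KleinMorphisms.
Variables (B B' : comNzRingType) (f : {rmorphism B -> B'}).

Let fn n : f n%:R = n%:R. Proof. exact: rmorph_nat. Qed.
Let fX x n : f (x ^+ n) = f x ^+ n. Proof. exact: rmorphXn. Qed.
Let fM x y : f (x * y) = f x * f y. Proof. exact: rmorphM. Qed.
Let fD x y : f (x + y) = f x + f y. Proof. exact: rmorphD. Qed.
Let fN x : f (- x) = - f x. Proof. exact: rmorphN. Qed.
Let fE := (fD, fN, fM, fX, fn).

Lemma rmorph_tet_t x y : f (tet_t x y) = tet_t (f x) (f y).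
Proof. by rewrite /tet_t !fE. Qed.
Lemma rmorph_tet_phi s x y : f (tet_phi s x y) = tet_phi (f s) (f x) (f y).
Proof. by rewrite /tet_phi !fE. Qed.
Lemma rmorph_oct_w x y : f (oct_w x y) = oct_w (f x) (f y).
Proof. by rewrite /oct_w !fE. Qed.
Lemma rmorph_oct_k x y : f (oct_k x y) = oct_k (f x) (f y).
Proof. by rewrite /oct_k !fE. Qed.
Lemma rmorph_ico_f x y : f (ico_f x y) = ico_f (f x) (f y).
Proof. by rewrite /ico_f !fE. Qed.
Lemma rmorph_ico_h x y : f (ico_h x y) = ico_h (f x) (f y).
Proof. by rewrite /ico_h !fE. Qed.
Lemma rmorph_ico_t x y : f (ico_t x y) = ico_t (f x) (f y).
Proof. by rewrite /ico_t !fE. Qed.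
End KleinMorphisms.

Section KleinGroups.
Variable K : numClosedFieldType.
Local Notation S := {mpoly K[2]}.
Local Notation x := (@fx K).
Local Notation y := (@fy K).

Lemma sum_tri (f0 f1 f2 : S) (t0 t1 t2 : nat) :
  \sum_i tri f0 f1 f2 i ^+ tri t0 t1 t2 i = f0 ^+ t0 + f1 ^+ t1 + f2 ^+ t2.
Proof. by rewrite !big_ord_recl big_ord0 addr0 addrA. Qed.

Lemma semi_invariant_tri t0 t1 t2 (f0 f1 f2 : S) g c0 c1 c2 C :
  sub g f0 = c0 *: f0 -> sub g f1 = c1 *: f1 -> sub g f2 = c2 *: f2 ->
  c0 ^+ t0 = C -> c1 ^+ t1 = C -> c2 ^+ t2 = C ->
  semi_invariant (tri t0 t1 t2) (tri f0 f1 f2) g.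
Proof.
by move=> *; exists (tri c0 c1 c2), C; case=> [[|[|[|//]]] ?].
Qed.

Lemma sub_scale g l c (f : S) : sub g f = c *: f -> sub g (l *: f) = c *: (l *: f).
Proof. by move=> h; rewrite subZ h !scalerA mulrC. Qed.

Lemma homog_nat n : (n%:R : S) \is 0.-homog.
Proof. by apply: rpredMn; apply: dhomog1. Qed.
Lemma homog_x n : x ^+ n \is n.-homog.
Proof. by rewrite -[X in X.-homog]mul1n dhomogMn // dhomogX; apply/eqP; apply: mdeg1. Qed.
Lemma homog_y n : y ^+ n \is n.-homog.
Proof. by rewrite -[X in X.-homog]mul1n dhomogMn // dhomogX; apply/eqP; apply: mdeg1. Qed.
Lemma homog_monom a b : x ^+ a * y ^+ b \is (a + b).-homog.
Proof. by rewrite dhomogM ?homog_x ?homog_y. Qed.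
Lemma homog_mono n a b : n%:R * x ^+ a * y ^+ b \is (a + b).-homog.
Proof. by rewrite -mulrA -[X in X.-homog]add0n dhomogM ?homog_nat ?homog_monom. Qed.
Lemma homog_nmul m n (f : S) : f \is m.-homog -> n%:R * f \is m.-homog.
Proof. by move=> hf; rewrite -[X in X.-homog]add0n dhomogM ?homog_nat. Qed.
Lemma homog_cmul m c (f : S) : f \is m.-homog -> c%:MP * f \is m.-homog.
Proof. by move=> hf; rewrite mul_mpolyC rpredZ. Qed.

Lemma homog_xy : x * y \is 2.-homog.
Proof. exact: (homog_monom 1 1). Qed.
Lemma homog_tet_t : tet_t x y \is 6.-homog.
Proof. by apply: (@dhomogM _ _ _ 2 _ 4); [exact: homog_xy|apply: rpredB; rewrite ?homog_x ?homog_y]. Qed.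
Lemma homog_tet_phi s : tet_phi s%:MP x y \is 4.-homog.
Proof.
apply: rpredD; [apply: rpredD|]; rewrite ?homog_x ?homog_y //.
rewrite -[2 * _ * _ * _]mulrA -[2 * _ * _]mulrA.
by apply: homog_nmul; apply: homog_cmul; apply: (homog_monom 2 2).
Qed.
Lemma homog_oct_w : oct_w x y \is 8.-homog.
Proof.
apply: rpredD; [apply: rpredD|]; rewrite ?homog_x ?homog_y //; exact: (homog_mono _ 4 4).
Qed.
Lemma homog_oct_k : oct_k x y \is 12.-homog.
Proof.
apply: rpredD; [apply: rpredB; [apply: rpredB|]|]; rewrite ?homog_x ?homog_y //.
  exact: (homog_mono _ 8 4).
exact: (homog_mono _ 4 8).
Qed.
Lemma homog_ico_f : ico_f x y \is 12.-homog.
Proof.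
apply: (@dhomogM _ _ _ 2 _ 10); first exact: homog_xy.
apply: rpredB; [apply: rpredD|]; rewrite ?homog_x ?homog_y //; exact: (homog_mono _ 5 5).
Qed.
Lemma homog_ico_h : ico_h x y \is 20.-homog.
Proof.
apply: rpredB; [apply: rpredD|].
- by apply: rpredNr; apply: rpredD; rewrite ?homog_x ?homog_y.
- apply: homog_nmul; apply: rpredB; [exact: (homog_monom 15 5)|exact: (homog_monom 5 15)].
- exact: (homog_mono _ 10 10).
Qed.
Lemma homog_ico_t : ico_t x y \is 30.-homog.
Proof.
apply: rpredB; [apply: rpredD|].
- by apply: rpredD; rewrite ?homog_x ?homog_y.
- apply: homog_nmul; apply: rpredB; [exact: (homog_monom 25 5)|exact: (homog_monom 5 25)].
- apply: homog_nmul; apply: rpredD; [exact: (homog_monom 20 10)|exact: (homog_monom 10 20)].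
Qed.

Lemma mevalx v : x.@[v] = v ord0. Proof. exact: mevalXU. Qed.
Lemma mevaly v : y.@[v] = v ord_max. Proof. exact: mevalXU. Qed.

Lemma zero_vec (v : 'I_2 -> K) : v ord0 = 0 -> v ord_max = 0 -> forall j, v j = 0.
Proof.
move=> h0 h1; case=> [[|[|//]] hj]; [rewrite -[RHS]h0|rewrite -[RHS]h1]; congr v; exact: val_inj.
Qed.

Lemma sub_idx z : sub (mx2 (1, 0, 0, z)) x = x.
Proof. by rewrite sub_mx2x mpolyC1 mpolyC0 mul1r mul0r addr0. Qed.
Lemma sub_idy z : sub (mx2 (1, 0, 0, z)) y = z%:MP * y.
Proof. by rewrite sub_mx2y mpolyC0 mul0r add0r. Qed.
Lemma sub_swx : sub (mx2 (0, 1, 1, 0)) x = y.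
Proof. by rewrite sub_mx2x mpolyC1 mpolyC0 mul1r mul0r add0r. Qed.
Lemma sub_swy : sub (mx2 (0, 1, 1, 0)) y = x.
Proof. by rewrite sub_mx2y mpolyC1 mpolyC0 mul1r mul0r addr0. Qed.

Lemma mpolyCX (c : K) n : (c ^+ n)%:MP_[2] = c%:MP ^+ n.
Proof. exact: rmorphXn. Qed.
Lemma mpolyCn n : (n%:R : K)%:MP_[2] = n%:R.
Proof. exact: rmorph_nat. Qed.

Lemma semi_invariant_id t (F : 'I_3 -> S) : semi_invariant t F (mx2 (1, 0, 0, 1)).
Proof.
have -> : mx2 (1, 0, 0, 1) = 1 :> 'M[K]_2.
  by apply/matrixP => i j; rewrite !mxE; case: i j => [[|[|//]] ?] [[|[|//]] ?].
by exists (fun=> 1), 1 => i; rewrite sub1 scale1r expr1n.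
Qed.

Lemma polyhedral_dihedral m : (2 <= m)%N -> polyhedral K (tri 2 2 m).
Proof.
move=> m2; have m0 : (0 < m)%N by lia.
have [zs [uz sz hz]] := unity_roots K m0.
(* The relation is (x^m + y^m)^2 - (x^m - y^m)^2 = 4 (x y)^m; the factor ['i] and this root absorb
   its constants. *)
pose l := m.-root (- 4 : K).
have lm : l ^+ m = - 4 by rewrite rootCK.
apply: (@polyhedral_intro K _ (tri (x ^+ m + y ^+ m) ('i *: (x ^+ m - y ^+ m)) (l *: (x * y)))
  (tri m m 2) (2 * m) zs [:: (1, 0, 0, 1); (0, 1, 1, 0)]) => //.
- case=> [[|[|[|//]]] ?] /=; split=> //; rewrite /tri /=; try lia; try apply: rpredZ.
  + by rewrite rpredD ?homog_x ?homog_y.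
  + by rewrite rpredB ?homog_x ?homog_y.
  + exact: homog_xy.
- rewrite sum_tri !exprZn sqrCi lm exprMn -[(- 4) *: _]mul_mpolyC mpolyCN mpolyCn scaleN1r.
  set a := x ^+ m; set b := y ^+ m; ring.
- move=> v hv; have := hv ord0; have := hv (@Ordinal 3 1 isT); rewrite /tri /=.
  rewrite mevalZ mevalB mevalD !rmorphXn /= mevalx mevaly => /eqP.
  rewrite mulf_eq0 (negbTE (neq0Ci _)) /= subr_eq0 => /eqP ->.
  move=> /eqP; rewrite -mulr2n mulrn_eq0 /= expf_eq0 => /andP[_ /eqP h1].
  move: (hv (@Ordinal 3 1 isT)); rewrite /tri /= mevalZ mevalB !rmorphXn /= mevalx mevaly h1.
  rewrite [X in _ - X]expr0n (gtn_eqF m0) subr0 => /eqP.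
  rewrite mulf_eq0 (negbTE (neq0Ci _)) /= expf_eq0 => /andP[_ /eqP h0].
  exact: zero_vec.
- rewrite /= andbT inE; apply/negP => /eqP[] /eqP; by rewrite oner_eq0.
- by rewrite sz /= mulnC.
- by move=> z /hz; apply: contra_eq_neq => ->; rewrite expr0n (gtn_eqF m0) eq_sym oner_eq0.
- move=> z zz; apply: (@semi_invariant_tri _ _ _ _ _ _ _ 1 1 z 1); rewrite ?expr1n ?hz //.
  + by rewrite subD !subX sub_idx sub_idy exprMn -mpolyCX hz // mpolyC1 mul1r scale1r.
  + by apply: sub_scale; rewrite subD subN !subX sub_idx sub_idy exprMn -mpolyCX hz // mpolyC1 mul1r scale1r.
  + by apply: sub_scale; rewrite sub_mul sub_idx sub_idy -mul_mpolyC; ring.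
- move=> q; rewrite !inE => /orP[]/eqP ->.
    exact: semi_invariant_id.
  apply: (@semi_invariant_tri _ _ _ _ _ _ _ 1 (-1) 1 1); rewrite ?expr1n ?sqrrN ?expr1n //.
  + by rewrite subD !subX sub_swx sub_swy scale1r addrC.
  + by apply: sub_scale; rewrite subD subN !subX sub_swx sub_swy scaleN1r opprB.
  + by apply: sub_scale; rewrite sub_mul sub_swx sub_swy scale1r mulrC.
- move=> q; rewrite !inE => /orP[]/eqP ->; rewrite ?mulr0 ?mulr1 ?subr0 ?sub0r ?oppr_eq0 oner_eq0 //.
- move=> q q'; rewrite !inE => /orP[]/eqP -> /orP[]/eqP ->; rewrite ?(mul0r, mulr0, mulr1) //.
  by move=> /eqP; rewrite oner_eq0.
  by move=> /eqP; rewrite eq_sym oner_eq0.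
Qed.

(** In the three exceptional groups the orbit of [1 : 0] consists of [1 : 0], [0 : 1] and points
    [1 : b] with b nonzero, so its points are distinct as soon as the entries b are. *)
Lemma polyhedral_intro1 (t : 'I_3 -> nat) (F : 'I_3 -> S) (hd : 'I_3 -> nat) (h k : nat)
    (zs : seq K) (e : K) (qs : seq (K * K * K * K)) :
  (forall i, [/\ F i \is (hd i).-homog, (0 < hd i)%N & (hd i * t i = h)%N]) ->
  \sum_i F i ^+ t i = 0 ->
  (forall v, (forall i, (F i).@[v] = 0) -> v ord0 = 0 /\ v ord_max = 0) ->
  (0 < k)%N -> e != 0 -> uniq zs -> uniq [seq q.1.1.2 | q <- qs] ->
  (size zs * (size qs).+2 = h)%N ->
  {in zs, forall z, z ^+ k = 1} ->
  {in zs, forall z, semi_invariant t F (mx2 (1, 0, 0, z))} ->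
  semi_invariant t F (mx2 (0, 1, e, 0)) ->
  {in qs, forall q, semi_invariant t F (mx2 q)} ->
  {in qs, forall q, [/\ q.1.1.1 = 1, q.1.1.2 != 0 & q.2 - q.1.1.2 * q.1.2 != 0]} ->
  polyhedral K t.
Proof.
move=> hF rel nz k0 e0 uz uq sz hz iz ie iq hq.
have inj : {in qs &, injective (fun q : K * K * K * K => q.1.1.2)}.
  move=> q q' hq1 hq2 eqq; apply/eqP.
  have := uq; rewrite -(nth_index q hq1) -(nth_index q hq2).
  move=> /uniqP-/(_ 0) U; rewrite [index q qs](U (index q qs) (index q' qs)) //.
  - by rewrite inE size_map index_mem.
  - by rewrite inE size_map index_mem.
  - by rewrite !(nth_map q) ?index_mem // !nth_index.
apply: (@polyhedral_intro K t F hd h zs [:: (1, 0, 0, 1), (0, 1, e, 0) & qs]) => //.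
- by move=> v /nz[h0 h1]; exact: zero_vec.
- rewrite /= (map_uniq uq) andbT inE negb_or -andbA; apply/and3P; split.
  + by apply/negP => /eqP[] /eqP; rewrite oner_eq0.
  + by apply/negP => /hq[_ /=]; rewrite eqxx.
  + by apply/negP => /hq[/= /esym /eqP]; rewrite oner_eq0.
- by move=> z /hz; apply: contra_eq_neq => ->; rewrite expr0n (gtn_eqF k0) eq_sym oner_eq0.
- move=> q; rewrite !inE => /or3P[/eqP ->|/eqP ->|/iq //]; last exact: ie.
  exact: semi_invariant_id.
- move=> q; rewrite !inE => /or3P[/eqP ->|/eqP ->|/hq].
  + by rewrite mulr1 mul0r subr0 oner_eq0.
  + by rewrite mul0r mul1r sub0r oppr_eq0.
  + by case: q => [[[a b] c] d] [/= -> _]; rewrite mul1r.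
- have N1 : (1 : K) <> 0 by apply/eqP; rewrite oner_eq0.
  move=> q q'; rewrite !inE => /or3P[/eqP ->|/eqP ->|h1] /or3P[/eqP ->|/eqP ->|h2] //.
  + by rewrite mulr1 mul0r => /N1.
  + case: q' h2 => [[[a b] c] d] /hq[/= -> b0 _]; rewrite mul1r mul0r => b00.
    by rewrite b00 eqxx in b0.
  + by rewrite mulr1 mul0r => /esym/N1.
  + by case: q' h2 => [[[a b] c] d] /hq[/= -> b0 _]; rewrite mul1r mul0r => /esym/N1.
  + case: q h1 => [[[a b] c] d] /hq[/= -> b0 _]; rewrite mulr0 mulr1 => b00.
    by rewrite -b00 eqxx in b0.
  + by case: q h1 => [[[a b] c] d] /hq[/= -> b0 _]; rewrite mulr0 mulr1 => /N1.
  + move: (inj q q' h1 h2) (hq _ h1) (hq _ h2).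
    case: q q' {h1 h2} => [[[a b] c] d] [[[a' b'] c'] d'] /= H [ea _ _] [ea' _ _].
    by move=> bb; apply: H; rewrite -[b]mulr1 -[b']mul1r -{1}ea' -{1}ea bb.
Qed.

Lemma evaltt v : (tet_t x y).@[v] = tet_t (v ord0) (v ord_max).
Proof. by rewrite rmorph_tet_t /= mevalx mevaly. Qed.

Lemma tet_t_eq0 (a b : K) : tet_t a b = 0 -> [\/ a = 0, b = 0 | a ^+ 4 = b ^+ 4].
Proof.
move=> /eqP; rewrite /tet_t !mulf_eq0 subr_eq0 => /orP[/orP[]|] /eqP h.
- by constructor 1.
- by constructor 2.
- by constructor 3.
Qed.

Lemma natK_neq0 n : (n.+1%:R : K) != 0. Proof. by rewrite pnatr_eq0. Qed.

(** The orbit of [1 : 0] is the zero set of [tet_t]: 0, infinity and the fourth roots of unity. With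
    the four matrices diag(1, u) this gives 6 * 4 = 24 elements. *)
Lemma polyhedral_octahedral : polyhedral K (tri 2 3 4).
Proof.
have [us [uu su hu]] := unity_roots K (isT : (0 < 4)%N).
pose l := 4.-root (- 108 : K).
have l4 : l ^+ 4 = - 108 by rewrite rootCK.
apply: (@polyhedral_intro1 _ (tri ('i *: oct_k x y) (oct_w x y) (l *: tet_t x y))
  (tri 12 8 6) 24 4 us 1 [seq (1, u, 1, - u) | u <- us]) => //.
- case=> [[|[|[|//]]] ?] /=; split=> //; rewrite /tri /=; try apply: rpredZ.
  + exact: homog_oct_k.
  + exact: homog_oct_w.
  + exact: homog_tet_t.
- rewrite sum_tri !exprZn sqrCi l4 -[(- 108) *: _]mul_mpolyC mpolyCN mpolyCn scaleN1r.
  exact: oct_rel0.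
- move=> v hv; have := hv ord_max; have := hv (@Ordinal 3 1 isT); rewrite /tri /=.
  rewrite rmorph_oct_w mevalZ evaltt /= mevalx mevaly.
  set a := v ord0; set b := v ord_max => hw /eqP; rewrite mulf_eq0 => /orP[/eqP l0|/eqP].
    by move: l4 => /eqP; rewrite l0 expr0n /= eq_sym oppr_eq0 (negbTE (natK_neq0 107)).
  have h8 (c d : K) (n : nat) : (0 < n)%N -> d != 0 -> d * c ^+ n = 0 -> c = 0.
    by move=> n0 d0 /eqP; rewrite mulf_eq0 (negbTE d0) expf_eq0 n0 => /eqP.
  move/tet_t_eq0 => [a0|b0|ab].
  + split=> //; apply: (h8 _ 1 8) => //; first exact: oner_neq0.
    by rewrite -hw a0 /oct_w; ring.
  + split=> //; apply: (h8 _ 1 8) => //; first exact: oner_neq0.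
    by rewrite -hw b0 /oct_w; ring.
  + have a0 : a = 0.
      apply: (h8 _ 16 8) => //; first exact: (natK_neq0 15).
      rewrite -hw /oct_w (exprM b 4 2) -ab; ring.
    split=> //; apply: (h8 _ 1 4) => //; first exact: oner_neq0.
    by rewrite -ab a0; ring.
- exact: oner_neq0.
- by rewrite -map_comp map_id_in.
- by rewrite size_map su.
- move=> z /hu z4.
  have Z4 : (z%:MP_[2]) ^+ 4 = 1 by rewrite -mpolyCX z4 mpolyC1.
  apply: (@semi_invariant_tri _ _ _ _ _ _ _ 1 1 z 1); rewrite ?expr1n //.
  + by apply: sub_scale; rewrite rmorph_oct_k /= sub_idx sub_idy scale1r oct_k_diag.
  + by rewrite rmorph_oct_w /= sub_idx sub_idy scale1r oct_w_diag.
  + by apply: sub_scale; rewrite rmorph_tet_t /= sub_idx sub_idy -mul_mpolyC tet_t_diag.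
- apply: (@semi_invariant_tri _ _ _ _ _ _ _ 1 1 (-1) 1); rewrite ?expr1n //.
  + by apply: sub_scale; rewrite rmorph_oct_k /= sub_swx sub_swy scale1r /oct_k; ring.
  + by rewrite rmorph_oct_w /= sub_swx sub_swy scale1r /oct_w; ring.
  + by apply: sub_scale; rewrite rmorph_tet_t /= sub_swx sub_swy scaleN1r /tet_t; ring.
  + by ring.
- move=> q /mapP[u /hu u4 ->].
  have U4 : (u%:MP_[2]) ^+ 4 = 1 by rewrite -mpolyCX u4 mpolyC1.
  have Ex : sub (mx2 (1, u, 1, - u)) x = x + y by rewrite sub_mx2x mpolyC1 !mul1r.
  have Ey : sub (mx2 (1, u, 1, - u)) y = u%:MP * (x - y).
    by rewrite sub_mx2y mpolyCN; ring.
  apply: (@semi_invariant_tri _ _ _ _ _ _ _ (- 64) 16 (8 * u) 4096).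
  + apply: sub_scale; rewrite rmorph_oct_k /= Ex Ey oct_k_mix // -mul_mpolyC mpolyCN mpolyCn.
    by [].
  + by rewrite rmorph_oct_w /= Ex Ey oct_w_mix // -mul_mpolyC mpolyCn.
  + apply: sub_scale; rewrite rmorph_tet_t /= Ex Ey -[y]mul1r tet_t_mix ?expr1n //.
    by rewrite -mul_mpolyC mpolyCM mpolyCn mul1r mulr1.
  + ring.
  + ring.
  + by rewrite exprMn u4; ring.
- move=> q /mapP[u /hu u4 ->] /=.
  have u0 : u != 0.
    by apply/eqP => u0; move/eqP: u4; rewrite u0 expr0n eq_sym oner_eq0.
  split=> //; rewrite mulr1 -opprD oppr_eq0 -mulr2n mulrn_eq0 //.
Qed.
End KleinGroups.

Section Icosahedral.
Variable K : numClosedFieldType.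
Local Notation S := {mpoly K[2]}.
Local Notation x := (@fx K).
Local Notation y := (@fy K).

Lemma meval_tet_phi s v : (tet_phi s%:MP x y).@[v] = tet_phi s (v ord0) (v ord_max).
Proof. by rewrite rmorph_tet_phi /= mevalx mevaly mevalC. Qed.

Lemma polyhedral_tetrahedral : polyhedral K (tri 2 3 3).
Proof.
have [us [uu su hu]] := unity_roots K (isT : (0 < 4)%N).
pose s : K := sqrtC (- 3).
have s2 : s ^+ 2 = - 3 by rewrite sqrtCK.
have S2 : (s%:MP_[2]) ^+ 2 = -3 by rewrite -mpolyCX s2 mpolyCN mpolyCn.
have Sn : - s%:MP_[2] = (- s)%:MP by rewrite mpolyCN.
have s0 : s != 0 by apply/eqP => s0; move/eqP: s2; rewrite s0 expr0n eq_sym oppr_eq0 (negbTE (natK_neq0 K 2)).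
pose l : K := sqrtC (- (12 * s)).
have l2 : l ^+ 2 = - (12 * s) by rewrite sqrtCK.
have l0 : l != 0.
  apply/eqP => l0; move/eqP: l2; rewrite l0 expr0n eq_sym oppr_eq0 mulf_eq0 (negbTE s0).
  by rewrite orbF (negbTE (natK_neq0 K 11)).
have rel0 : \sum_i tri (l *: tet_t x y) (tet_phi s%:MP x y) ((-1) *: tet_phi (- s)%:MP x y) i
      ^+ tri 2 3 3 i = 0 :> S.
  rewrite sum_tri !exprZn l2 -Sn -[(- (12 * s)) *: _]mul_mpolyC mpolyCN mpolyCM mpolyCn.
  rewrite -[(-1) ^+ 3]signr_odd /= expr1 scaleN1r; exact: tet_rel0.
(* The six points are those of the octahedron, but only z = 1, -1 stabilize [1 : 0]. The entry v = i
   u satisfies v^2 = - u^2, as [tet_phi_mix] demands. *)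
apply: (@polyhedral_intro1 K _ (tri (l *: tet_t x y) (tet_phi s%:MP x y) ((-1) *: tet_phi (- s)%:MP x y))
  (tri 6 4 4) 12 2 [:: 1; -1] 1 [seq (1, u, 'i * u, - ('i * u) * u) | u <- us]) => //.
- case=> [[|[|[|//]]] ?] /=; split=> //; rewrite /tri /=; try apply: rpredZ.
  + exact: homog_tet_t.
  + exact: homog_tet_phi.
  + exact: homog_tet_phi.
- move=> v hv; pose a := v ord0; pose b := v ord_max.
  have hp : tet_phi s a b = 0 by rewrite -meval_tet_phi; apply: (hv (@Ordinal 3 1 isT)).
  have hm : tet_phi (- s) a b = 0.
    have : ((-1) *: tet_phi (- s)%:MP x y).@[v] = 0 := hv ord_max.
    by rewrite mevalZ meval_tet_phi mulN1r => /eqP; rewrite oppr_eq0 => /eqP.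
  have : (l *: tet_t x y).@[v] = 0 := hv ord0.
  rewrite mevalZ evaltt => /eqP; rewrite mulf_eq0 (negbTE l0) /= => /eqP.
  have h4 (c d : K) (n : nat) : (0 < n)%N -> d != 0 -> d * c ^+ n = 0 -> c = 0.
    by move=> n0 d0 /eqP; rewrite mulf_eq0 (negbTE d0) expf_eq0 n0 => /eqP.
  have add : a ^+ 4 + b ^+ 4 = 0.
    apply/eqP; have /eqP : 2 * (a ^+ 4 + b ^+ 4) = 0.
      by transitivity (tet_phi s a b + tet_phi (- s) a b); [rewrite /tet_phi; ring|rewrite hp hm addr0].
    by rewrite mulf_eq0 (negbTE (natK_neq0 K 1)).
  move/tet_t_eq0 => [a0|b0|ab].
  + split=> //; apply: (h4 _ 1 4) => //; first exact: oner_neq0.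
    by rewrite -[RHS]add /a /b a0; ring.
  + split=> //; apply: (h4 _ 1 4) => //; first exact: oner_neq0.
    by rewrite -[RHS]add /a /b b0; ring.
  + split; apply: (h4 _ 2 4) => //; rewrite ?natK_neq0 // -add.
      by rewrite /a /b -ab; ring.
    by rewrite /a /b ab; ring.
- exact: oner_neq0.
- by rewrite /= andbT inE -subr_eq0 opprK; exact: (natK_neq0 K 1).
- by rewrite -map_comp map_id_in.
- by rewrite size_map su.
- by move=> z; rewrite !inE => /orP[]/eqP ->; rewrite ?sqrrN expr1n.
- move=> z hz; have z2 : z ^+ 2 = 1 by move: hz; rewrite !inE => /orP[]/eqP ->; rewrite ?sqrrN expr1n.
  have Z2 : (z%:MP_[2]) ^+ 2 = 1 by rewrite -mpolyCX z2 mpolyC1.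
  have Z4 : (z%:MP_[2]) ^+ 4 = 1 by rewrite (exprM _ 2 2) Z2 expr1n.
  apply: (@semi_invariant_tri _ _ _ _ _ _ _ _ z 1 1 1); rewrite ?expr1n //.
  + by apply: sub_scale; rewrite rmorph_tet_t /= sub_idx sub_idy -mul_mpolyC tet_t_diag.
  + by rewrite rmorph_tet_phi /= subC sub_idx sub_idy scale1r tet_phi_diag.
  + by apply: sub_scale; rewrite rmorph_tet_phi /= subC sub_idx sub_idy scale1r tet_phi_diag.
- apply: (@semi_invariant_tri _ _ _ _ _ _ _ _ (-1) 1 1 1); rewrite ?sqrrN ?expr1n //.
  + by apply: sub_scale; rewrite rmorph_tet_t /= sub_swx sub_swy scaleN1r /tet_t; ring.
  + by rewrite rmorph_tet_phi /= subC sub_swx sub_swy scale1r /tet_phi; ring.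
  + by apply: sub_scale; rewrite rmorph_tet_phi /= subC sub_swx sub_swy scale1r /tet_phi; ring.
- move=> q /mapP[u /hu u4 ->]; pose v := 'i * u.
  have v2 : v ^+ 2 = - u ^+ 2 by rewrite exprMn sqrCi mulN1r.
  have v4 : v ^+ 4 = 1 by rewrite (exprM v 2 2) v2 sqrrN -exprM.
  have U4 : (u%:MP_[2]) ^+ 4 = 1 by rewrite -mpolyCX u4 mpolyC1.
  have V4 : (v%:MP_[2]) ^+ 4 = 1 by rewrite -mpolyCX v4 mpolyC1.
  have V2 : (v%:MP_[2]) ^+ 2 = - (u%:MP) ^+ 2 by rewrite -!mpolyCX v2 mpolyCN.
  have Ex : sub (mx2 (1, u, v, - v * u)) x = x + v%:MP * y by rewrite sub_mx2x mpolyC1 !mul1r.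
  have Ey : sub (mx2 (1, u, v, - v * u)) y = u%:MP * (x - v%:MP * y).
    by rewrite sub_mx2y mpolyCM mpolyCN; ring.
  (* As u^2 is 1 or -1, c u^2 is again a square root of -3, so the base is 4 times a primitive sixth
     root of unity. *)
  have cube (c : K) : c ^+ 2 = - 3 -> (2 + 2 * c * u ^+ 2) ^+ 3 = - 64.
    move=> c2; transitivity (8 * (1 + 3 * c * u ^+ 2 + 3 * c ^+ 2 * u ^+ 4 + c ^+ 2 * c * u ^+ 4 * u ^+ 2)).
      by ring.
    by rewrite u4 c2; ring.
  apply: (@semi_invariant_tri _ _ _ _ _ _ _ _ (8 * u * v) (2 + 2 * s * u ^+ 2) (2 + 2 * (- s) * u ^+ 2) (- 64)).
  + apply: sub_scale; rewrite rmorph_tet_t /= Ex Ey tet_t_mix //.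
    by rewrite -mul_mpolyC !mpolyCM mpolyCn.
  + rewrite rmorph_tet_phi /= subC Ex Ey tet_phi_mix //.
    by rewrite -mul_mpolyC mpolyCD mpolyCM mpolyCX mpolyCM !mpolyCn.
  + apply: sub_scale; rewrite rmorph_tet_phi /= subC Ex Ey tet_phi_mix // -?Sn ?sqrrN //.
    by rewrite -mul_mpolyC mpolyCD mpolyCM mpolyCX mpolyCM mpolyCN !mpolyCn.
  + by rewrite 2!exprMn v2; transitivity (- 64 * u ^+ 4); [ring|rewrite u4; ring].
  + exact: cube.
  + by apply: cube; rewrite sqrrN.
- move=> q /mapP[u /hu u4 ->] /=.
  have u0 : u != 0.
    by apply/eqP => u0; move/eqP: u4; rewrite u0 expr0n eq_sym oner_eq0.
  split=> //; rewrite mulNr [u * _]mulrC -opprD oppr_eq0 -mulr2n mulrn_eq0 /=.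
  by rewrite !mulf_neq0 ?neq0Ci.
Qed.

Lemma mx2_mul (a b c d a' b' c' d' : K) : mx2 (a, b, c, d) * mx2 (a', b', c', d') =
  mx2 (a * a' + b * c', a * b' + b * d', c * a' + d * c', c * b' + d * d').
Proof.
apply/matrixP => i j; rewrite -[_ * _]/(_ *m _) !mxE big_ord_recl big_ord1 !mxE /=.
by case: (i == ord0); case: (j == ord0).
Qed.

(** The twelve zeros of [ico_f] are [1 : 0], [0 : 1] and the points [1 : v u] with u^5 = 1 and v one
    of the two roots of v^2 = v + 1; with the five matrices diag(1, u) this gives 60 elements. *)
Lemma polyhedral_icosahedral : polyhedral K (tri 2 3 5).
Proof.
have [us [uu su hu]] := unity_roots K (isT : (0 < 5)%N).
pose w : K := (1 + sqrtC 5) / 2.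
have two0 := natK_neq0 K 1.
have w2 : w ^+ 2 = w + 1.
  have := sqrtCK (5 : K); rewrite /w; set r := sqrtC _ => r2.
  rewrite expr_div_n; transitivity ((1 + 2 * r + r ^+ 2) / 2 ^+ 2); first by congr (_ / _); ring.
  by rewrite r2; field.
pose w' := 1 - w.
have w'2 : w' ^+ 2 = w' + 1.
  by rewrite /w'; transitivity (1 - 2 * w + w ^+ 2); [ring|rewrite w2; ring].
have ww' : w != w'.
  apply/eqP => e; have e2 : 2 * w = 1 by rewrite mulr2n mulrDl mul1r {2}e /w'; ring.
  have : (2 * w) ^+ 2 = 2 * (2 * w) + 4.
    by rewrite exprMn w2; ring.
  rewrite e2 expr1n => /eqP; rewrite -subr_eq0.
  have -> : 1 - (2 * 1 + 4) = - 5 :> K by ring.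
  by rewrite oppr_eq0 (negbTE (natK_neq0 K 4)).
have wn0 (v : K) : v ^+ 2 = v + 1 -> v != 0.
  by move=> h; apply/eqP => v0; move: h; rewrite v0 expr0n /= add0r => /esym/eqP; rewrite oner_eq0.
pose l := 5.-root (- 1728 : K).
have l5 : l ^+ 5 = - 1728 by rewrite rootCK.
have l0 : l != 0.
  apply/eqP => l0; move/eqP: l5; rewrite l0 expr0n /= eq_sym oppr_eq0 (negbTE (natK_neq0 K _)) //.
pose F := tri (ico_t x y) (ico_h x y) (l *: ico_f x y).
pose q v u : K * K * K * K := (1, v * u, v, - u).
have rel : \sum_i F i ^+ tri 2 3 5 i = 0.
  rewrite sum_tri exprZn l5 -mul_mpolyC mpolyCN mpolyCn; exact: ico_rel0.
have hdiag z : z ^+ 5 = 1 -> semi_invariant (tri 2 3 5) F (mx2 (1, 0, 0, z)).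
  move=> z5; have Z5 : (z%:MP_[2]) ^+ 5 = 1 by rewrite -mpolyCX z5 mpolyC1.
  apply: (@semi_invariant_tri _ _ _ _ _ _ _ _ 1 1 z 1); rewrite ?expr1n //.
  + by rewrite rmorph_ico_t /= sub_idx sub_idy scale1r ico_t_diag.
  + by rewrite rmorph_ico_h /= sub_idx sub_idy scale1r ico_h_diag.
  + by apply: sub_scale; rewrite rmorph_ico_f /= sub_idx sub_idy -mul_mpolyC ico_f_diag.
have hS : semi_invariant (tri 2 3 5) F (mx2 (0, 1, -1, 0)).
  have Ex : sub (mx2 (0, 1, -1, 0)) x = - y by rewrite sub_mx2x mpolyC0 mpolyCN mpolyC1; ring.
  have Ey : sub (mx2 (0, 1, -1, 0)) y = x by rewrite sub_mx2y mpolyC0 mpolyC1; ring.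
  apply: (@semi_invariant_tri _ _ _ _ _ _ _ _ 1 1 1 1); rewrite ?expr1n //.
  + by rewrite rmorph_ico_t /= Ex Ey scale1r /ico_t; ring.
  + by rewrite rmorph_ico_h /= Ex Ey scale1r /ico_h; ring.
  + by apply: sub_scale; rewrite rmorph_ico_f /= Ex Ey scale1r /ico_f; ring.
have hT v : v ^+ 2 = v + 1 -> semi_invariant (tri 2 3 5) F (mx2 (- v, 1, 1, v)).
  move=> v2; have V2 : v%:MP_[2] ^+ 2 = v%:MP + 1 by rewrite -mpolyCX v2 mpolyCD mpolyC1.
  have Ex : sub (mx2 (- v, 1, 1, v)) x = - v%:MP * x + y by rewrite sub_mx2x mpolyCN mpolyC1 mul1r.
  have Ey : sub (mx2 (- v, 1, 1, v)) y = x + v%:MP * y by rewrite sub_mx2y mpolyC1 mul1r.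
  have Ef : sub (mx2 (- v, 1, 1, v)) (ico_f x y) = (125 * v ^+ 6) *: ico_f x y.
    by rewrite rmorph_ico_f /= Ex Ey ico_f_mix // -mul_mpolyC mpolyCM mpolyCn mpolyCX.
  have Eh : sub (mx2 (- v, 1, 1, v)) (ico_h x y) = (3125 * v ^+ 10) *: ico_h x y.
    by rewrite rmorph_ico_h /= Ex Ey ico_h_mix // -mul_mpolyC mpolyCM mpolyCn mpolyCX.
  pose C : K := (3125 * v ^+ 10) ^+ 3.
  have C5 : (125 * v ^+ 6) ^+ 5 = C by rewrite /C; ring.
  (* The relation determines the square of the image of [ico_t]. *)
  have Et2 : sub (mx2 (- v, 1, 1, v)) (ico_t x y) ^+ 2 = (sqrtC C *: ico_t x y) ^+ 2.
    have Er : ico_t x y ^+ 2 = 1728 * ico_f x y ^+ 5 - ico_h x y ^+ 3 by rewrite -ico_rel addrK.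
    rewrite exprZn sqrtCK Er -subX Er subD subN sub_mul !subX Ef Eh !exprZn C5 -/C.
    by rewrite -mpolyCn subC -scalerAr scalerBr.
  have [e|e] : sub (mx2 (- v, 1, 1, v)) (ico_t x y) = sqrtC C *: ico_t x y \/
      sub (mx2 (- v, 1, 1, v)) (ico_t x y) = (- sqrtC C) *: ico_t x y.
    by move/eqP: Et2; rewrite eqf_sqr => /orP[]/eqP ->; [left|right; rewrite scaleNr].
    apply: (@semi_invariant_tri _ _ _ _ _ _ _ _ (sqrtC C) _ _ C e Eh (sub_scale _ Ef)) => //.
    by rewrite sqrtCK.
  apply: (@semi_invariant_tri _ _ _ _ _ _ _ _ (- sqrtC C) _ _ C e Eh (sub_scale _ Ef)) => //.
  by rewrite sqrrN sqrtCK.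
have hq v u : v ^+ 2 = v + 1 -> u ^+ 5 = 1 -> semi_invariant (tri 2 3 5) F (mx2 (q v u)).
  move=> v2 u5; have -> : mx2 (q v u) = mx2 (0, 1, -1, 0) * mx2 (- v, 1, 1, v) * mx2 (1, 0, 0, u).
    by rewrite !mx2_mul /q; congr mx2; congr (_, _, _, _); ring.
  by apply: semi_invariantM; [apply: semi_invariantM; [exact: hS|exact: hT]|exact: hdiag].
have un0 (u : K) : u ^+ 5 = 1 -> u != 0.
  by move=> h; apply/eqP => u0; move/eqP: h; rewrite u0 expr0n eq_sym oner_eq0.
apply: (@polyhedral_intro1 K _ F (tri 30 20 12) 60 5 us (-1)
   ([seq q w u | u <- us] ++ [seq q w' u | u <- us])) => //.
- case=> [[|[|[|//]]] ?] /=; split=> //; rewrite /F /tri /=; try apply: rpredZ.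
  + exact: homog_ico_t.
  + exact: homog_ico_h.
  + exact: homog_ico_f.
- move=> v hv; have := hv ord_max; have := hv (@Ordinal 3 1 isT); rewrite /F /tri /=.
  rewrite mevalZ !(rmorph_ico_h, rmorph_ico_f) /= mevalx mevaly.
  set a := v ord0; set b := v ord_max => hH /eqP.
  rewrite mulf_eq0 (negbTE l0) /= /ico_f !mulf_eq0 subr_eq0 => hf.
  move=> {hv}; have h20 (c : K) (n : nat) : (0 < n)%N -> - c ^+ n = 0 -> c = 0.
    by move=> n0 /eqP; rewrite oppr_eq0 expf_eq0 n0 => /eqP.
  have hb : a = 0 -> b = 0.
    by move=> a0; apply: (h20 _ 20) => //; rewrite -hH /ico_h a0; ring.
  have ha : b = 0 -> a = 0.
    by move=> b0; apply: (h20 _ 20) => //; rewrite -hH /ico_h b0; ring.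
  case/orP: hf => [/orP[]/eqP h|/eqP h]; first by split; auto.
    by split; auto.
  (* Modulo the cofactor p of x y in [ico_f], the form [ico_h] is -3125 a^10 b^10, so a common zero
     has a = 0 or b = 0. *)
  have : 3125 * (a ^+ 10 * b ^+ 10) = 0.
    pose p := a ^+ 10 + 11 * a ^+ 5 * b ^+ 5 - b ^+ 10.
    transitivity (p * (250 * a ^+ 5 * b ^+ 5 - p) - ico_h a b); first by rewrite /p /ico_h; ring.
    by rewrite hH /p h subrr mul0r subr0.
  move/eqP; rewrite mulf_eq0 (negbTE (natK_neq0 K 3124)) mulf_eq0 !expf_eq0 /=.
  by move=> /orP[]/eqP h0; split; auto.
- by rewrite oppr_eq0 oner_eq0.
- rewrite map_cat -!map_comp cat_uniq !map_inj_uniq ?uu /=; try by apply: mulfI; rewrite wn0.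
  rewrite andbT; apply/hasPn => z /mapP[u /hu u5 ->]; apply/negP => /mapP[u' /hu u5' /= e].
  have [_ _ w5 _ _] := golden_pow w2; have [_ _ w5' _ _] := golden_pow w'2.
  have : w' ^+ 5 = w ^+ 5.
    by rewrite -[LHS]mulr1 -u5 -[RHS]mulr1 -u5' -!exprMn e.
  rewrite [RHS]w5 [LHS]w5' => /addIr /(mulfI (natK_neq0 K 4)) ew.
  by rewrite ew eqxx in ww'.
- by rewrite size_cat !size_map su.
- move=> z /hu; exact: hdiag.
- by move=> p; rewrite mem_cat => /orP[]/mapP[u /hu u5 ->]; apply: hq.
- have hd v u : v ^+ 2 = v + 1 -> u ^+ 5 = 1 -> - u - v * u * v != 0 :> K.
    move=> v2 u5; have -> : - u - v * u * v = - (u * (v + 2)).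
      by transitivity (- u * (1 + v ^+ 2)); [ring|rewrite v2; ring].
    rewrite oppr_eq0; apply: mulf_neq0; [exact: un0|apply/eqP => e].
    have v2' : v = - 2 by apply/eqP; rewrite -subr_eq0 opprK e.
    have : (5 : K) = 0.
      by transitivity (v ^+ 2 - (v + 1)); [rewrite v2'; ring|rewrite v2 subrr].
    by move/eqP; rewrite (negbTE (natK_neq0 K 4)).
  move=> p; rewrite mem_cat => /orP[]/mapP[u /hu u5 ->] /=.
  + by split; [|apply: mulf_neq0; [exact: wn0|exact: un0]|exact: hd].
  + by split; [|apply: mulf_neq0; [exact: wn0|exact: un0]|exact: hd].
Qed.
End Icosahedral.

(** * Special forms over three given points *)

Section KleinData.
Variable K : numClosedFieldType.
Local Notation S := {mpoly K[2]}.

Definition pcoord (P : P1 K) : K * K := if P is Some a then (a, 1) else (1, 0).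
Definition pdet (P Q : P1 K) : K := (pcoord P).1 * (pcoord Q).2 - (pcoord P).2 * (pcoord Q).1.

Lemma pdet_neq0 P Q : P != Q -> pdet P Q != 0.
Proof.
rewrite /pdet; case: P Q => [a|] [b|] //=.
- by rewrite mulr1 mul1r subr_eq0; apply: contra_neq => ->.
- by rewrite mulr0 mul1r sub0r oppr_eq0 oner_eq0.
- by rewrite mulr1 mul0r subr0 oner_eq0.
Qed.

(* The quotient map of the polyhedral group is [X : Y]; it has ramification index
   [t i] above [V i], where it is given by the powers of the special forms. *)
Record klein_forms (t : 'I_3 -> nat) (V : 'I_3 -> P1 K) := KleinFormsOf {
  kF :> 'I_3 -> S;
  kX : S;
  kY : S;
  khd : 'I_3 -> nat;
  kh : nat;
  kms : seq 'M[K]_2;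
  kF_homog : forall i, kF i \is (khd i).-homog;
  kt_gt0 : forall i, (0 < t i)%N;
  kV_inj : injective V;
  khd_gt0 : forall i, (0 < khd i)%N;
  khd_t : forall i, (khd i * t i = kh)%N;
  kX_homog : kX \is kh.-homog;
  kY_homog : kY \is kh.-homog;
  kF_t : forall i, kF i ^+ t i = (pcoord (V i)).2 *: kX - (pcoord (V i)).1 *: kY;
  kXY_eq0 : forall v, kX.@[v] = 0 -> kY.@[v] = 0 -> forall j, v j = 0;
  kms_uniq : uniq kms;
  size_kms : size kms = kh;
  kms_stab : forall g, g \in kms -> g \in unitmx /\ exists c C,
    [/\ forall i, sub g (kF i) = c i *: kF i, sub g kX = C *: kX & sub g kY = C *: kY];
  kms_proj : forall g g' a, g \in kms -> g' \in kms -> g = a *: g' -> g = g'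
}.

Lemma ord3P (P : 'I_3 -> Prop) : P ord0 -> P (@Ordinal 3 1 isT) -> P ord_max -> forall i, P i.
Proof.
move=> h0 h1 h2 [[|[|[|//]]] hi].
- by have <- : ord0 = Ordinal hi by apply/val_inj.
- by have <- : Ordinal (isT : (1 < 3)%N) = Ordinal hi by apply/val_inj.
- by have <- : ord_max = Ordinal hi by apply/val_inj.
Qed.

Lemma sum_ord3 (L : nmodType) (f : 'I_3 -> L) :
  \sum_i f i = f ord0 + f (@Ordinal 3 1 isT) + f ord_max.
Proof.
rewrite !big_ord_recl big_ord0 addr0 addrA.
have -> : fintype.lift ord0 ord0 = @Ordinal 3 1 isT by apply/val_inj.
by have -> : fintype.lift ord0 (fintype.lift ord0 ord0) = ord_max :> 'I_3 by apply/val_inj.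
Qed.

Lemma pencil_eval (L : lmodType K) (A B : L) (k a0 b0 a1 b1 a2 b2 : K) :
  b2 *: (k *: (- a1 *: A + a0 *: B)) - a2 *: (k *: (- b1 *: A + b0 *: B))
  = (k * (a2 * b1 - b2 * a1)) *: A + (k * (b2 * a0 - a2 * b0)) *: B.
Proof.
rewrite -scaleNr !scalerA !scalerDr !scalerA addrACA -!scalerDl.
by congr (_ *: _ + _ *: _); ring.
Qed.

Lemma sub_pencil g (A B : S) (C k a b : K) : sub g A = C *: A -> sub g B = C *: B ->
  sub g (k *: (a *: A + b *: B)) = C *: (k *: (a *: A + b *: B)).
Proof.
move=> hA hB; rewrite subZ subD !subZ hA hB !scalerDr !scalerA.
by congr (_ *: _ + _ *: _); ring.
Qed.

Lemma klein_forms_exist (t : 'I_3 -> nat) (V : 'I_3 -> P1 K) :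
  (forall i, (0 < t i)%N) -> injective V -> polyhedral K t -> inhabited (klein_forms t V).
Proof.
move=> t0 Vinj [F [hd [h [ms [hF rel nz [ums sms] [hms pms]]]]]].
pose i1 := @Ordinal 3 1 isT.
pose W i := pcoord (V i).
(* The linear forms b_i X - a_i Y of the points V_i = [a_i : b_i] satisfy the relation with
   coefficients [beta i]. Dividing F_i^t_i by [beta i] turns the relation among the special forms
   into this one, so X and Y can be solved from two of the equations by Cramer's rule and the third
   follows. *)
pose beta (i : 'I_3) := pdet (V (ordS i)) (V (ordS (ordS i))).
have b0 i : beta i != 0.
  apply: pdet_neq0; apply/eqP => /Vinj /(congr1 val) /=.
  by case: i => [[|[|[|//]]] hi].
pose l i := (t i).-root ((beta i)^-1).
pose F' i := l i *: F i.
have F't i : F' i ^+ t i = (beta i)^-1 *: F i ^+ t i by rewrite exprZn rootCK.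
have [o0 o1 o2] : [/\ ordS ord0 = i1, ordS i1 = ord_max & ordS ord_max = ord0 :> 'I_3].
  by split; apply/val_inj.
have e0 : beta ord0 = (W i1).1 * (W ord_max).2 - (W i1).2 * (W ord_max).1.
  by rewrite /beta o0 o1.
have e1 : beta i1 = (W ord_max).1 * (W ord0).2 - (W ord_max).2 * (W ord0).1.
  by rewrite /beta o1 o2.
have e2 : beta ord_max = (W ord0).1 * (W i1).2 - (W ord0).2 * (W i1).1.
  by rewrite /beta o2 o0.
pose A := F' ord0 ^+ t ord0; pose B := F' i1 ^+ t i1.
pose k := (beta ord_max)^-1.
pose X := k *: (- (W i1).1 *: A + (W ord0).1 *: B).
pose Y := k *: (- (W i1).2 *: A + (W ord0).2 *: B).
have homt i : F' i ^+ t i \is h.-homog.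
  by have [h1 _ <-] := hF i; apply: dhomogMn; apply: rpredZ.
have hX : X \is h.-homog by apply: rpredZ; apply: rpredD; apply: rpredZ; apply: homt.
have hY : Y \is h.-homog by apply: rpredZ; apply: rpredD; apply: rpredZ; apply: homt.
have kb : k * beta ord_max = 1 by rewrite mulVf.
have FtE : forall i, F' i ^+ t i = (W i).2 *: X - (W i).1 *: Y.
  apply: ord3P.
  - rewrite /X /Y pencil_eval; set p := k * _; set q := k * _.
    have -> : p = 1 by rewrite -kb e2 /p; ring.
    have -> : q = 0 by rewrite /q; ring.
    by rewrite scale1r scale0r addr0.
  - rewrite /X /Y pencil_eval; set p := k * _; set q := k * _.
    have -> : q = 1 by rewrite -kb e2 /q; ring.
    have -> : p = 0 by rewrite /p; ring.
    by rewrite scale1r scale0r add0r.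
  - have r : beta ord0 *: A + beta i1 *: B + beta ord_max *: (F' ord_max ^+ t ord_max) = 0.
      rewrite /A /B !F't !scalerA !mulfV // !scale1r -[RHS]rel sum_ord3.
      by [].
    have -> : F' ord_max ^+ t ord_max = - k *: (beta ord0 *: A + beta i1 *: B).
      have := congr1 (fun z => k *: z) r.
      rewrite scaler0 scalerDr scalerA kb scale1r => /eqP; rewrite addrC addr_eq0 => /eqP ->.
      by rewrite scaleNr.
    rewrite /X /Y pencil_eval scalerDr !scalerA e0 e1.
    by congr (_ *: _ + _ *: _); ring.
have zXY v : X.@[v] = 0 -> Y.@[v] = 0 -> forall j, v j = 0.
  move=> X0 Y0; apply: nz => i.
  have /eqP : (F' i ^+ t i).@[v] = 0 by rewrite FtE mevalB (mevalZ v _ X) (mevalZ v _ Y) X0 Y0 !mulr0 subrr.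
  rewrite rmorphXn /= expf_eq0 t0 mevalZ mulf_eq0 => /orP[|/eqP //].
  move=> /eqP li; have := rootCK (t0 i) (beta i)^-1; rewrite -/(l i) li expr0n (gtn_eqF (t0 i)).
  by move=> /esym /eqP; rewrite invr_eq0 (negbTE (b0 i)).
constructor.
apply: (@KleinFormsOf t V F' X Y hd h ms) => //.
- by move=> i; have [h1 _ _] := hF i; apply: rpredZ.
- by move=> i; have [_ h1 _] := hF i.
- by move=> i; have [_ _ h1] := hF i.
- move=> g /hms[ug [c [C hc]]]; split=> //; exists c, C.
  have sF i : sub g (F' i ^+ t i) = C *: F' i ^+ t i.
    have [h1 <-] := hc i; rewrite subX /F' subZ h1 -exprZn; congr (_ ^+ _).
    by rewrite !scalerA mulrC.
  split=> [i||].
  + by have [h1 _] := hc i; rewrite /F' subZ h1 !scalerA mulrC.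
  + by apply: sub_pencil; apply: sF.
  + by apply: sub_pencil; apply: sF.
Qed.
End KleinData.

(** * Products of special forms with binary forms in X and Y *)

Section Monomials.
Variables (K : numClosedFieldType) (t s : 'I_3 -> nat) (V : 'I_3 -> P1 K).
Variable o : klein_forms t V.
Let t_gt0 := kt_gt0 o.
Local Notation S := {mpoly K[2]}.
Local Notation X := (kX o).
Local Notation Y := (kY o).
Local Notation H := (hm X Y).
Implicit Types (q r : {poly K}) (n m : nat).

Lemma kh_gt0 : (0 < kh o)%N.
Proof. by rewrite -(khd_t o ord0) muln_gt0 khd_gt0 t_gt0. Qed.

(** A form of positive degree has a nontrivial zero; at a zero of one of X, Y the relation would
    make the other vanish too, unless its coefficient is 0. *)
Lemma kXY_indep (a b : K) : a *: X + b *: Y = 0 -> a = 0 /\ b = 0.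
Proof.
move=> e.
have aux (P Q : S) (c c' : K) : P \is (kh o).-homog ->
    (forall v, P.@[v] = 0 -> Q.@[v] = 0 -> forall j, v j = 0) ->
    c *: P + c' *: Q = 0 -> c' = 0.
  move=> hP nz h; have [v [[i vi] Pv]] := homog_root kh_gt0 hP.
  have := congr1 (meval v) h; rewrite mevalD !mevalZ Pv mulr0 add0r meval0.
  move/eqP; rewrite mulf_eq0 => /orP[/eqP //|/eqP Qv].
  by move: vi; rewrite (nz v Pv Qv) eqxx.
split; last exact: (aux X Y a b (kX_homog o) (@kXY_eq0 _ _ _ o) e).
apply: (aux Y X b a (kY_homog o)) => [v hY hX j|]; first exact: (kXY_eq0 hX hY).
by rewrite addrC.
Qed.

Lemma hmXY_eq0 e q : (size q <= e.+1)%N -> H e q = 0 -> q = 0.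
Proof. by apply: hm_eq0; apply: kXY_indep. Qed.

(** An equation of V_i, always regarded as a form of degree 1: for V_i at infinity it is the
    constant -1, standing for -Y. *)
Definition lp i : {poly K} := (pcoord (V i)).2 *: 'X + (- (pcoord (V i)).1)%:P.

Lemma lp_neq0 i : lp i != 0.
Proof.
rewrite /lp /pcoord; case: (V i) => [a|] /=.
  by rewrite scale1r polyCN polyXsubC_eq0.
by rewrite scale0r add0r polyC_eq0 oppr_eq0 oner_eq0.
Qed.

Lemma size_lp i : (size (lp i) <= 2)%N.
Proof.
apply: leq_trans (size_polyD _ _) _; rewrite geq_max; apply/andP; split.
  by apply: leq_trans (size_scale_leq _ _) _; rewrite size_polyX.
by apply: leq_trans (size_polyC_leq1 _) _.
Qed.

Lemma hm_lp i : H 1 (lp i) = o i ^+ t i.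
Proof. by rewrite hm_linear kF_t scaleNr. Qed.

Lemma kF_neq0 i : o i != 0.
Proof.
apply/eqP => F0; have := kF_t o i; rewrite F0 expr0n (gtn_eqF (t_gt0 i)) -scaleNr.
move=> /esym /kXY_indep; rewrite /pcoord; case: (V i) => [a|] /= [/eqP h0 /eqP h1].
  by rewrite oner_eq0 in h0.
by rewrite oppr_eq0 oner_eq0 in h1.
Qed.

Definition lw (c : 'I_3 -> nat) : {poly K} := \prod_i lp i ^+ c i.

Lemma lw_neq0 c : lw c != 0.
Proof. by apply/prodf_neq0 => i _; rewrite expf_neq0 // lp_neq0. Qed.

Lemma lwD c c' : lw (fun i => c i + c' i)%N = lw c * lw c'.
Proof. by rewrite -big_split /=; apply: eq_bigr => i _; rewrite exprD. Qed.

Lemma eq_lw c c' : c =1 c' -> lw c = lw c'.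
Proof. by move=> cc; apply: eq_bigr => i _; rewrite cc. Qed.

Lemma lw1 c : (forall i, c i = 0%N) -> lw c = 1.
Proof. by move=> c0; rewrite /lw big1 // => i _; rewrite c0 expr0. Qed.

Lemma size_exp_lp i n : (size (lp i ^+ n) <= n.+1)%N.
Proof.
apply: leq_trans (size_exp_leq _ _) _; rewrite ltnS.
have := size_lp i; case: (size (lp i)) => [|[|[|]]] //= _; rewrite ?mul0n ?mul1n //.
Qed.

Lemma lw_hm c : (size (lw c) <= (\sum_i c i).+1)%N /\
  H (\sum_i c i) (lw c) = \prod_i o i ^+ (t i * c i).
Proof.
rewrite /lw; elim: (index_enum _) => [|i l [IHs IHh]].
  by rewrite !big_nil size_poly1 hm_one expr0.
have hi n : H n (lp i ^+ n) = o i ^+ (t i * n).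
  elim: n => [|n IHn]; first by rewrite muln0 !expr0 hm_one expr0.
  by rewrite exprS -[n.+1]add1n hmM ?size_lp ?size_exp_lp // IHn hm_lp add1n mulnS exprD.
rewrite !big_cons; split.
  apply: leq_trans (size_polyMleq _ _) _.
  have := size_exp_lp i (c i); lia.
by rewrite hmM ?size_exp_lp // hi IHh.
Qed.

Definition fl i n := ((n * s i) %/ t i)%N.
Definition rm i n := ((n * s i) %% t i)%N.
Definition e_ n := (\sum_i fl i n)%N.
Definition d_ := (\sum_i s i * khd o i)%N.
(** The carry at V_i: when the exponents [rm i n] and [rm i m] add up to t_i or more, a factor
    F_i^t_i splits off and joins the numerator as [lp i]. *)
Definition cr n m i := (fl i (n + m) - fl i n - fl i m)%N.

Lemma flrm i n : (n * s i = fl i n * t i + rm i n)%N.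
Proof. exact: divn_eq. Qed.

Lemma fl_add i n m : (fl i n + fl i m <= fl i (n + m))%N.
Proof.
rewrite /fl mulnDl leq_divRL ?t_gt0 // mulnDl.
by apply: leq_add; apply: leq_trunc_div.
Qed.

Lemma fl_cr i n m : (fl i (n + m) = fl i n + fl i m + cr n m i)%N.
Proof. by have := fl_add i n m; rewrite /cr; lia. Qed.

Lemma rm_cr i n m : (rm i n + rm i m = rm i (n + m) + t i * cr n m i)%N.
Proof.
have h1 := flrm i n; have h2 := flrm i m; have h3 := flrm i (n + m).
have h4 := fl_cr i n m; nia.
Qed.

Lemma e_cr n m : (e_ (n + m) = e_ n + e_ m + \sum_i cr n m i)%N.
Proof. by rewrite /e_ -!big_split; apply: eq_bigr => i _; apply: fl_cr. Qed.

(* The invariant corresponding to the section of [n D] with numerator [q]. *)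
Definition mon n q : S := (\prod_i o i ^+ rm i n) * H (e_ n) q.

Lemma mon_is_linear n : linear (mon n).
Proof. by move=> c q r; rewrite /mon linearP mulrDr scalerAr. Qed.
HB.instance Definition _ n :=
  GRing.isLinear.Build K {poly K} S _ (mon n) (mon_is_linear n).

Lemma prodF_neq0 (c : 'I_3 -> nat) : \prod_i o i ^+ c i != 0.
Proof. by apply/prodf_neq0 => i _; rewrite expf_neq0 // kF_neq0. Qed.

Lemma monM n m q r : (size q <= (e_ n).+1)%N -> (size r <= (e_ m).+1)%N ->
  mon n q * mon m r = mon (n + m) (lw (cr n m) * (q * r)).
Proof.
move=> sq sr; have [slw hlw] := lw_hm (cr n m).
have sqr : (size (q * r)%R <= (e_ n + e_ m).+1)%N.
  by apply: leq_trans (size_polyMleq _ _) _; lia.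
have eC : e_ (n + m) = (\sum_i cr n m i + (e_ n + e_ m))%N by rewrite e_cr addnC.
rewrite /mon eC (hmM X Y slw sqr) (hmM X Y sq sr) hlw mulrACA [RHS]mulrA.
congr (_ * _); rewrite -!big_split /=; apply: eq_bigr => i _.
by rewrite -!exprD rm_cr.
Qed.

Lemma size_monM n m q r : (size q <= (e_ n).+1)%N -> (size r <= (e_ m).+1)%N ->
  (size (lw (cr n m) * (q * r))%R <= (e_ (n + m)).+1)%N.
Proof.
move=> sq sr; have [slw _] := lw_hm (cr n m).
apply: leq_trans (size_polyMleq _ _) _.
have := size_polyMleq q r; rewrite e_cr; lia.
Qed.

Lemma mon_eq0 n q : (size q <= (e_ n).+1)%N -> mon n q = 0 -> q = 0.
Proof.
move=> sq /eqP; rewrite mulf_eq0 (negbTE (prodF_neq0 _)) /= => /eqP.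
exact: hmXY_eq0.
Qed.

Lemma mon_inj n q r : (size q <= (e_ n).+1)%N -> (size r <= (e_ n).+1)%N ->
  mon n q = mon n r -> q = r.
Proof.
move=> sq sr e; apply/eqP; rewrite -subr_eq0; apply/eqP; apply: (@mon_eq0 n).
  by apply: leq_trans (size_polyD _ _) _; rewrite size_polyN geq_max sq.
by rewrite linearB /= e subrr.
Qed.

Lemma e0 : e_ 0 = 0%N.
Proof. by rewrite /e_ big1 // => i _; rewrite /fl mul0n div0n. Qed.

Lemma mon01 : mon 0 1 = 1.
Proof.
rewrite /mon hm_one e0 expr0 mulr1 big1 // => i _.
by rewrite /rm mul0n mod0n expr0.
Qed.

Lemma prodF_homog (c : 'I_3 -> nat) :
  \prod_i o i ^+ c i \is (\sum_i khd o i * c i).-homog.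
Proof.
elim/big_rec2: _ => [|i p q _ hq]; first exact: dhomog1.
by rewrite dhomogM // dhomogMn // kF_homog.
Qed.

Lemma mon_homog n q : mon n q \is (n * d_).-homog.
Proof.
have -> : (n * d_ = \sum_i khd o i * rm i n + kh o * e_ n)%N.
  rewrite /d_ /e_ !big_distrr /= -big_split /=; apply: eq_bigr => i _.
  rewrite -(khd_t o i); have := flrm i n; nia.
by rewrite dhomogM ?prodF_homog // hm_homog // ?kX_homog ?kY_homog.
Qed.

End Monomials.

(** * The group and its invariants *)

Section Evaluation.
Variable K : closedFieldType.
Local Notation S := {mpoly K[2]}.
Implicit Types (f : S) (q : {poly K}).

Definition pt (a b : K) (i : 'I_2) : K := if i == ord0 then a else b.

Definition hev (a b : K) e q : K := \sum_(i < e.+1) q`_i * (a ^+ i * b ^+ (e - i)).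

Lemma meval_hm (X Y : S) v e q : (hm X Y e q).@[v] = hev X.@[v] Y.@[v] e q.
Proof.
rewrite /hm raddf_sum; apply: eq_bigr => i _.
by rewrite /= mevalZ mevalM !rmorphXn.
Qed.

Lemma meval_pt n f a b : f \is n.-homog -> f.@[pt a b] = hev a b n (dehom f).
Proof. by move=> hf; rewrite -{1}(hm_dehom hf) meval_hm !mevalXU. Qed.

Lemma hev1 a e q : (size q <= e.+1)%N -> hev a 1 e q = q.[a].
Proof.
move=> sq; rewrite (horner_coef_wide _ sq); apply: eq_bigr => i _.
by rewrite expr1n mulr1.
Qed.

Lemma hevZ c a b e q : hev (c * a) (c * b) e q = c ^+ e * hev a b e q.
Proof.
rewrite /hev mulr_sumr; apply: eq_bigr => i _; have hi : (i <= e)%N by rewrite -ltnS.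
rewrite !exprMn mulrACA -exprD subnKC // !mulrA; congr (_ * _); congr (_ * _).
by rewrite mulrC.
Qed.

Lemma hev0 a e q : hev a 0 e q = q`_e * a ^+ e.
Proof.
rewrite /hev big_ord_recr /= subnn expr0 mulr1 big1 ?add0r // => i _.
by rewrite [X in _ * (_ * X)]expr0n subn_eq0 leqNgt ltn_ord !mulr0.
Qed.

Lemma hev_root a b e q : b != 0 -> (size q <= e.+1)%N ->
  hev a b e q = b ^+ e * q.[a / b].
Proof.
by move=> b0 sq; rewrite -(hev1 _ sq) -hevZ mulr1 mulrC mulfVK.
Qed.

Lemma meval_pt1 n f a : f \is n.-homog -> f.@[pt a 1] = (dehom f).[a].
Proof. by move=> hf; rewrite (meval_pt _ _ hf) hev1 // size_dehom. Qed.

Lemma roots_ex (p : {poly K}) : exists rs : seq K, p != 0 -> forall a, root p a -> a \in rs.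
Proof.
have [rs Dp] := closed_field_poly_normal p; exists rs => p0 a.
by rewrite {1}Dp rootZ ?lead_coef_eq0 // root_prod_XsubC.
Qed.

Lemma roots_fun : exists rts : {poly K} -> seq K,
  forall p, p != 0 -> forall a, root p a -> a \in rts p.
Proof. by have [rts h] := choice roots_ex; exists rts. Qed.

Lemma XnC_neq0 (c f0 : K) n : (0 < n)%N -> f0 != 0 -> c *: 'X^n - f0%:P != 0.
Proof.
move=> n0 h; apply/eqP => /(congr1 (fun p : {poly K} => p`_0)).
rewrite coefB coefZ coefXn coefC eqxx coef0 eq_sym (gtn_eqF n0) mulr0 sub0r => /eqP.
by rewrite oppr_eq0 (negbTE h).
Qed.

(** The zeros of Z lie on finitely many lines through the origin, and on each of them F is a
    multiple of a d-th power, so it takes the nonzero value [f0] finitely often. The second list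
    covers the line b = 0. *)
Lemma finite_solutions h d (Z F : S) (f0 : K) : Z \is h.-homog -> Z != 0 ->
  F \is d.-homog -> (0 < d)%N -> f0 != 0 ->
  exists L : seq (K * K), forall a b, Z.@[pt a b] = 0 -> F.@[pt a b] = f0 -> (a, b) \in L.
Proof.
move=> hZ Z0 hF d0 f00; have [rts hr] := roots_fun.
have z0 : dehom Z != 0 by apply: contra_neq Z0; apply: dehom_inj hZ.
exists ([seq (r * b, b) | r <- rts (dehom Z), b <- rts ((dehom F).[r] *: 'X^d - f0%:P)]
  ++ [seq (a, 0) | a <- rts ((dehom F)`_d *: 'X^d - f0%:P)]) => a b.
rewrite (meval_pt _ _ hZ) (meval_pt _ _ hF) mem_cat.
have [->|b0] := eqVneq b 0.
  rewrite !hev0 => _ e; apply/orP; right; apply/mapP; exists a => //.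
  by apply: hr; [exact: XnC_neq0|rewrite /root !hornerE e subrr].
rewrite !hev_root ?size_dehom // => /eqP.
rewrite mulf_eq0 expf_eq0 (negbTE b0) andbF /= => r0 e; apply/orP; left.
apply/allpairsPdep; exists (a / b), b; split; last by rewrite mulfVK.
  by apply: hr.
by apply: hr; [exact: XnC_neq0|rewrite /root !hornerE mulrC e subrr].
Qed.
End Evaluation.

Section Stabilizer.
Variables (K : numClosedFieldType) (t s : 'I_3 -> nat) (V : 'I_3 -> P1 K).
Variable o : klein_forms t V.
Hypothesis s_gt0 : forall i, (0 < s i)%N.
Local Notation S := {mpoly K[2]}.
Local Notation X := (kX o).
Local Notation Y := (kY o).
Local Notation H := (hm X Y).
Local Notation mon := (mon s o).
Local Notation e_ := (e_ t s).
Local Notation d_ := (d_ s o).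
Implicit Types (q r : {poly K}) (n m : nat) (g : 'M[K]_2) (f : S).

Definition stab g : Prop := g \in unitmx /\ exists c C,
  [/\ forall i, sub g (o i) = c i *: o i, sub g X = C *: X, sub g Y = C *: Y
    & \prod_i c i ^+ s i = 1].

Lemma d_gt0 : (0 < d_)%N.
Proof.
rewrite /d_ (bigD1 ord0) //= addn_gt0 muln_gt0.
by rewrite s_gt0 (khd_gt0 o).
Qed.

Lemma sub_ct g (c : 'I_3 -> K) C : (forall i, sub g (o i) = c i *: o i) ->
  sub g X = C *: X -> sub g Y = C *: Y -> forall i, c i ^+ t i = C.
Proof.
move=> hF hX hY i; have h : sub g (o i ^+ t i) = C *: o i ^+ t i.
  by rewrite kF_t subD subN !subZ hX hY scalerBr !scalerA ![C * _]mulrC.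
move: h; rewrite subX hF exprZn => /eqP; rewrite -subr_eq0 -scalerBl scaler_eq0 subr_eq0.
by rewrite expf_eq0 (negbTE (kF_neq0 o i)) andbF orbF => /eqP.
Qed.

Lemma sub_hm g C e q : sub g X = C *: X -> sub g Y = C *: Y -> sub g (H e q) = C ^+ e *: H e q.
Proof.
move=> hX hY; rewrite rmorph_hm /= hX hY /hm scaler_sumr; apply: eq_bigr => i _.
have hi : (i <= e)%N by rewrite -ltnS.
rewrite !exprZn -scalerAl -scalerAr !scalerA; congr (_ *: _).
by rewrite -mulrA -exprD subnKC // mulrC.
Qed.

(** Since C = c_i^t_i for each i, the power C^(e_n) contributes the exponents [fl i n * t i];
    together with the remainders the total factor is the n-th power of the product of the c_i^s_i,
    which is 1. *)
Lemma stab_mon g n q : stab g -> sub g (mon n q) = mon n q.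
Proof.
move=> [_ [c [C [hF hX hY hs]]]]; rewrite /mon sub_mul (sub_hm _ _ hX hY) sub_prod.
have -> : \prod_i sub g (o i ^+ rm t s i n) = (\prod_i c i ^+ rm t s i n) *: \prod_i o i ^+ rm t s i n.
  by rewrite -scaler_prod; apply: eq_bigr => i _; rewrite subX hF exprZn.
rewrite -scalerAl -scalerAr scalerA.
suff -> : \prod_i c i ^+ rm t s i n * C ^+ e_ n = 1 by rewrite scale1r.
rewrite /e_ expr_sum -big_split /= -[RHS](expr1n _ n) -[in RHS]hs -prodrXl; apply: eq_bigr => i _.
rewrite -(sub_ct hF hX hY i) -!exprM -exprD [(s i * n)%N]mulnC (flrm t s); congr (_ ^+ _).
by rewrite addnC mulnC.
Qed.

Lemma stab1 : stab 1.
Proof.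
split; first exact: unitmx1; exists (fun=> 1), 1; split=> [i|||]; rewrite ?sub1 ?scale1r //.
by rewrite big1 // => i _; rewrite expr1n.
Qed.

Lemma stabM g g' : stab g -> stab g' -> stab (g * g').
Proof.
move=> [ug [c [C [hF hX hY hs]]]] [ug' [c' [C' [hF' hX' hY' hs']]]].
split; first by rewrite unitmx_mul ug ug'.
exists (fun i => c' i * c i), (C' * C); split=> [i|||].
- by rewrite -subM hF' subZ hF scalerA.
- by rewrite -subM hX' subZ hX scalerA.
- by rewrite -subM hY' subZ hY scalerA.
- rewrite -[RHS]mul1r -[X in X * _]hs' -[in X in _ * X]hs -big_split /=; apply: eq_bigr => i _.
  by rewrite exprMn.
Qed.

Lemma sub_invK g f : g \in unitmx -> sub g^-1 (sub g f) = f.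
Proof. by move=> ug; rewrite subM mulVr // sub1. Qed.

Lemma sub_unit_neq0 g c f : g \in unitmx -> f != 0 -> sub g f = c *: f -> c != 0.
Proof.
move=> ug f0 h; apply: contra_neq f0 => c0; rewrite -(sub_invK f ug) h c0 scale0r.
exact: raddf0.
Qed.

Lemma sub_inv g c f : g \in unitmx -> f != 0 -> sub g f = c *: f -> sub g^-1 f = c^-1 *: f.
Proof.
move=> ug f0 h; have c0 := sub_unit_neq0 ug f0 h.
by rewrite -[in RHS](sub_invK f ug) h subZ scalerA mulVf // scale1r.
Qed.

Lemma kX_neq0 : X != 0.
Proof.
apply/eqP => X0; have [] := kXY_indep (o := o) (a := 1) (b := 0).
  by rewrite X0 scaler0 scale0r addr0.
by move/eqP; rewrite oner_eq0.
Qed.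

Lemma kY_neq0 : Y != 0.
Proof.
apply/eqP => X0; have [] := kXY_indep (o := o) (a := 0) (b := 1).
  by rewrite X0 scaler0 scale0r addr0.
by move=> _ /eqP; rewrite oner_eq0.
Qed.

Lemma stabV g : stab g -> stab g^-1.
Proof.
move=> [ug [c [C [hF hX hY hs]]]]; split; first by rewrite unitmx_inv.
exists (fun i => (c i)^-1), C^-1; split=> [i|||].
- exact: sub_inv (kF_neq0 o i) (hF i).
- exact: sub_inv kX_neq0 hX.
- exact: sub_inv kY_neq0 hY.
- under eq_bigr => i _ do rewrite exprVn.
  by rewrite prodfV hs invr1.
Qed.

Lemma sub_scalar (l : K) n f : f \is n.-homog -> sub l%:M f = l ^+ n *: f.
Proof.
move=> hf; rewrite [f]mpolyE sub_sum scaler_sumr; apply: eq_big_seq => m mf.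
rewrite subZ !scalerA mulrC -scalerA; congr (_ *: _).
have <- : mdeg m = n := dhomog_mf hf mf.
rewrite mpolyXE_id sub_prod mdegE expr_sum -scaler_prod; apply: eq_bigr => i _.
rewrite subX sub_X -exprZn (bigD1 i) //= mxE eqxx big1 ?addr0 // => j ne.
by rewrite mxE (negbTE ne) scale0r.
Qed.

Lemma sub_scale_mx (l : K) g n f : f \is n.-homog -> sub (l *: g) f = l ^+ n *: sub g f.
Proof.
by move=> hf; rewrite -mul_scalar_mx -[_ *m _]/(_ * _) -subM (sub_scalar _ (sub_homog g hf)).
Qed.

Definition kprod : S := \prod_i o i ^+ s i.

Lemma kprod_homog : kprod \is d_.-homog.
Proof.
rewrite /kprod /d_; elim/big_rec2: _ => [|i p q _ hq]; first exact: dhomog1.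
by rewrite mulnC dhomogM // dhomogMn // kF_homog.
Qed.

Lemma stab_kprod g : stab g -> sub g kprod = kprod.
Proof.
move=> [_ [c [C [hF _ _ hs]]]]; rewrite /kprod sub_prod -[RHS]scale1r -hs -scaler_prod.
by apply: eq_bigr => i _; rewrite subX hF exprZn.
Qed.

Lemma row_pt g a b i : \sum_j pt a b j * g j i = a * g ord0 i + b * g ord_max i.
Proof.
rewrite big_ord_recl big_ord1.
by have -> : fintype.lift ord0 ord0 = ord_max :> 'I_2 by apply/val_inj.
Qed.

Lemma meval_sub_pt g f a b : (sub g f).@[pt a b] =
  f.@[pt (a * g ord0 ord0 + b * g ord_max ord0) (a * g ord0 ord_max + b * g ord_max ord_max)].
Proof.
rewrite meval_sub; apply: meval_eq => i; rewrite row_pt /pt.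
case: ifP => [/eqP -> //|]; case: i => [[|[|//]] hi] // _.
by have -> : Ordinal hi = ord_max by apply/val_inj.
Qed.

(* A stabilizing matrix is determined by the images of two vectors, and these lie on
   a level set of [kprod] and on a fibre of [X : Y]. *)
Lemma stab_finite : exists L : seq 'M[K]_2, forall g, stab g -> g \in L.
Proof.
have hF := kprod_homog; have F0 : kprod != 0 by exact: prodF_neq0.
have f0 : dehom kprod != 0 by apply: contra_neq F0; apply: dehom_inj hF.
have [z1 r1] := closed_nonrootP _ f0.
have : dehom kprod * ('X - z1%:P) != 0 by rewrite mulf_neq0 // polyXsubC_eq0.
case/closed_nonrootP => z2; rewrite rootM negb_or root_XsubC => /andP[r2 z12].
have aux z : (dehom kprod).[z] != 0 -> exists L : seq (K * K), forall g, stab g ->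
    (z * g ord0 ord0 + 1 * g ord_max ord0, z * g ord0 ord_max + 1 * g ord_max ord_max) \in L.
  move=> fz; pose a := X.@[pt z 1]; pose b := Y.@[pt z 1]; pose Z := b *: X - a *: Y.
  have hZ : Z \is (kh o).-homog by rewrite rpredB // rpredZ // ?kX_homog ?kY_homog.
  have Z0 : Z != 0.
    apply/eqP; rewrite /Z -scaleNr => /kXY_indep[b0 /eqP]; rewrite oppr_eq0 => /eqP a0.
    by have := kXY_eq0 a0 b0 ord_max; rewrite /pt /= => /eqP; rewrite oner_eq0.
  have [L hL] := finite_solutions hZ Z0 hF d_gt0 fz.
  exists L => g hg; apply: hL; rewrite -meval_sub_pt; last first.
    by rewrite stab_kprod // (meval_pt1 _ hF).
  case: hg => _ [c [C [_ hX hY _]]].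
  rewrite /Z subD subN !subZ hX hY mevalB !mevalZ -/a -/b; ring.
have [L1 hL1] := aux z1 r1; have [L2 hL2] := aux z2 r2.
pose M (p q : K * K) : 'M[K]_2 :=
  let r := (z2 - z1)^-1 in
  \matrix_(i, j) if i == ord0 then (if j == ord0 then r * (q.1 - p.1) else r * (q.2 - p.2))
    else (if j == ord0 then r * (z2 * p.1 - z1 * q.1) else r * (z2 * p.2 - z1 * q.2)).
exists [seq M p p' | p <- L1, p' <- L2] => g hg.
apply/allpairsP; eexists (_, _); split; [exact: hL1 hg|exact: hL2 hg|].
have z0 : z2 - z1 != 0 by rewrite subr_eq0.
apply/matrixP => i j; rewrite mxE /=.
have e1 (j' : 'I_2) : g ord0 j' = (z2 - z1)^-1 * ((z2 * g ord0 j' + 1 * g ord_max j') - (z1 * g ord0 j' + 1 * g ord_max j')).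
  by field.
have e2 (j' : 'I_2) : g ord_max j' = (z2 - z1)^-1 * (z2 * (z1 * g ord0 j' + 1 * g ord_max j') - z1 * (z2 * g ord0 j' + 1 * g ord_max j')).
  by field.
have om (k : 'I_2) : k != ord0 -> k = ord_max.
  by case: k => [[|[|//]] hk] // _; apply/val_inj.
have [-> | /om ->] := eqVneq i ord0; have [-> | /om ->] := eqVneq j ord0; by rewrite -?e1 -?e2.
Qed.

End Stabilizer.

(** * Invariants as forms in the pencil *)

Section Structure.
Variables (K : numClosedFieldType) (t s : 'I_3 -> nat) (V : 'I_3 -> P1 K).
Variable o : klein_forms t V.
Hypothesis s_gt0 : forall i, (0 < s i)%N.
Local Notation S := {mpoly K[2]}.
Local Notation X := (kX o).
Local Notation Y := (kY o).
Local Notation h := (kh o).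
Local Notation H := (hm X Y).
Local Notation d_ := (d_ s o).
Local Notation stab := (stab s o).
Implicit Types (q r : {poly K}) (n m : nat) (g : 'M[K]_2) (f : S).

Lemma stab_scalar (l : K) : l ^+ d_ = 1 -> stab l%:M.
Proof.
move=> ld; have l0 : l != 0.
  apply/eqP => l0; move/eqP: ld; rewrite l0 expr0n (gtn_eqF (d_gt0 o s_gt0)) eq_sym.
  by rewrite oner_eq0.
split; first by rewrite -scalemx1 unitmxZ ?unitfE // unitmx1.
exists (fun i => l ^+ khd o i), (l ^+ h); split=> [i|||].
- exact: sub_scalar (kF_homog o i).
- exact: sub_scalar (kX_homog o).
- exact: sub_scalar (kY_homog o).
- rewrite -[RHS]ld /d_ expr_sum; apply: eq_bigr => i _.
  by rewrite -exprM mulnC.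
Qed.

(** The scalars l with l^d = 1 lie in G and act on [f] by l^n. If n had a nonzero remainder r modulo
    d, all d of them would be r-th roots of unity with r < d. *)
Lemma invariant_degree n f : f \is n.-homog -> f != 0 ->
  (forall g, stab g -> sub g f = f) -> exists k, n = (k * d_)%N.
Proof.
move=> hf f0 inv; have d0 := d_gt0 o s_gt0.
suff /dvdnP[k ->] : (d_ %| n)%N by exists k.
have [zs [uz sz hz]] := unity_roots K d0.
rewrite /dvdn; apply/eqP; case: (posnP (n %% d_)) => // r0; exfalso.
have /(max_unity_roots r0)/(_ uz) : all (n %% d_).-unity_root zs.
  apply/allP => z /hz zd; rewrite unity_rootE.
  have /eqP := inv _ (stab_scalar zd); rewrite (sub_scalar _ hf) -subr_eq0.
  rewrite -{2}[f]scale1r -scalerBl scaler_eq0 (negbTE f0) orbF subr_eq0.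
  by rewrite {1}(divn_eq n d_) exprD mulnC exprM zd expr1n mul1r.
by rewrite sz leqNgt ltn_mod d0.
Qed.

(** Scaling a matrix by l multiplies the factor of the product of the F_i^s_i by l^d, so a d-th root
    of its inverse will do. *)
Lemma kms_scaled g : g \in kms o -> exists2 l : K, l != 0 & stab (l *: g).
Proof.
case/kms_stab => ug [c [C [hF hX hY]]].
have c0 i : c i != 0 by apply: sub_unit_neq0 ug (kF_neq0 o i) (hF i).
pose P := \prod_i c i ^+ s i.
have P0 : P != 0 by apply/prodf_neq0 => i _; rewrite expf_neq0.
have d0 := d_gt0 o s_gt0.
pose l := d_.-root P^-1; have ld : l ^+ d_ = P^-1 by rewrite rootCK.
have l0 : l != 0.
  apply/eqP => l0; move/eqP: ld; rewrite l0 expr0n (gtn_eqF d0) eq_sym invr_eq0.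
  by rewrite (negbTE P0).
exists l => //; split; first by rewrite unitmxZ ?unitfE.
exists (fun i => l ^+ khd o i * c i), (l ^+ h * C); split=> [i|||].
- by rewrite (sub_scale_mx _ _ (kF_homog o i)) hF scalerA.
- by rewrite (sub_scale_mx _ _ (kX_homog o)) hX scalerA.
- by rewrite (sub_scale_mx _ _ (kY_homog o)) hY scalerA.
- rewrite -[RHS](mulVf P0) -ld /d_ expr_sum -big_split /=; apply: eq_bigr => i _.
  by rewrite exprMn -exprM mulnC.
Qed.

(** The j-th coordinate of the image of (z, 1) under [g], as a polynomial in z. Below, [wedge g g']
    vanishes at z when the two images of (z, 1) are proportional. *)
Definition colp g (j : 'I_2) : {poly K} := g ord0 j *: 'X + (g ord_max j)%:P.

Lemma colp_neq0 g j : g \in unitmx -> colp g j != 0.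
Proof.
move=> ug; apply/eqP => c0.
have g0 : g ord0 j = 0.
  by have := congr1 (fun p : {poly K} => p`_1) c0; rewrite coefD coefZ coefX coefC coef0 mulr1 addr0.
have g1 : g ord_max j = 0.
  by have := congr1 (fun p : {poly K} => p`_0) c0; rewrite coefD coefZ coefX coefC coef0 mulr0 add0r.
have /matrixP/(_ j j) := mulVmx ug; rewrite mxE big1 ?mxE ?eqxx => [|i _].
  by move/esym/eqP; rewrite oner_eq0.
suff -> : g i j = 0 by rewrite mulr0.
case: i => [[|[|//]] hi]; [rewrite -[RHS]g0|rewrite -[RHS]g1]; congr (g _ j); exact/val_inj.
Qed.

Definition wedge g g' : {poly K} := colp g ord0 * colp g' ord_max - colp g ord_max * colp g' ord0.

Lemma wedge_eq0 g g' : g' \in unitmx -> wedge g g' = 0 -> exists a, g = a *: g'.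
Proof.
move=> ug' w0; pose D := g * g'^-1.
have gE : g = D * g' by rewrite /D mulrVK.
have E (i j : 'I_2) : g i j = D i ord0 * g' ord0 j + D i ord_max * g' ord_max j.
  rewrite gE -[D * g']/(D *m g') mxE big_ord_recl big_ord1.
  by have -> : fintype.lift ord0 ord0 = ord_max :> 'I_2 by apply/val_inj.
have colE j : colp g j = (g' ord0 j)%:P * colp D ord0 + (g' ord_max j)%:P * colp D ord_max.
  rewrite /colp !E -!mul_polyC !(polyCD, polyCM); ring.
(* The determinant of g' times the same expression for D = g g'^-1 and the identity; the
   coefficients of the latter vanish only if D is scalar. *)
have : wedge g g' = (g' ord0 ord0 * g' ord_max ord_max - g' ord0 ord_max * g' ord_max ord0)%:P
     * (colp D ord0 - colp D ord_max * 'X).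
  rewrite /wedge !colE [colp g' ord_max]/colp [colp g' ord0]/colp -!mul_polyC !(polyCD, polyCM, polyCN); ring.
rewrite w0 => /esym/eqP; rewrite mulf_eq0 polyC_eq0 => /orP[/eqP d0|/eqP c0].
  exfalso; move: ug'; rewrite unitmxE (expand_det_row _ ord0) big_ord_recl big_ord1.
  rewrite /cofactor !det_mx11 !mxE /= unitfE expr0 expr1 mul1r mulN1r mulrN.
  have -> : fintype.lift ord0 ord0 = ord_max :> 'I_2 by apply/val_inj.
  have -> : fintype.lift ord_max ord0 = ord0 :> 'I_2 by apply/val_inj.
  by rewrite d0 eqxx.
have h0 : D ord_max ord0 = 0.
  have := congr1 (fun p : {poly K} => p`_0) c0.
  by rewrite coefB coefMX /colp !coefD !coefZ !coefX !coefC /= mulr0 add0r subr0 ?coef0.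
have h1 : D ord0 ord0 = D ord_max ord_max.
  have := congr1 (fun p : {poly K} => p`_1) c0.
  rewrite coefB coefMX /colp !coefD !coefZ !coefX !coefC /= mulr0 add0r mulr1 addr0 ?coef0.
  by move/eqP; rewrite subr_eq0 => /eqP.
have h2 : D ord0 ord_max = 0.
  have := congr1 (fun p : {poly K} => p`_2) c0.
  rewrite coefB coefMX /colp !coefD !coefZ !coefX !coefC /= mulr0 add0r mulr1 addr0 ?coef0.
  by move/eqP; rewrite sub0r oppr_eq0 => /eqP.
exists (D ord0 ord0); apply/matrixP => i j; rewrite mxE E.
case: i => [[|[|//]] hi].
  have -> : Ordinal hi = ord0 by apply/val_inj.
  by rewrite h2 mul0r addr0.
have -> : Ordinal hi = ord_max by apply/val_inj.
by rewrite h0 mul0r add0r h1.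
Qed.

(* A point whose orbit consists of [h] distinct points, all at finite distance. *)
Lemma generic_point : exists z : K, [/\ Y.@[pt z 1] != 0,
  forall g, g \in kms o -> (colp g ord_max).[z] != 0
  & uniq [seq (colp g ord0).[z] / (colp g ord_max).[z] | g <- kms o]].
Proof.
pose P := dehom Y * (\prod_(g <- kms o) colp g ord_max) *
  (\prod_(g <- kms o) \prod_(g' <- kms o | g' != g) wedge g g').
have Y0 : dehom Y != 0 by apply: contra_neq (kY_neq0 o); apply: dehom_inj (kY_homog o).
have P0 : P != 0.
  rewrite !mulf_neq0 ?Y0 //; rewrite prodf_seq_neq0; apply/allP => g hg; rewrite implyTb.
    by rewrite colp_neq0 //; have [] := kms_stab hg.
  rewrite prodf_seq_neq0; apply/allP => g' hg'; apply/implyP => ne.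
  apply/eqP => /(wedge_eq0 (proj1 (kms_stab hg')))[a ga].
  by move: ne; rewrite (kms_proj hg hg' ga) eqxx.
have [z rz] := closed_nonrootP _ P0; exists z.
move: rz; rewrite !rootM !negb_or => /andP[/andP[r1 r2] r3].
have hc g : g \in kms o -> (colp g ord_max).[z] != 0.
  move=> hg; move: r2; rewrite /root horner_prod prodf_seq_neq0 => /allP/(_ g hg).
  by [].
split=> //; first by rewrite (meval_pt1 _ (kY_homog o)).
rewrite map_inj_in_uniq ?kms_uniq // => g g' hg hg' e; apply/eqP/negP => /negP ne.
move: r3; rewrite /root horner_prod prodf_seq_neq0 => /allP/(_ g hg) /=.
rewrite horner_prod prodf_seq_neq0 => /allP/(_ g' hg') /=; rewrite eq_sym ne /= => /eqP; apply.
rewrite /wedge hornerD hornerN !hornerM.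
move: e => /eqP; rewrite eqr_div ?hc // => /eqP ->; rewrite mulrC; ring.
Qed.

(* Subtracting a multiple of [Y ^+ k] makes [f] vanish at a generic point, hence on
   its orbit, which is the zero set of a member of the pencil spanned by X and Y. *)
Lemma pencil_form k f : f \is (h * k).-homog ->
  (forall g, g \in kms o -> forall C, sub g X = C *: X -> sub g Y = C *: Y -> sub g f = C ^+ k *: f) ->
  exists2 q : {poly K}, (size q <= k.+1)%N & f = H k q.
Proof.
have [z [Yz cz uz]] := generic_point.
elim: k f => [|k IH] f.
  rewrite muln0 => hf _; exists ((dehom f)`_0)%:P; first exact: size_polyC_leq1.
  by rewrite hm0C -{1}(hm_dehom hf) /hm big_ord1 !expr0 mul1r.
move=> hf inv; have h0 := kh_gt0 o.
pose x0 := X.@[pt z 1]; pose y0 := Y.@[pt z 1]; pose a := x0 / y0.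
pose c := f.@[pt z 1] / y0 ^+ k.+1.
pose f1 := f - c *: Y ^+ k.+1; pose Z := X - a *: Y.
have hf1 : f1 \is (h * k.+1).-homog by rewrite rpredB // rpredZ // dhomogMn // kY_homog.
have hZ : Z \is h.-homog by rewrite rpredB ?kX_homog // rpredZ // kY_homog.
have Z0 : Z != 0.
  apply/eqP; rewrite /Z -[X]scale1r -scaleNr => /kXY_indep[/eqP].
  by rewrite oner_eq0.
have f1z : f1.@[pt z 1] = 0.
  by rewrite /f1 mevalB mevalZ rmorphXn /= -/y0 /c mulfVK ?subrr // expf_neq0.
have Zz : Z.@[pt z 1] = 0 by rewrite /Z mevalB mevalZ -/x0 -/y0 /a mulfVK ?subrr.
pose rs := [seq (colp g ord0).[z] / (colp g ord_max).[z] | g <- kms o].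
have vanish n (u : S) : u \is n.-homog -> u.@[pt z 1] = 0 ->
    (forall g, g \in kms o -> exists C', sub g u = C' *: u) -> \prod_(r <- rs) ('X - r%:P) %| dehom u.
  move=> hu u0 su; apply: uniq_roots_dvdp; last by rewrite uniq_rootsE.
  apply/allP => _ /mapP[g hg ->]; have [C' e] := su g hg.
  have : (sub g u).@[pt z 1] = 0 by rewrite e mevalZ u0 mulr0.
  have ev (j : 'I_2) : z * g ord0 j + 1 * g ord_max j = (colp g j).[z].
    by rewrite /colp !hornerE mulrC.
  rewrite meval_sub_pt !ev (meval_pt _ _ hu) hev_root ?cz ?size_dehom // => /eqP.
  by rewrite mulf_eq0 expf_eq0 (negbTE (cz g hg)) andbF.
have sP : size (\prod_(r <- rs) ('X - r%:P)) = h.+1.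
  by rewrite size_prod_XsubC size_map size_kms.
have CX g (C : K) : sub g X = C *: X -> sub g Y = C *: Y -> sub g Z = C *: Z.
  by move=> hX hY; rewrite /Z subD subN subZ hX hY scalerBr !scalerA [a * C]mulrC.
have Cf g : g \in kms o -> forall C : K, sub g X = C *: X -> sub g Y = C *: Y -> sub g f1 = C ^+ k.+1 *: f1.
  move=> hg C hX hY; rewrite /f1 subD subN subZ subX (inv g hg C) // hY exprZn scalerBr !scalerA.
  by rewrite [c * _]mulrC.
have dZ := vanish _ _ hZ Zz; have df := vanish _ _ hf1 f1z.
have {}dZ : \prod_(r <- rs) ('X - r%:P) %| dehom Z.
  by apply: dZ => g hg; have [_ [c' [C [_ hX hY]]]] := kms_stab hg; exists C; apply: CX.
have {}df : \prod_(r <- rs) ('X - r%:P) %| dehom f1.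
  by apply: df => g hg; have [_ [c' [C [_ hX hY]]]] := kms_stab hg; exists (C ^+ k.+1); apply: Cf.
have z0 : dehom Z != 0 by apply: contra_neq Z0; apply: dehom_inj hZ.
(* Z has degree [h] and vanishes at the [h] distinct points of the orbit, so its dehomogenization is
   the product of these linear factors up to a constant, and it divides whatever vanishes on the
   orbit. *)
have sZ : size (dehom Z) = h.+1.
  apply/eqP; rewrite eqn_leq size_dehom //= -sP; exact: dvdp_leq.
have {}df : dehom Z %| dehom f1.
  by rewrite -(eqp_dvdl _ (_ : \prod_(r <- rs) ('X - r%:P) %= dehom Z)) // -dvdp_size_eqp // sP sZ.
pose w := dehom f1 %/ dehom Z.
have sw : (size w <= (h * k).+1)%N.
  rewrite /w size_divp // sZ /= leq_subLR addnS -mulnS; exact: size_dehom hf1.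
have fE : f1 = Z * hm (fx K) (fy K) (h * k) w.
  rewrite -[LHS](hm_dehom hf1) -(divpK df) -/w mulrC mulnS hmM ?sZ //.
  by rewrite (hm_dehom hZ).
pose f2 := hm (fx K) (fy K) (h * k) w.
have hx : fx K \is 1.-homog by rewrite dhomogX; apply/eqP; exact: mdeg1.
have hy : fy K \is 1.-homog by rewrite dhomogX; apply/eqP; exact: mdeg1.
have hf2 : f2 \is (h * k).-homog by have := hm_homog (h * k) w hx hy; rewrite mul1n.
have [|q sq f2E] := IH f2 hf2.
  move=> g hg C hX hY; have C0 : C != 0.
    by have [ug _] := kms_stab hg; apply: sub_unit_neq0 ug (kX_neq0 o) hX.
  have := Cf g hg C hX hY; rewrite fE -/f2 sub_mul (CX g C hX hY) => e.
  apply: (mulfI Z0); apply: (scalerI C0); rewrite scalerAl e exprS -scalerA.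
  by rewrite -scalerAr.
exists ((1 *: 'X + (- a)%:P) * q + c%:P).
  apply: leq_trans (size_polyD _ _) _; rewrite geq_max (leq_trans (size_polyC_leq1 _)) // andbT.
  rewrite scale1r polyCN; apply: leq_trans (size_polyMleq _ _) _.
  by rewrite size_XsubC.
have -> : f = Z * f2 + c *: Y ^+ k.+1 by rewrite -fE subrK.
have s1 : (size (1 *: 'X + (- a)%:P)%R <= 2)%N by rewrite scale1r polyCN size_XsubC.
rewrite linearD /= -[in H k.+1 _](add1n k) hmM // hm_linear scale1r scaleNr -/Z -f2E.
by congr (_ + _); rewrite -[c%:P]mulr1 mul_polyC linearZ /= hm_one.
Qed.

End Structure.

Section StructureTheorem.
Variables (K : numClosedFieldType) (t s : 'I_3 -> nat) (V : 'I_3 -> P1 K).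
Variable o : klein_forms t V.
Hypothesis s_gt0 : forall i, (0 < s i)%N.
Local Notation S := {mpoly K[2]}.
Local Notation X := (kX o).
Local Notation Y := (kY o).
Local Notation h := (kh o).
Local Notation mon := (mon s o).
Local Notation e_ := (e_ t s).
Local Notation d_ := (d_ s o).
Local Notation stab := (stab s o).
Local Notation lp := (lp V).
Local Notation W i := (pcoord (V i)).
Implicit Types (q r : {poly K}) (n m : nat) (g : 'M[K]_2) (f : S).

Lemma hevM (a b : K) e e' q r : (size q <= e.+1)%N -> (size r <= e'.+1)%N ->
  hev a b (e + e') (q * r) = hev a b e q * hev a b e' r.
Proof. exact: (@hmM K K^o a b). Qed.

Lemma hev_lp i j : hev (W j).1 (W j).2 1 (lp i) = pdet (V j) (V i).
Proof.
rewrite /hev big_ord_recl big_ord1 /lp !coefD !coefZ !coefX !coefC /= /pdet.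
rewrite !expr0 !expr1; ring.
Qed.

Lemma lp_dvd i e q : (size q <= e.+2)%N -> hev (W i).1 (W i).2 e.+1 q = 0 ->
  exists2 q' : {poly K}, (size q' <= e.+1)%N & q = lp i * q'.
Proof.
rewrite /lp /pcoord; case: (V i) => [a|] /= sq.
  rewrite hev1 // => /eqP/factor_theorem[q' qE]; exists q'.
    have [->|q0] := eqVneq q' 0; first by rewrite size_poly0.
    by move: sq; rewrite qE size_Mmonic ?monicXsubC // size_XsubC addn2.
  by rewrite scale1r polyCN mulrC.
rewrite hev0 expr1n mulr1 => qe; exists (- q); last by rewrite scale0r add0r polyCN mulrNN mul1r.
rewrite size_polyN; move: sq; rewrite leq_eqVlt => /orP[/eqP sq|//].
by move/eqP: qe; rewrite -[e.+1]/(e.+2.-1) -sq lead_coef_eq0 => /eqP q0; rewrite q0 size_poly0 in sq.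
Qed.

Lemma lp_dvd_seq (l : seq 'I_3) e q : uniq l -> (size q <= (size l + e).+1)%N ->
  (forall i, i \in l -> hev (W i).1 (W i).2 (size l + e) q = 0) ->
  exists2 q' : {poly K}, (size q' <= e.+1)%N & q = (\prod_(i <- l) lp i) * q'.
Proof.
elim: l q => [|i l IH] q /=; first by exists q; rewrite // big_nil mul1r.
move=> /andP[il ul] sq hq.
have [|q1 sq1 qE] := @lp_dvd i _ _ sq; first by apply: hq; rewrite inE eqxx.
have [j jl|q' sq' q1E] := IH q1 ul sq1.
  have := hq j; rewrite inE jl orbT => /(_ isT).
  rewrite qE -[((size l).+1 + e)%N]/(1 + (size l + e))%N hevM ?size_lp // hev_lp => /eqP.
  rewrite mulf_eq0 => /orP[|/eqP //]; rewrite (negbTE (pdet_neq0 _)) //.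
  by rewrite (inj_eq (kV_inj o)); apply: contraNneq il => <-.
by exists q' => //; rewrite big_cons qE q1E mulrA.
Qed.

(* The product of [f] with powers of the special forms is a form in X and Y; it
   vanishes at the zeros of the special forms, so the powers can be divided out. *)
Lemma invariant_mon n f : f \is n.-homog -> f != 0 ->
  (forall g, stab g -> sub g f = f) ->
  exists k (r : {poly K}), [/\ n = (k * d_)%N, (size r <= (e_ k).+1)%N & f = mon k r].
Proof.
move=> hf f0 inv; have [k nE] := invariant_degree s_gt0 hf f0 inv; exists k.
pose M i := (t i - rm t s i k)%N.
have rmt i : (rm t s i k < t i)%N by rewrite ltn_mod (kt_gt0 o).
have M0 i : (0 < M i)%N by rewrite subn_gt0.
(* If f is [mon k r], then [f * G] is the product of the three F_i^t_i with a form of degree [e_ k]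
   in X and Y, which accounts for the 3. *)
pose k' := (3 + e_ k)%N.
have k'E : k' = (\sum_i (fl t s i k).+1)%N.
  transitivity (\sum_(i < 3) (1 + fl t s i k))%N; last by [].
  by rewrite big_split /= sum_nat_const card_ord.
pose G := \prod_i o i ^+ M i.
have hG : f * G \is (h * k').-homog.
  have -> : (h * k' = n + \sum_i khd o i * M i)%N.
    rewrite nE k'E /d_ !big_distrr /= -big_split /=; apply: eq_bigr => i _.
    rewrite -(khd_t o i) /M; have := rmt i; have := flrm t s i k; nia.
  by rewrite dhomogM // prodF_homog.
have sG g : g \in kms o -> forall C, sub g X = C *: X -> sub g Y = C *: Y ->
    sub g (f * G) = C ^+ k' *: (f * G).
  move=> hg C hX hY; have [l l0 sl] := kms_scaled s_gt0 hg.
  have [_ [c [C' [hF' hX' hY' hs']]]] := sl.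
  have CE : C' = l ^+ h * C.
    move/eqP: hX'; rewrite (sub_scale_mx _ _ (kX_homog o)) hX scalerA -subr_eq0 -scalerBl.
    by rewrite scaler_eq0 (negbTE (kX_neq0 o)) orbF subr_eq0 => /eqP.
  have e1 : sub (l *: g) (f * G) = C' ^+ k' *: (f * G).
    rewrite sub_mul (inv _ sl) scalerAr; congr (_ * _).
    rewrite /G sub_prod.
    transitivity ((\prod_i c i ^+ s i) ^+ k *: \prod_i sub (l *: g) (o i ^+ M i)).
      by rewrite hs' expr1n scale1r.
    rewrite -prodrXl k'E expr_sum -!scaler_prod; apply: eq_bigr => i _.
    rewrite subX hF' exprZn scalerA -(sub_ct hF' hX' hY' i) -!exprM -exprD.
    congr (_ ^+ _ *: _); rewrite /M; have := rmt i; have := flrm t s i k; nia.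
  move: e1; rewrite (sub_scale_mx _ _ hG) CE exprMn -exprM -scalerA.
  by apply: scalerI; rewrite expf_neq0.
have [q sq qE] := pencil_form hG sG.
(* [M i] is positive, so [f * G] vanishes at a zero of F_i, and there (X, Y) is a nonzero multiple
   of the coordinates of V_i. *)
have van i : hev (W i).1 (W i).2 k' q = 0.
  have [v [[j vj] Fv]] := homog_root (khd_gt0 o i) (kF_homog o i).
  have Gv : hev X.@[v] Y.@[v] k' q = 0.
    rewrite -meval_hm -qE mevalM /G rmorph_prod /= (bigD1 i) //= rmorphXn /= Fv.
    by rewrite expr0n (gtn_eqF (M0 i)) mul0r mulr0.
  have lv : (W i).2 * X.@[v] = (W i).1 * Y.@[v].
    have := congr1 (meval v) (kF_t o i); rewrite rmorphXn /= Fv expr0n (gtn_eqF (kt_gt0 o i)).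
    by rewrite mevalB !mevalZ => /esym/eqP; rewrite subr_eq0 => /eqP.
  have [c c0 [Xc Yc]] : exists2 c, c != 0 & X.@[v] = c * (W i).1 /\ Y.@[v] = c * (W i).2.
    move: lv; rewrite /pcoord; case: (V i) => [a|] /=.
      rewrite mul1r => Xa; exists Y.@[v]; last by rewrite mulr1 mulrC.
      apply/eqP => Y0; move/eqP: vj; apply; apply: (@kXY_eq0 _ _ _ o) => //.
      by rewrite Xa Y0 mulr0.
    rewrite mul0r mul1r => /esym Y0; exists X.@[v]; last by rewrite mulr1 mulr0.
    by apply/eqP => X0; move/eqP: vj; apply; exact: (@kXY_eq0 _ _ _ o v X0 Y0 j).
  move/eqP: Gv; rewrite Xc Yc hevZ mulf_eq0 expf_eq0 (negbTE c0) andbF /= => /eqP.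
  by [].
have s3 : size (index_enum 'I_3) = 3 by rewrite -sum1_size sum_nat_const card_ord.
have [||q' sq' q'E] := @lp_dvd_seq (index_enum 'I_3) (e_ k) q (index_enum_uniq _).
- by rewrite s3.
- by move=> i _; rewrite s3.
exists q'; split=> //; apply: (mulIf (prodF_neq0 o M)); rewrite -/G qE q'E.
have [sl hl] := lw_hm o (fun=> 1%N).
have lwE : lw V (fun=> 1%N) = \prod_i lp i by apply: eq_bigr => i _; rewrite expr1.
have s1 : (\sum_(i < 3) 1 = 3)%N by rewrite sum_nat_const card_ord.
rewrite s1 in sl hl.
rewrite -lwE /k' hmM // hl /mon mulrAC /G -big_split /=; congr (_ * _); apply: eq_bigr => i _.
by rewrite -exprD muln1 subnKC // ltnW.
Qed.
End StructureTheorem.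

Section FiniteMatrixGroup.
Variables (K : fieldType) (P : 'M[K]_2 -> Prop) (L : seq 'M[K]_2).
Hypotheses (PL : forall g, P g -> g \in L) (P1 : P 1)
  (PM : forall g g', P g -> P g' -> P (g * g')) (PV : forall g, P g -> P g^-1)
  (PU : forall g, P g -> g \in unitmx).

Definition matrix_group : Type := seq_sub [seq g <- L | `[< P g >]].
HB.instance Definition _ := Finite.copy matrix_group (seq_sub [seq g <- L | `[< P g >]]).
Local Notation T := matrix_group.

Let memT g : (g \in [seq g <- L | `[< P g >]]) = `[< P g >].
Proof.
by rewrite mem_filter; apply/andP/idP => [[] //|h]; split=> //; apply: PL; apply/asboolP.
Qed.

Let TP (a : T) : P (ssval a).
Proof. by apply/asboolP; rewrite -memT; apply: ssvalP. Qed.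

Let mk g (h : P g) : T := @SeqSub _ _ g (etrans (memT g) (introT (asboolP _) h)).

Let mulT (a b : T) : T := mk (PM (TP a) (TP b)).
Let oneT : T := mk P1.
Let invT (a : T) : T := mk (PV (TP a)).

Let mulTA : associative mulT.
Proof. by move=> a b c; apply: val_inj; apply: mulrA. Qed.
Let mul1T : left_id oneT mulT.
Proof. by move=> a; apply: val_inj; apply: mul1r. Qed.
Let mulVT : left_inverse oneT invT mulT.
Proof. by move=> a; apply: val_inj; apply: mulVr; apply: PU; apply: TP. Qed.

HB.instance Definition _ := Finite_isGroup.Build T mulTA mul1T mulVT.

Lemma finite_matrix_group : exists (gT : finGroupType) (f : gT -> 'M[K]_2),
  [/\ f 1%g = 1, forall a b, f (a * b)%g = f a * f b & forall g, P g <-> exists a, f a = g].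
Proof.
exists T, (@ssval _ _); split=> // g; split=> [h|[a <-]]; last exact: TP.
by exists (mk h).
Qed.
End FiniteMatrixGroup.

(** * Sections of the multiples of D *)

(* Unification is very slow in [{fraction {poly k}}], hence the detour through an
   abstract field of fractions. *)
Section AbstractFraction.
Variables (A : idomainType) (F : fieldType) (i : {rmorphism A -> F}).
Hypothesis i_eq0 : forall p, (i p == 0) = (p == 0).
Implicit Types (p q : A) (f g : F).

Lemma afrac_num_neq0 f p q : f != 0 -> q != 0 -> f * i q = i p -> p != 0.
Proof. by move=> f0 q0 e; rewrite -i_eq0 -e mulf_neq0 // i_eq0. Qed.

Lemma afrac_inj p q : i p = i q -> p = q.
Proof. by move/eqP; rewrite -subr_eq0 -rmorphB i_eq0 subr_eq0 => /eqP. Qed.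

Lemma afrac_poly f q d : d != 0 -> f * i d = i (q * d) -> f = i q.
Proof.
move=> d0; rewrite rmorphM => /mulIf; apply; by rewrite i_eq0.
Qed.

Lemma afrac_mulr f p q l : f * i q = i p -> (f * i l) * i q = i (p * l).
Proof. by move=> e; rewrite mulrAC e rmorphM. Qed.

Lemma afracM f g l l' c q q' : f * i l = i q -> g * i l' = i q' ->
  (f * g) * i (l * l' * c) = i (c * (q * q')).
Proof. by move=> e e'; rewrite !rmorphM mulrA mulrACA e e' mulrC. Qed.

Lemma afracD f g l q q' : f * i l = i q -> g * i l = i q' -> (f + g) * i l = i (q + q').
Proof. by move=> e e'; rewrite mulrDl e e' rmorphD. Qed.

Lemma afracZ f l q c : f * i l = i q -> (i c * f) * i l = i (c * q).
Proof. by move=> e; rewrite -mulrA e rmorphM. Qed.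

Lemma afrac_mul_neq0 f l : f != 0 -> l != 0 -> f * i l != 0.
Proof. by move=> f0 l0; rewrite mulf_neq0 // i_eq0. Qed.

Lemma afrac_eq0 f l : l != 0 -> f * i l = i 0 -> f = 0.
Proof.
move=> l0 /eqP; rewrite rmorph0 mulf_eq0 i_eq0 (negbTE l0) orbF => /eqP //.
Qed.

Lemma afrac_ex l q : l != 0 -> exists f, f * i l = i q.
Proof. by move=> l0; exists (i q / i l); rewrite mulfVK // i_eq0. Qed.

Lemma afrac1 f q : f = i q -> f * i 1 = i q.
Proof. by move->; rewrite rmorph1 mulr1. Qed.

Lemma afrac0 l : 0 * i l = i 0.
Proof. by rewrite mul0r rmorph0. Qed.
End AbstractFraction.

Section OrdOfFraction.
Variable k : fieldType.
Local Notation "x %:F" := (tofrac x).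

Let i_eq0 (p : {poly k}) : (p%:F == 0) = (p == 0).
Proof. exact: tofrac_eq0. Qed.

Let de0 (f : function_field k) : \d_(repr f) != 0.
Proof. exact: denom_ratioP. Qed.

Lemma ordE (P : P1 k) (f : function_field k) (p q : {poly k}) :
  f != 0 -> q != 0 -> f * q%:F = p%:F -> ord P f = poly_ord P p - poly_ord P q.
Proof. exact: (aordE i_eq0 de0 (@fracE k)). Qed.

Implicit Types (f g : function_field k) (p q l c : {poly k}).

Lemma frac_num_neq0 f p q : f != 0 -> q != 0 -> f * q%:F = p%:F -> p != 0.
Proof. exact: (afrac_num_neq0 i_eq0). Qed.
Lemma tofrac_inj p q : p%:F = q%:F -> p = q.
Proof. exact: (afrac_inj i_eq0). Qed.
Lemma frac_polyE f q d : d != 0 -> f * d%:F = (q * d)%:F -> f = q%:F.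
Proof. exact: (afrac_poly i_eq0). Qed.
Lemma frac_mulr f p q l : f * q%:F = p%:F -> (f * l%:F) * q%:F = (p * l)%:F.
Proof. exact: afrac_mulr. Qed.
Lemma fracM f g l l' c q q' : f * l%:F = q%:F -> g * l'%:F = q'%:F ->
  (f * g) * (l * l' * c)%:F = (c * (q * q'))%:F.
Proof. exact: afracM. Qed.
Lemma fracD f g l q q' : f * l%:F = q%:F -> g * l%:F = q'%:F -> (f + g) * l%:F = (q + q')%:F.
Proof. exact: afracD. Qed.
Lemma fracZ f l q c : f * l%:F = q%:F -> (c%:F * f) * l%:F = (c * q)%:F.
Proof. exact: afracZ. Qed.
Lemma frac_mul_neq0 f l : f != 0 -> l != 0 -> f * l%:F != 0.
Proof. exact: (afrac_mul_neq0 i_eq0). Qed.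
Lemma frac_eq0 f l : l != 0 -> f * l%:F = 0%:F -> f = 0.
Proof. exact: (afrac_eq0 i_eq0). Qed.
Lemma frac_ex l q : l != 0 -> exists f : function_field k, f * l%:F = q%:F.
Proof. exact: (afrac_ex i_eq0). Qed.
Lemma frac1 f q : f = q%:F -> f * 1%:F = q%:F.
Proof. exact: afrac1. Qed.
Lemma frac0 l : (0 : function_field k) * l%:F = 0%:F.
Proof. exact: afrac0. Qed.

End OrdOfFraction.

Section FractionFacts.
Variable K : closedFieldType.
Local Notation "x %:F" := (tofrac x).
Implicit Types (p q : {poly K}) (f g : function_field K).

Lemma dvdp_mup p q : q != 0 -> p != 0 -> (forall a, mup a q <= mup a p)%N -> q %| p.
Proof.
move=> q0 p0; have [n] := ubnP (size q); elim: n => // n IH in p q q0 p0 *; rewrite ltnS => sq le.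
have [s1|s1] := leqP (size q) 1.
  have q1 : q %= 1 by rewrite -size_poly_eq1 eqn_leq s1 size_poly_gt0.
  by rewrite (eqp_dvdl _ q1) dvd1p.
have [a ra] := closed_rootP q (negbT (gtn_eqF s1)).
have /factor_theorem[q' qE] := ra.
have m1 : (0 < mup a q)%N by rewrite -XsubC_dvd // dvdp_XsubCl.
have /factor_theorem[p' pE] : root p a.
  by rewrite -dvdp_XsubCl XsubC_dvd // (leq_trans m1 (le a)).
move: q0 p0 sq le; rewrite qE pE !mulf_eq0 !negb_or => /andP[q'0 X0] /andP[p'0 _].
rewrite size_Mmonic ?monicXsubC // size_XsubC addn2 => sq le.
rewrite dvdp_mul2r //; apply: IH => // b.
by have := le b; rewrite !mupM // leq_add2r.
Qed.

Lemma frac_poly f : f != 0 -> (forall a : K, 0 <= ord (Some a : P1 K) f) -> exists q, f = q%:F.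
Proof.
move=> f0 o_f; set n := \n_(repr f); set d := \d_(repr f).
have d0 : d != 0 by exact: denom_ratioP.
have fd : f * d%:F = n%:F by exact: fracE.
have n0 : n != 0 by exact: frac_num_neq0 f0 d0 fd.
have /divpK dn : d %| n.
  by apply: dvdp_mup => // a; have := o_f a; rewrite subr_ge0 lez_nat.
by exists (n %/ d); apply: (frac_polyE d0); rewrite dn.
Qed.
End FractionFacts.

Section SectionsOfMultiples.
Variables (K : numClosedFieldType) (t s : 'I_3 -> nat) (V : 'I_3 -> P1 K).
Hypotheses (t_gt0 : forall i, (0 < t i)%N) (V_inj : injective V).
Variable D : Qdivisor K.
Hypothesis DE : forall P, coeff P D = \sum_i (s i)%:R / (t i)%:R * (V i == P)%:R.
Local Notation "x %:F" := (tofrac x).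
Local Notation fl := (fl t s).
Local Notation e_ := (e_ t s).
Local Notation lp := (lp V).
Local Notation lw := (lw V).
Local Notation flw n := (lw (fun i => fl i n)).
Local Notation F := (function_field K).
Implicit Types (p q r : {poly K}) (n m : nat).

Definition bnd n (P : P1 K) := (\sum_i fl i n * (V i == P))%N.

Lemma bnd_at n i : bnd n (V i) = fl i n.
Proof.
rewrite /bnd (bigD1 i) //= eqxx muln1 big1 ?addn0 // => j ne.
by rewrite (inj_eq V_inj) (negbTE ne) muln0.
Qed.

Lemma coeff_at i : coeff (V i) D = (s i)%:R / (t i)%:R.
Proof.
rewrite DE (bigD1 i) //= eqxx mulr1 big1 ?addr0 // => j ne.
by rewrite (inj_eq V_inj) (negbTE ne) mulr0.
Qed.

(** For an integer m, the conditions m + x >= 0 and m + floor(x) >= 0 are equivalent; this is the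
    rounding down of n D. *)
Lemma coeff_bnd n P (m : int) :
  (0 <= m%:~R + coeff P (D *+ n)) = (0 <= m + (bnd n P)%:Z).
Proof.
rewrite coeffMn; have [[i <-]|no] := pselect (exists i, V i = P).
  rewrite coeff_at bnd_at; case: m => m.
    rewrite addr_ge0 ?ler0n // ?mulrn_wge0 // ?divr_ge0 ?ler0n //.
  have tr : 0 < (t i)%:R :> rat by rewrite ltr0n t_gt0.
  rewrite NegzE mulrNz ![- _ + _]addrC !subr_ge0 lez_nat /fl leq_divRL ?t_gt0 //.
  rewrite -mulrnAl -mulrnA ler_pdivlMr // [(s i * n)%N]mulnC.
  by rewrite -[(m.+1)%:~R]/(m.+1%:R) -natrM ler_nat.
have no' i : (V i == P) = false by apply/eqP => e; apply: no; exists i.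
rewrite DE big1 => [|i _]; last by rewrite no' mulr0.
rewrite /bnd big1 => [|i _]; last by rewrite no' muln0.
by rewrite mul0rn !addr0 ler0z.
Qed.

(** The pole at infinity comes from dehomogenizing an equation of degree 1. For V_i at infinity the
    two terms cancel, in accordance with [lp i] being constant. *)
Lemma poly_ord_lp P i : poly_ord P (lp i) = (V i == P)%:Z - (P == None :> P1 K)%:Z.
Proof.
rewrite /poly_ord /Defs.poly_ord /lp /pcoord; case: P => [a|]; case: (V i) => [b|] /=.
- rewrite scale1r polyCN -[_ - _]expr1 mup_XsubCX subr0.
  by rewrite -[Some b == Some a]/(b == a); case: (b == a).
- rewrite scale0r add0r mupNroot ?subr0 // rootC oppr_eq0 oner_eq0 //.
- by rewrite scale1r polyCN size_XsubC.
- by rewrite scale0r add0r size_polyC oppr_eq0 oner_eq0.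
Qed.

Lemma poly_ord_exp P p n : p != 0 -> poly_ord P (p ^+ n) = poly_ord P p *+ n.
Proof.
move=> p0; elim: n => [|n IH]; last by rewrite exprS poly_ordM ?expf_neq0 // IH mulrS.
rewrite expr0 mulr0n /poly_ord; case: P => [a|]; last by rewrite size_poly1.
by rewrite mupNroot ?root1.
Qed.

Lemma poly_ord_lw P c :
  poly_ord P (lw c) = (\sum_i c i * (V i == P))%N%:Z - ((P == None :> P1 K) * \sum_i c i)%N%:Z.
Proof.
rewrite /lw; elim: (index_enum _) => [|i l IH].
  by rewrite !big_nil muln0 subrr -(expr0 (1 : {poly K})) poly_ord_exp ?oner_eq0.
rewrite !big_cons poly_ordM ?expf_neq0 ?lp_neq0 //; last first.
  by rewrite prodf_seq_neq0; apply/allP => j _; rewrite /= expf_neq0 // lp_neq0.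
rewrite IH poly_ord_exp ?lp_neq0 // poly_ord_lp.
by case: (V i == P); case: (P == None); rewrite /=; lia.
Qed.

(* [q] is the numerator of the section [f] of [n D] with respect to the equations
   of the [V i]. *)
Definition num_of n (f : F) q := (size q <= (e_ n).+1)%N /\ f * (flw n)%:F = q%:F.

(** Multiplying by the equations of floor(n D) clears the poles at finite distance, so the product
    is a polynomial; the condition at infinity becomes the bound on its degree. *)
Lemma H0_num n (f : F) : H0 (D *+ n) f <-> exists q, num_of n f q.
Proof.
have l0 : flw n != 0 by exact: lw_neq0.
have [->|f0] := eqVneq f 0.
  split=> _; last by move=> /eqP; rewrite eqxx.
  by exists 0; split; [rewrite size_poly0|exact: frac0].
split=> [hf|[q [sq qE]] _ P].
  have {}hf P : 0 <= ord P f + (bnd n P)%:Z.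
    by rewrite -coeff_bnd; apply: hf; apply/eqP.
  pose g := f * (flw n)%:F; have g0 : g != 0 by exact: frac_mul_neq0.
  have og P : ord P g = ord P f + poly_ord P (flw n).
    have := fracE f; set nf := \n_(_); set df := \d_(_) => fE.
    have d0 : df != 0 by exact: denom_ratioP.
    have n0 : nf != 0 by exact: frac_num_neq0 f0 d0 fE.
    rewrite (ordE P f0 d0 fE) (ordE P g0 d0 (frac_mulr (flw n) fE)).
    by rewrite poly_ordM // addrAC.
  have [a|q qE] := frac_poly g0.
    by have := hf (Some a); rewrite og poly_ord_lw /bnd mul0n subr0.
  exists q; split=> //; have gE := frac1 qE.
  have q0 : q != 0 by exact: frac_num_neq0 g0 (oner_neq0 _) gE.
  have := hf None; rewrite -[ord None f](addrK (poly_ord None (flw n))) -og poly_ord_lw eqxx mul1n.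
  rewrite (ordE _ g0 (oner_neq0 _) gE).
  have -> : poly_ord None (1 : {poly K}) = 0 by rewrite /= size_poly1.
  rewrite /= /bnd /e_; set u := (\sum_(i < 3) _)%N; set v := (\sum_(i < 3) _)%N.
  rewrite subr0 opprB addrA subrK addrC subr_ge0 lez_nat.
  by case: (size q).
have q0 : q != 0 by exact: frac_num_neq0 f0 l0 qE.
rewrite coeff_bnd (ordE P f0 l0 qE) poly_ord_lw -/(bnd n P).
rewrite opprB addrA subrK; case: P => [a|] /=; first by rewrite mul0n addr0 le0z_nat.
rewrite ?eqxx mul1n addrC subr_ge0 lez_nat -ltnS.
by move: sq; rewrite /e_; case: (size q).
Qed.

End SectionsOfMultiples.

Section KleinAction.
Variables (K : numClosedFieldType) (t s : 'I_3 -> nat) (V : 'I_3 -> P1 K).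
Variable o : klein_forms t V.
Hypothesis s_gt0 : forall i, (0 < s i)%N.

Lemma klein_action : exists (gT : finGroupType) (act : graded_action K 2 gT),
  forall f, (forall a, act a f = f) <-> (forall g, stab s o g -> sub g f = f).
Proof.
have [L hL] := stab_finite o s_gt0.
have [gT [fM [f1 fm fP]]] := finite_matrix_group hL (stab1 s o) (@stabM _ _ s _ o)
  (@stabV _ _ s _ o) (fun g hg => proj1 hg).
pose act_fun (a : gT) : {lrmorphism {mpoly K[2]} -> {mpoly K[2]}} := sub (fM a).
have act1 f : act_fun 1%g f = f by rewrite /act_fun /= f1 sub1.
have actM g h f : act_fun (g * h)%g f = act_fun g (act_fun h f).
  by rewrite /act_fun /= fm subM.
have acth g n f : f \is n.-homog -> act_fun g f \is n.-homog by exact: sub_homog.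
exists gT, (GradedAction act1 actM acth) => f; split=> /= h g.
  by move=> /fP[a <-]; apply: h.
by apply: h; apply/fP; exists g.
Qed.
End KleinAction.

(** * The isomorphism from the section ring to the invariant ring *)

Section SectionRingIso.
Variables (K : numClosedFieldType) (t s : 'I_3 -> nat) (V : 'I_3 -> P1 K).
Variable o : klein_forms t V.
Hypothesis s_gt0 : forall i, (0 < s i)%N.
Variable D : Qdivisor K.
Hypothesis DE : forall P, coeff P D = \sum_i (s i)%:R / (t i)%:R * (V i == P)%:R.
Variables (gT : finGroupType) (act : graded_action K 2 gT).
Hypothesis actP : forall f,
  (forall a, act a f = f) <-> (forall g, stab s o g -> sub g f = f).
Local Notation "x %:F" := (tofrac x).
Local Notation S := {mpoly K[2]}.
Local Notation mon := (mon s o).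
Local Notation e_ := (e_ t s).
Local Notation d_ := (d_ s o).
Local Notation F := (function_field K).
Local Notation flw n := (lw V (fun i => fl t s i n)).
Local Notation num_of := (num_of t s V).
Implicit Types (q r : {poly K}) (n m : nat) (f : F) (a b : section_ring D).

Let H0_num n f : H0 (D *+ n) f <-> exists q, num_of n f q.
Proof. exact: (@H0_num K t s V (kt_gt0 o) (@kV_inj _ _ _ o) D DE n f). Qed.

Lemma num_of_uniq n f q r : num_of n f q -> num_of n f r -> q = r.
Proof. by move=> [_ e] [_ e']; apply: tofrac_inj; rewrite -e -e'. Qed.

Lemma num_of0 n : num_of n 0 0.
Proof. by split; [rewrite size_poly0|exact: frac0]. Qed.

Lemma num_ofD n f f' q q' : num_of n f q -> num_of n f' q' -> num_of n (f + f') (q + q').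
Proof.
move=> [sq e] [sq' e']; split; last exact: fracD.
by apply: leq_trans (size_polyD _ _) _; rewrite geq_max sq.
Qed.

Lemma num_ofZ n (c : K) f q : num_of n f q -> num_of n ((c%:P)%:F * f) (c *: q).
Proof.
move=> [sq e]; split; first exact: leq_trans (size_scale_leq _ _) sq.
by rewrite -mul_polyC; exact: fracZ.
Qed.

Lemma num_ofM n m f f' q q' : num_of n f q -> num_of m f' q' ->
  num_of (n + m) (f * f') (lw V (cr t s n m) * (q * q')).
Proof.
move=> [sq e] [sq' e']; split; first exact: (size_monM (s := s) o sq sq').
have -> : flw (n + m) = flw n * flw m * lw V (cr t s n m).
  by rewrite -!lwD; apply: eq_lw => i; apply: (fl_cr s o).
exact: fracM.
Qed.

Definition numer n f : {poly K} := xget 0 [set q | num_of n f q].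

Lemma numerP n f : H0 (D *+ n) f -> num_of n f (numer n f).
Proof. by move/H0_num; apply: xgetPex. Qed.

Lemma numerE n f q : num_of n f q -> numer n f = q.
Proof.
move=> h; apply: num_of_uniq (h); apply: numerP; apply/H0_num; by exists q.
Qed.

Lemma section_H0 a n : H0 (D *+ n) (val a)`_n.
Proof. by have /asboolP := section_valP a; apply. Qed.

Definition to_forms a : S := \sum_(n < size (val a)) mon n (numer n (val a)`_n).

Lemma to_forms_wide a N : (size (val a) <= N)%N ->
  to_forms a = \sum_(n < N) mon n (numer n (val a)`_n).
Proof.
move=> sN; rewrite /to_forms (big_ord_widen N (fun n => mon n (numer n (val a)`_n))) // big_mkcond /=.
apply: eq_bigr => n _; case: ifP => // /negbT; rewrite -leqNgt => le.
by rewrite nth_default // (numerE (num_of0 n)) linear0.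
Qed.

Lemma to_forms_is_linear : linear to_forms.
Proof.
move=> c a b; pose N := maxn (size (val (c *: a + b))) (maxn (size (val a)) (size (val b))).
rewrite !(@to_forms_wide _ N) /N ?leq_max ?leqnn ?orbT //.
rewrite scaler_sumr -big_split; apply: eq_bigr => n _.
have -> : (val (c *: a + b))`_n = (c%:P)%:F * (val a)`_n + (val b)`_n.
  by rewrite /= coefD coefZ.
have ha := numerP (@section_H0 a n); have hb := numerP (@section_H0 b n).
by rewrite (numerE (num_ofD (num_ofZ c ha) hb)) linearP.
Qed.
HB.instance Definition _ :=
  GRing.isLinear.Build K (section_ring D) S _ to_forms to_forms_is_linear.

Lemma to_forms_monom a n f : val a = f *: 'X^n -> to_forms a = mon n (numer n f).
Proof.
move=> e; rewrite (@to_forms_wide a n.+1); last first.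
  by rewrite e (leq_trans (size_scale_leq _ _)) // size_polyXn.
rewrite (bigD1 ord_max) //= e coefZ coefXn eqxx mulr1 big1 ?addr0 // => i ne.
rewrite coefZ coefXn; have -> : (i == n :> nat) = false by apply/negbTE.
by rewrite mulr0 (numerE (num_of0 i)) linear0.
Qed.

Lemma to_forms_is_multiplicative : multiplicative to_forms.
Proof.
split=> [a b|]; last first.
  have v1 : val (1 : section_ring D) = 1 *: 'X^0 by rewrite scale1r expr0.
  rewrite (to_forms_monom v1).
  have -> : numer 0 1 = 1.
    apply: numerE; split; first by rewrite size_poly1.
    have -> : flw 0 = 1 by apply: lw1 => i; rewrite /fl mul0n div0n.
    by apply: frac1; rewrite tofrac1.
  exact: mon01.
have [N [ca [hca ->]]] := section_piece_dec a; have [M [cb [hcb ->]]] := section_piece_dec b.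
rewrite mulr_suml !linear_sum mulr_suml; apply: eq_bigr => i _.
rewrite mulr_sumr linear_sum mulr_sumr; apply: eq_bigr => j _.
have [f ef] := hca i; have [f' ef'] := hcb j.
have eff : val (ca i * cb j) = (f * f') *: 'X^(i + j).
  transitivity ((f *: 'X^i) * (f' *: 'X^j)); first by rewrite -ef -ef'.
  by rewrite -scalerAl -scalerAr scalerA exprD.
rewrite /= (to_forms_monom ef) (to_forms_monom ef') (to_forms_monom eff).
have H0c (c : section_ring D) (g : F) n : val c = g *: 'X^n -> H0 (D *+ n) g.
  by move=> e; have := @section_H0 c n; rewrite e coefZ coefXn eqxx mulr1.
have h1 := numerP (H0c _ _ _ ef); have h2 := numerP (H0c _ _ _ ef').
by rewrite (numerE (num_ofM h1 h2)) (monM o h1.1 h2.1).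
Qed.
HB.instance Definition _ :=
  GRing.isMultiplicative.Build (section_ring D) S to_forms to_forms_is_multiplicative.

Lemma to_forms_invariant a : to_forms a \in invariant_pred act.
Proof.
apply/invariantP/actP => g hg; rewrite /to_forms sub_sum; apply: eq_bigr => n _.
exact: stab_mon.
Qed.

Definition section_iso a : invariant_ring act := InvariantRing (to_forms_invariant a).

Lemma section_iso_is_linear : linear section_iso.
Proof. by move=> c a b; apply: val_inj; rewrite /= linearP. Qed.
HB.instance Definition _ := GRing.isLinear.Build K (section_ring D) (invariant_ring act) _
  section_iso section_iso_is_linear.

Lemma section_iso_is_multiplicative : multiplicative section_iso.
Proof. by split=> [a b|]; apply: val_inj; rewrite /= ?rmorphM ?rmorph1. Qed.
HB.instance Definition _ := GRing.isMultiplicative.Build (section_ring D) (invariant_ring act)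
  section_iso section_iso_is_multiplicative.

Lemma invariant_monP n (f : invariant_ring act) : val f \is n.-homog -> val f != 0 ->
  exists k (r : {poly K}), [/\ n = (k * d_)%N, (size r <= (e_ k).+1)%N & val f = mon k r].
Proof.
move=> hf f0; apply: (invariant_mon s_gt0 hf f0); apply/actP/invariantP.
exact: invariant_valP.
Qed.

Lemma section_of_num n q : (size q <= (e_ n).+1)%N ->
  exists2 a : section_ring D, section_piece n a & to_forms a = mon n q.
Proof.
move=> sq; have [f fE] := frac_ex q (lw_neq0 V (fun i => fl t s i n)).
have nq : num_of n f q by [].
have hf : H0 (D *+ n) f by apply/H0_num; exists q.
have mem : f *: 'X^n \in section_pred D.
  apply/asboolP => m; rewrite coefZ coefXn; have [->|_] := eqVneq m n; first by rewrite mulr1.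
  by rewrite mulr0; apply: H0_0.
exists (SectionRing mem); first by exists f.
by rewrite (@to_forms_monom (SectionRing mem) n f) // (numerE nq).
Qed.

Lemma section_iso_piece n :
  section_iso @` section_grading D n = invariant_grading act (d_ * n)%N.
Proof.
have d0 := d_gt0 o s_gt0.
apply/seteqP; split=> [_ [a [f ef] <-]|g hg].
  rewrite /= /invariant_piece /= (to_forms_monom ef) mulnC; exact: mon_homog.
have [g0|g0] := eqVneq (val g) 0.
  exists 0; first exact: section_piece0.
  by apply: val_inj; rewrite raddf0 g0.
have [k [r [e sr gE]]] := invariant_monP hg g0.
have {e} kn : k = n by move/eqP: e; rewrite mulnC eqn_pmul2r // => /eqP.
subst k; have [a ha aE] := section_of_num sr.
by exists a => //; apply: val_inj; rewrite /= aE gE.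
Qed.

Lemma section_iso_bij : bijective section_iso.
Proof.
have d0 := d_gt0 o s_gt0.
have inj : injective section_iso.
  apply: raddf_inj => a /(congr1 val); rewrite [val 0]raddf0 /= /to_forms => e.
  apply: val_inj; rewrite [RHS]raddf0; apply/polyP => n; rewrite coef0.
  have [le|lt] := leqP (size (val a)) n; first exact: nth_default.
  have hn := numerP (@section_H0 a n).
  have : mon n (numer n (val a)`_n) = 0.
    have := congr1 (pihomog mdeg (n * d_)%N) e; rewrite pihomog0 raddf_sum /=.
    rewrite (bigD1 (Ordinal lt)) //= big1 => [|i ne].
      by rewrite addr0 pihomog_dE // mon_homog.
    apply: (@pihomog_ne0 _ _ mdeg (i * d_)%N); last exact: mon_homog.
    by rewrite eqn_pmul2r.
  move/(mon_eq0 hn.1) => q0; apply: (frac_eq0 (lw_neq0 V (fun i => fl t s i n))).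
  by rewrite hn.2 q0.
have surj g : exists a, section_iso a = g.
  have [N [c [hc ->]]] := invariant_piece_dec g.
  have hs n : exists a, section_iso a = c n.
    have [g0|g0] := eqVneq (val (c n)) 0.
      by exists 0; apply: val_inj; rewrite raddf0 g0.
    have [k [r [_ sr gE]]] := invariant_monP (hc n) g0.
    by have [a ha aE] := section_of_num sr; exists a; apply: val_inj; rewrite /= aE gE.
  exists (\sum_(n < N) projT1 (cid (hs n))); rewrite linear_sum.
  by apply: eq_bigr => n _; exact: projT2 (cid (hs n)).
exists (fun g => projT1 (cid (surj g))) => [a|g]; last exact: projT2 (cid (surj g)).
by apply: inj; exact: projT2 (cid (surj _)).
Qed.

Lemma section_ring_iso : exists phi : {lrmorphism section_ring D -> invariant_ring act},
  bijective phi /\ forall n, phi @` section_grading D n = invariant_grading act (d_ * n)%N.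
Proof. by exists section_iso; split; [exact: section_iso_bij|exact: section_iso_piece]. Qed.

End SectionRingIso.

(** * The canonical module of the invariant ring *)

Section InvariantPieces.
Variables (K : numClosedFieldType) (t s : 'I_3 -> nat) (V : 'I_3 -> P1 K).
Variable o : klein_forms t V.
Hypothesis s_gt0 : forall i, (0 < s i)%N.
Variables (gT : finGroupType) (act : graded_action K 2 gT).
Hypothesis actP : forall f,
  (forall a, act a f = f) <-> (forall g, stab s o g -> sub g f = f).
Local Notation S := {mpoly K[2]}.
Local Notation mon := (mon s o).
Local Notation e_ := (e_ t s).
Local Notation d_ := (d_ s o).
Local Notation fl := (fl t s).
Local Notation A := (invariant_ring act).
Local Notation gr := (invariant_grading act).
Implicit Types (q r : {poly K}) (n m k : nat) (a b : A).

Let d0 : (0 < d_)%N := d_gt0 o s_gt0.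

Lemma mon_invariant n q : mon n q \in invariant_pred act.
Proof. by apply/invariantP/actP => g; apply: stab_mon. Qed.

Definition monA n q : A := InvariantRing (mon_invariant n q).

Lemma monA_is_linear n : linear (monA n).
Proof. by move=> c q r; apply: val_inj; rewrite /= linearP. Qed.
HB.instance Definition _ n :=
  GRing.isLinear.Build K {poly K} A _ (monA n) (monA_is_linear n).

Lemma monAM n m q r : (size q <= (e_ n).+1)%N -> (size r <= (e_ m).+1)%N ->
  monA n q * monA m r = monA (n + m) (lw V (cr t s n m) * (q * r)).
Proof. by move=> sq sr; apply: val_inj; rewrite /= -(monM o sq sr). Qed.

Lemma monA_gr n q : gr (n * d_)%N (monA n q).
Proof. exact: mon_homog. Qed.

Lemma gr_monA m a : gr m a -> a = 0 \/
  exists k r, [/\ m = (k * d_)%N, (size r <= (e_ k).+1)%N & a = monA k r].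
Proof.
move=> ha; have [a0|a0] := eqVneq (val a) 0.
  by left; apply: val_inj; rewrite [RHS]raddf0.
right; have [k [r [e sr aE]]] := invariant_monP s_gt0 actP ha a0.
by exists k, r; split=> //; apply: val_inj.
Qed.

Lemma monA_ind (P : A -> Prop) : (forall a b, P a -> P b -> P (a + b)) ->
  (forall n q, (size q <= (e_ n).+1)%N -> P (monA n q)) -> forall a, P a.
Proof.
move=> PD Pm a; have P0 : P 0 by rewrite -(linear0 (monA 0)); apply: Pm; rewrite size_poly0.
have [N [c [hc ->]]] := piece_dec gr a; elim/big_ind: _ => // i _.
by have [->|[k [r [_ sr ->]]]] := gr_monA (hc i); last exact: Pm.
Qed.

Lemma monA_inj n q r : (size q <= (e_ n).+1)%N -> (size r <= (e_ n).+1)%N ->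
  monA n q = monA n r -> q = r.
Proof. by move=> sq sr /(congr1 val) /=; apply: mon_inj. Qed.

Lemma monA_eq0 n q : (size q <= (e_ n).+1)%N -> monA n q = 0 -> q = 0.
Proof. by move=> sq h; apply: (monA_inj sq); rewrite ?size_poly0 ?linear0. Qed.

(** The numerator of the component of degree n d. It is defined for every invariant, so that
    functionals can be written as coefficients of it. *)
Definition has_rho n a r := (size r <= (e_ n).+1)%N /\ pihomog mdeg (n * d_)%N (val a) = mon n r.

Lemma rho_ex n a : exists r, has_rho n a r.
Proof.
have [|a0|[k [r [e sr aE]]]] := @gr_monA (n * d_) (InvariantRing (invariant_comp_subproof a (n * d_))).
- exact: pihomogP.
- exists 0; split; first by rewrite size_poly0.
  by rewrite linear0; have := congr1 val a0; rewrite [val 0]raddf0.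
- have kn : k = n by apply/eqP; rewrite -(eqn_pmul2r d0) e.
  by subst k; exists r; split=> //; have := congr1 val aE.
Qed.

Definition rho n a : {poly K} := projT1 (cid (rho_ex n a)).

Lemma rhoP n a : has_rho n a (rho n a). Proof. exact: projT2 (cid (rho_ex n a)). Qed.

Lemma size_rho n a : (size (rho n a) <= (e_ n).+1)%N. Proof. exact: (rhoP n a).1. Qed.

Lemma rhoE n a r : has_rho n a r -> rho n a = r.
Proof.
move=> [sr e]; apply: (mon_inj (o := o) (n := n) (s := s)) => //; first exact: size_rho.
by rewrite -e (rhoP n a).2.
Qed.

Lemma rho_is_linear n : linear (rho n).
Proof.
move=> c a b; apply: rhoE; split.
  apply: leq_trans (size_polyD _ _) _; rewrite geq_max size_rho andbT.
  exact: leq_trans (size_scale_leq _ _) (size_rho n a).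
have -> : val (c *: a + b) = c *: val a + val b by [].
by rewrite [LHS]linearP /= (rhoP n a).2 (rhoP n b).2 [RHS]linearP.
Qed.
HB.instance Definition _ n := GRing.isLinear.Build K A {poly K} _ (rho n) (rho_is_linear n).

Lemma rho_monA n m q : (size q <= (e_ m).+1)%N -> rho n (monA m q) = if n == m then q else 0.
Proof.
move=> sq; apply: rhoE; case: eqVneq => [->|ne]; split; rewrite ?size_poly0 //=.
  by rewrite pihomog_dE // mon_homog.
rewrite linear0; apply: (@pihomog_ne0 _ _ mdeg (m * d_)%N); last exact: mon_homog.
by rewrite eqn_pmul2r // eq_sym.
Qed.

Lemma rho_mul n k q a : (size q <= (e_ n).+1)%N ->
  rho (n + k) (monA n q * a) = lw V (cr t s n k) * (q * rho k a).
Proof.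
move=> sq; elim/monA_ind: a => [a b IHa IHb|m r sr].
  by rewrite mulrDr !linearD /= IHa IHb !mulrDr.
rewrite monAM // !rho_monA //; last exact: (size_monM (s := s) o sq sr).
rewrite eqn_add2l; case: eqVneq => [->//|_]; by rewrite !mulr0.
Qed.

Lemma rho_mul_lt n m q a : (size q <= (e_ n).+1)%N -> (m < n)%N -> rho m (monA n q * a) = 0.
Proof.
move=> sq mn; elim/monA_ind: a => [a b IHa IHb|k r sr].
  by rewrite mulrDr linearD /= IHa IHb addr0.
rewrite monAM // rho_monA; last exact: (size_monM (s := s) o sq sr).
by case: eqP => // e; move: mn; rewrite e; lia.
Qed.

(** The divisor tau D is integral, of degree [NN], so multiplication by a section of a multiple of
    it produces no carry. *)
Definition tau := (\prod_i t i)%N.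
Definition Tt i := fl i tau.
Definition NN := e_ tau.

Lemma tau_gt0 : (0 < tau)%N.
Proof. by rewrite prodn_gt0 // => i; exact: kt_gt0 o i. Qed.

Lemma Tt_t i : (Tt i * t i = tau * s i)%N.
Proof. by rewrite /Tt /fl divnK // /tau (bigD1 i) //= -mulnA dvdn_mulr. Qed.

Lemma Tt_gt0 i : (0 < Tt i)%N.
Proof.
rewrite lt0n; apply/eqP => h; have := Tt_t i; rewrite h mul0n => /esym/eqP.
by rewrite muln_eq0 => /orP[]/eqP e; [have := tau_gt0 | have := s_gt0 i]; rewrite e.
Qed.

Lemma NN_gt0 : (0 < NN)%N.
Proof. by rewrite /NN /e_ (bigD1 ord0) //= addn_gt0 -/(Tt ord0) Tt_gt0. Qed.

Lemma fl_tau i j n : (fl i (j * tau + n) = j * Tt i + fl i n)%N.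
Proof.
rewrite /fl mulnDl -mulnA -Tt_t mulnA divnMDl //; exact: kt_gt0 o i.
Qed.

Lemma e_tau j n : (e_ (j * tau + n) = j * NN + e_ n)%N.
Proof.
rewrite /NN /e_ big_distrr -big_split /=; apply: eq_bigr => i _; exact: fl_tau.
Qed.

Lemma e_tau0 j : e_ (j * tau) = (j * NN)%N.
Proof. by rewrite -[(j * tau)%N]addn0 e_tau e0 addn0. Qed.

Lemma lw_tau j n : lw V (cr t s (j * tau) n) = 1.
Proof.
apply: lw1 => i; have := fl_tau i j n; have := fl_tau i j 0.
have f0 : fl i 0 = 0%N by rewrite /fl mul0n div0n.
by rewrite addn0 /cr f0 => -> ->; lia.
Qed.

Lemma monA_tau j n q r : (size q <= (j * NN).+1)%N -> (size r <= (e_ n).+1)%N ->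
  monA (j * tau) q * monA n r = monA (j * tau + n) (q * r).
Proof. by move=> sq sr; rewrite monAM ?e_tau0 // lw_tau mul1r. Qed.

Lemma rho_tau j n q a : (size q <= (j * NN).+1)%N ->
  rho (j * tau + n) (monA (j * tau) q * a) = q * rho n a.
Proof. by move=> sq; rewrite rho_mul ?e_tau0 // lw_tau mul1r. Qed.

(** The remainders vanish at [tau], so these are the forms X^NN and Y^NN. *)
Definition xs (i : 'I_2) : A := monA tau (if i == ord0 then 'X^NN else 1).

Lemma monA01 : monA 0 1 = 1.
Proof. by apply: val_inj; exact: mon01. Qed.

Lemma xs_exp i j : xs i ^+ j = monA (j * tau) (if i == ord0 then 'X^(j * NN) else 1).
Proof.
elim: j => [|j IH]; first by rewrite expr0 !mul0n expr0 if_same monA01.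
have s1 : (size (if i == ord0 then 'X^NN else 1 : {poly K})%R <= (1 * NN).+1)%N.
  by case: ifP; rewrite ?size_polyXn ?size_poly1 // mul1n.
have s2 : (size (if i == ord0 then 'X^(j * NN) else 1 : {poly K})%R <= (e_ (j * tau)).+1)%N.
  by case: ifP; rewrite ?size_polyXn ?size_poly1 // e_tau0.
rewrite exprS IH /xs; have := monA_tau s1 s2; rewrite mul1n => ->.
by rewrite -mulSn; case: ifP; rewrite -?exprD ?mulr1 // -mulSn.
Qed.

Lemma xs_monom (m : 'X_{1..2}) : \prod_i xs i ^+ m i = monA (mdeg m * tau) 'X^(m ord0 * NN).
Proof.
rewrite big_ord_recl big_ord1 mdegE big_ord_recl big_ord1.
rewrite !xs_exp /= monA_tau ?size_polyXn // ?size_poly1 ?e_tau0 //.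
by rewrite mulr1 mulnDl.
Qed.

Lemma xs_mmap (p : {mpoly K[2]}) : mmap (GRing.in_alg A) xs p =
  \sum_(m <- msupp p) p@_m *: monA (mdeg m * tau) 'X^(m ord0 * NN).
Proof.
rewrite /mmap; apply: eq_bigr => m _.
by rewrite /mmap1 xs_monom /= -scalerAl mul1r.
Qed.

Lemma xs_indep (p : {mpoly K[2]}) : mmap (GRing.in_alg A) xs p = 0 -> p = 0.
Proof.
rewrite xs_mmap => h; apply/eqP; rewrite -msupp_eq0; case E: (msupp p) => [//|m l]; exfalso.
have mp : m \in msupp p by rewrite E inE eqxx.
have tau0 := tau_gt0; have N0 := NN_gt0.
have le (m' : 'X_{1..2}) : (size ('X^(m' ord0 * NN)%N : {poly K})%R <= (e_ (mdeg m' * tau)).+1)%N.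
  by rewrite size_polyXn e_tau0 ltnS leq_mul2r mdegE big_ord_recl leq_addr orbT.
have := congr1 (fun a => (rho (mdeg m * tau) a)`_(m ord0 * NN)) h.
rewrite linear0 coef0 linear_sum coef_sum (bigD1_seq m) ?msupp_uniq //= big_seq_cond big1 => [|m' /andP[_ ne]].
  rewrite addr0 linearZ /= rho_monA // eqxx coefZ coefXn eqxx mulr1 => /eqP.
  by rewrite mcoeff_eq0 mp.
rewrite linearZ /= rho_monA // coefZ eqn_pmul2r //.
case: eqP => [e|_]; last by rewrite coef0 mulr0.
rewrite coefXn eqn_pmul2r //; case: eqP => [e'|_]; last by rewrite mulr0.
case/negP: ne; apply/eqP/mnmP => i.
move: e; rewrite !mdegE !big_ord_recl !big_ord0 !addn0 e' => /addnI e1.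
case: i => [[|[|//]] hi].
  by have -> : Ordinal hi = ord0 by apply/val_inj.
by have -> : Ordinal hi = fintype.lift ord0 ord0 by apply/val_inj.
Qed.

Definition spanned (I : finType) (b : I -> A) a := exists c : I -> {mpoly K[2]},
  a = \sum_i mmap (GRing.in_alg A) xs (c i) * b i.

Lemma spannedD (I : finType) (b : I -> A) a a' : @spanned I b a -> @spanned I b a' -> @spanned I b (a + a').
Proof.
move=> [c ->] [c' ->]; exists (fun i => c i + c' i); rewrite -big_split /=.
by apply: eq_bigr => i _; rewrite mmapD mulrDl.
Qed.

Lemma spanned_mul (I : finType) (b : I -> A) a (p : {mpoly K[2]}) : @spanned I b a -> @spanned I b (mmap (GRing.in_alg A) xs p * a).
Proof.
move=> [c ->]; exists (fun i => p * c i); rewrite mulr_sumr.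
apply: eq_bigr => i _; rewrite mulrA; congr (_ * _).
by rewrite (mmap_is_multiplicative xs (GRing.in_alg A)).1.
Qed.

Lemma spanned_gen (I : finType) (b : I -> A) i : @spanned I b (b i).
Proof.
exists (fun j => (j == i)%:R); rewrite (bigD1 i) //= eqxx big1 ?addr0 => [|j /negbTE ->].
  by rewrite -[1%:R]/(1 : S) -mpolyC1 mmapC /= scale1r mul1r.
by rewrite mmap0 mul0r.
Qed.

Lemma spanned0 (I : finType) (b : I -> A) : @spanned I b 0.
Proof. by exists (fun=> 0); rewrite big1 // => i _; rewrite mmap0 mul0r. Qed.

Lemma e_mono n m : (n <= m)%N -> (e_ n <= e_ m)%N.
Proof. by move=> h; apply: leq_sum => i _; rewrite leq_div2r // leq_mul2r h orbT. Qed.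

(** The generators are the sections z^j of n D with n < 2 tau. For n >= 2 tau the degree left after
    removing tau D is at least NN, so z^j is divisible by the parameter z^NN if j >= NN, and
    otherwise by the parameter 1. *)
Lemma xs_finite : exists (m : nat) (b : 'I_m -> A), forall a,
  exists c : 'I_m -> {mpoly K[2]}, a = \sum_i mmap (GRing.in_alg A) xs (c i) * b i.
Proof.
have tau0 := tau_gt0.
pose I : finType := ('I_(2 * tau) * 'I_(2 * NN).+1)%type.
pose b (i : I) := monA i.1 'X^(i.2).
suff h a : spanned b a.
  exists #|I|, (fun i => b (enum_val i)) => a; have [c ->] := h a.
  exists (fun i => c (enum_val i)); rewrite (reindex (@enum_val I I)) //.
  by apply: onW_bij; apply: enum_val_bij.
have hX i : mmap (GRing.in_alg A) xs 'X_i = xs i by rewrite mmapX mmap1U.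
have hm n : forall j, (j <= e_ n)%N -> spanned b (monA n 'X^j).
  have [M] := ubnP n; elim: M n => // M IH n; rewrite ltnS => nM j jn.
  have [n2|n2] := ltnP n (2 * tau).
    have j2 : (j < (2 * NN).+1)%N.
      by rewrite ltnS -e_tau0 (leq_trans jn) // e_mono // ltnW.
    by have := @spanned_gen I b (Ordinal n2, Ordinal j2).
  pose n' := (n - tau)%N.
  have nE : n = (1 * tau + n')%N by rewrite mul1n subnKC //; lia.
  have eE : e_ n = (NN + e_ n')%N by rewrite nE e_tau mul1n.
  have eN : (NN <= e_ n')%N.
    rewrite -[NN]mul1n -e_tau0 e_mono // mul1n /n'; lia.
  have n'M : (n' < M)%N by rewrite /n'; lia.
  have [jN|jN] := leqP NN j.
    have -> : monA n 'X^j = xs ord0 * monA n' 'X^(j - NN).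
      rewrite /xs -[tau in RHS]mul1n monA_tau ?size_polyXn ?mul1n //; last by lia.
      by rewrite -exprD subnKC // -[tau]mul1n -nE.
    by rewrite -hX; apply: spanned_mul; apply: IH => //; lia.
  have -> : monA n 'X^j = xs ord_max * monA n' 'X^j.
    rewrite /xs -[tau in RHS]mul1n monA_tau ?size_polyXn ?size_poly1 //=; last by lia.
    by rewrite mul1r -nE.
  by rewrite -hX; apply: spanned_mul; apply: IH => //; lia.
elim/monA_ind: a => [a a'|n q sq]; first exact: spannedD.
rewrite (polyE_size sq) linear_sum; elim/big_ind: _ => [||i _]; [exact: spanned0|exact: spannedD|].
rewrite linearZ /= -[_ *: _]mulr_algl -[_%:A]/(GRing.in_alg A q`_i) -(mmapC xs (GRing.in_alg A)).
by apply: spanned_mul; apply: hm; rewrite -ltnS.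
Qed.

Lemma xs_gr i : gr (tau * d_)%N (xs i).
Proof. exact: monA_gr. Qed.

Lemma xs_deg_gt0 (i : 'I_2) : (0 < tau * d_)%N.
Proof. by rewrite muln_gt0 tau_gt0 d0. Qed.

Definition xsop : hsop gr := @Hsop K A gr 2 xs (fun=> (tau * d_)%N)
  xs_deg_gt0 xs_gr xs_indep xs_finite.

End InvariantPieces.

(** * Functionals on local cohomology as residues *)

Section CanonicalModuleOfInvariants.
Variables (K : numClosedFieldType) (t s : 'I_3 -> nat) (V : 'I_3 -> P1 K).
Variable o : klein_forms t V.
Hypothesis s_gt0 : forall i, (0 < s i)%N.
Variables (gT : finGroupType) (act : graded_action K 2 gT).
Hypothesis actP : forall f,
  (forall a, act a f = f) <-> (forall g, stab s o g -> sub g f = f).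
Local Notation e_ := (e_ t s).
Local Notation d_ := (d_ s o).
Local Notation fl := (fl t s).
Local Notation A := (invariant_ring act).
Local Notation gr := (invariant_grading act).
Local Notation monA := (monA actP).
Local Notation rho := (rho s_gt0 actP).
Local Notation tau := (tau t).
Local Notation NN := (NN t s).
Local Notation Tt := (Tt t s).
Local Notation xsop := (xsop s_gt0 actP).
Local Notation Om := (omega xsop).
Implicit Types (q r : {poly K}) (n m k j : nat) (a b : A) (l : Om).

Let tau0 : (0 < tau)%N := tau_gt0 o.
Let N0 : (0 < NN)%N := NN_gt0 o s_gt0.
Let t0 i : (0 < t i)%N := kt_gt0 o i.

Let eT j : e_ (j * tau) = (j * NN)%N := e_tau0 s o j.

Definition ce i m := ((m * s i + (t i).-1) %/ t i)%N.

Lemma ce_fl i j m : (m <= j * tau)%N -> (fl i (j * tau - m) + ce i m = j * Tt i)%N.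
Proof.
move=> mj; have ht := t0 i; have hT := Tt_t t s i.
set f := fl i _; set c := ce i m; set Q := (j * Tt i)%N.
have hQ : (Q * t i = j * tau * s i)%N by rewrite /Q -mulnA hT mulnA.
have f1 := divn_eq ((j * tau - m) * s i) (t i); have f2 := ltn_pmod ((j * tau - m) * s i) ht.
have c1 := divn_eq (m * s i + (t i).-1) (t i); have c2 := ltn_pmod (m * s i + (t i).-1) ht.
rewrite -/(fl i (j * tau - m)) -/f mulnBl -hQ in f1 f2; rewrite -/(ce i m) -/c in c1.
have ms : (m * s i <= Q * t i)%N by rewrite hQ leq_mul2r mj orbT.
have h1 : ((f + c) * t i < Q.+1 * t i)%N by rewrite mulnDl mulSn; lia.
have h2 : (Q * t i < (f + c).+1 * t i)%N by rewrite mulSn mulnDl; lia.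
move: h1 h2; rewrite !ltn_pmul2r //; lia.
Qed.

Lemma ce_gt i j m : (j * tau < m)%N -> (j * Tt i < ce i m)%N.
Proof.
move=> jm; rewrite /ce leq_divRL ?t0 // mulSn -mulnA (Tt_t t s i) mulnA.
have h : (j * tau * s i + s i <= m * s i)%N by rewrite addnC -mulSn leq_mul2r jm orbT.
have := s_gt0 i; have := t0 i; lia.
Qed.

(* The degree of K + ceil(m D), whose sections form the degree [m] part of omega. *)
Definition kap m := (\sum_i ce i m - 2)%N.

Lemma kapE m : (0 < m)%N -> (\sum_i ce i m = kap m + 2)%N /\ (0 < kap m)%N.
Proof.
move=> m0; have h : (3 <= \sum_i ce i m)%N.
  have : (\sum_(i < 3) 1 <= \sum_i ce i m)%N.
    by apply: leq_sum => i _; apply: (@ce_gt i 0).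
  by rewrite sum_nat_const card_ord.
by rewrite /kap; lia.
Qed.

(** The degrees of floor((j tau - m) D) and of K + ceil(m D) add up to that of K + j tau D, because
    floor(j tau D - m D) = j tau D - ceil(m D). *)
Lemma e_kap j m : (0 < m)%N -> (m <= j * tau)%N -> (e_ (j * tau - m) + kap m + 2 = j * NN)%N.
Proof.
move=> m0 mj; rewrite -addnA; have [<- _] := kapE m0.
rewrite /NN /e_ -big_split big_distrr /=.
by apply: eq_bigr => i _; apply: ce_fl.
Qed.

Lemma kap_gt j m : (j * tau < m)%N -> (j * NN < kap m)%N.
Proof.
move=> jm; have [hk _] := kapE (leq_ltn_trans (leq0n _) jm).
suff : (j * NN + 3 <= \sum_i ce i m)%N by lia.
have -> : (j * NN + 3 = \sum_i (j * Tt i + 1))%N.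
  by rewrite big_split /= sum_nat_const card_ord /NN big_distrr.
by apply: leq_sum => i _; rewrite addn1; apply: ce_gt.
Qed.

Lemma total_deg : hs_total_deg xsop = (2 * (tau * d_))%N.
Proof. by rewrite /hs_total_deg big_ord_recl big_ord1 mul2n addnn. Qed.

(* The residue pairing with the numerator [q] of a section of K + ceil(m D). *)
Definition lfun m q n a : K :=
  if (m <= 2 * n * tau)%N then (q * rho (2 * n * tau - m) a)`_(n * NN).-1 else 0.

Lemma xs_prod : \prod_i xs actP i = monA (2 * tau) 'X^NN.
Proof.
rewrite big_ord_recl big_ord1 /xs /=; have := @monA_tau _ _ _ _ o s_gt0 _ _ actP 1 tau 'X^NN 1.
rewrite !mul1n => ->; rewrite ?size_polyXn ?size_poly1 //.
by rewrite mulr1 addnn -mul2n.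
Qed.

(** The coefficient read has index n NN - 1. A multiple of the n-th power of the first parameter is
    divisible by z^(n NN); for the second, [e_kap] bounds the degree by n NN - 2. Multiplication by
    the product of the parameters shifts both polynomial and index by NN. *)
Lemma lfun_omega m q : (0 < m)%N -> (size q <= (kap m).+1)%N -> lfun m q \in omega_pred xsop.
Proof.
move=> m0 sq; apply/asboolP; split.
- move=> n c a b; rewrite /lfun; case: ifP => _; last by rewrite mulr0 addr0.
  by rewrite linearP /= mulrDr -scalerAr coefD coefZ.
- move=> n i a; rewrite /lfun; case: ifP => // le.
  have n0 : (0 < n)%N by case: n le => //; rewrite muln0 mul0n leqNgt m0.
  change (hs_elt xsop i) with (xs actP i); rewrite (xs_exp s_gt0).
  set y := if _ then _ else _.
  have sy : (size y <= (n * NN).+1)%N by rewrite /y; case: ifP; rewrite ?size_polyXn ?size_poly1.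
  (* For m > n tau the component read lies in a degree below that of the n-th power of a
     parameter. *)
  have [mn|mn] := leqP m (n * tau); last first.
    rewrite (rho_mul_lt s_gt0) ?mulr0 ?coef0 ?eT //. lia.
  have -> : (2 * n * tau - m = n * tau + (n * tau - m))%N by lia.
  rewrite (rho_tau s_gt0) // /y; case: ifP => _.
    by rewrite mulrCA coefXnM ltn_predL muln_gt0 n0 N0.
  rewrite mul1r nth_default //; apply: leq_trans (size_polyMleq _ _) _.
  have := size_rho s_gt0 actP (n * tau - m) a; have := e_kap m0 mn; lia.
- move=> n a; change (hs_elt xsop) with (xs actP); rewrite xs_prod /lfun.
  have [le|gt] := leqP m (2 * n * tau).
    have n0 : (0 < n)%N by case: n le => //; rewrite muln0 mul0n leqNgt m0.
    have le' : (m <= 2 * n.+1 * tau)%N by lia.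
    rewrite le'; have -> : (2 * n.+1 * tau - m = 2 * tau + (2 * n * tau - m))%N by lia.
    rewrite (rho_tau s_gt0) ?size_polyXn //; last by lia.
    rewrite mulrCA coefXnM; have nn : (0 < n * NN)%N by rewrite muln_gt0 n0.
    have -> : ((n.+1 * NN).-1 < NN)%N = false by rewrite mulSn; lia.
    by congr (_`__); rewrite mulSn; lia.
  case: ifP => // le'; rewrite (rho_mul_lt s_gt0) ?mulr0 ?coef0 //; last by lia.
  by rewrite size_polyXn eT; lia.
- exists (m * d_)%N => n k a ha; rewrite total_deg => hk.
  rewrite /lfun; case: ifP => // le.
  have [->|[k' [r [kE sr ->]]]] := gr_monA s_gt0 actP ha; first by rewrite linear0 mulr0 coef0.
  rewrite (rho_monA s_gt0) //; case: eqP => [e|_]; last by rewrite mulr0 coef0.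
  exfalso; move: hk; rewrite kE -e ltNge; apply/negP; rewrite negbK.
  have -> : (n * (2 * (tau * d_)) = (2 * n * tau - m) * d_ + m * d_)%N.
    by rewrite -mulnDl subnK //; lia.
  by rewrite PoszD opprD addrA subrr sub0r normrN.
Qed.

Definition lOm m q (m0 : (0 < m)%N) (sq : (size q <= (kap m).+1)%N) : Om := Omega (lfun_omega m0 sq).

Lemma Om_lin l n c a b : l n (c *: a + b) = c * l n a + l n b.
Proof. by have /asboolP[h _ _ _] := omega_valP l; apply: h. Qed.
Lemma Om_van l n i a : l n (xs actP i ^+ n * a) = 0.
Proof. by have /asboolP[_ h _ _] := omega_valP l; apply: h. Qed.
Lemma Om_com l n a : l n.+1 (monA (2 * tau) 'X^NN * a) = l n a.
Proof. by have /asboolP[_ _ h _] := omega_valP l; rewrite -xs_prod; apply: h. Qed.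
Lemma Om_deg l : exists N : nat, forall n m a, gr m a ->
  N%:Z < `|m%:Z - (n * hs_total_deg xsop)%:Z| -> l n a = 0.
Proof. by have /asboolP[_ _ _ h] := omega_valP l. Qed.

Lemma Om0 l n : l n 0 = 0.
Proof. by have := Om_lin l n (-1) 0 0; rewrite scaler0 addr0 mulN1r addNr. Qed.
Lemma OmD l n a b : l n (a + b) = l n a + l n b.
Proof. by rewrite -[a]scale1r Om_lin mul1r scale1r. Qed.
Lemma OmZ l n c a : l n (c *: a) = c * l n a.
Proof. by rewrite -[c *: a]addr0 Om_lin Om0 addr0. Qed.

(** A level so large that m <= 2 n tau and kap m < n NN, so that all coefficients up to index
    [kap m] are visible. *)
Definition nm m := (kap m + m).+1.

(* Recovers [q] from [lfun m q]; every level at least [nm m] gives the same value. *)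
Definition Qf l m : {poly K} :=
  \poly_(c < (kap m).+1) l (nm m) (monA (2 * nm m * tau - m) 'X^((nm m * NN).-1 - c)).

Lemma size_Qf l m : (size (Qf l m) <= (kap m).+1)%N. Proof. exact: size_poly. Qed.

Lemma nm_tau m : (m <= 2 * nm m * tau)%N.
Proof. by rewrite /nm; nia. Qed.
Lemma nm_NN m : (kap m < nm m * NN)%N.
Proof. by rewrite /nm; nia. Qed.

Lemma Om_step l n m c : (0 < m)%N -> (m <= 2 * n * tau)%N -> (c <= kap m)%N -> (c < n * NN)%N ->
  ((n * NN).-1 - c <= e_ (2 * n * tau - m))%N -> forall k,
  l n (monA (2 * n * tau - m) 'X^((n * NN).-1 - c))
  = l (n + k)%N (monA (2 * (n + k) * tau - m) 'X^(((n + k) * NN).-1 - c)).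
Proof.
move=> m0 mn ck cn je; elim=> [|k IH]; first by rewrite addn0.
rewrite IH -Om_com addnS.
have mk : (m <= 2 * (n + k) * tau)%N by nia.
have h1 := e_kap m0 mn; have h2 := e_kap m0 mk.
rewrite (monA_tau s_gt0) ?size_polyXn; [|lia|nia].
rewrite -exprD; congr (l _ (monA _ 'X^_)); first by lia.
have : (c < (n + k) * NN)%N by rewrite mulnDl ltn_addr.
by rewrite mulSn; lia.
Qed.

(** If j >= n NN, the monomial is a multiple of the n-th power of the first parameter. If c = n NN -
    1 - j exceeds [kap m], then [e_kap] leaves room to divide by that of the second. In between, the
    value is the coefficient of index c of [Qf l m], by compatibility of the levels. *)
Lemma Om_monX l n m j : (0 < m)%N -> (m <= 2 * n * tau)%N -> (j <= e_ (2 * n * tau - m))%N ->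
  l n (monA (2 * n * tau - m) 'X^j) = (Qf l m * 'X^j)`_(n * NN).-1.
Proof.
move=> m0 mn je; rewrite coefMXn; have h1 := e_kap m0 mn.
have n0 : (0 < n)%N by case: n mn {je h1} => //; rewrite muln0 mul0n leqNgt m0.
have nn : (0 < n * NN)%N by rewrite muln_gt0 n0.
have mle : (kap m < n * NN)%N -> (m <= n * tau)%N.
  by move=> h; rewrite leqNgt; apply/negP => /kap_gt; lia.
have [jn|nj] := ltnP (n * NN).-1 j.
  have mt : (m <= n * tau)%N by apply: mle; nia.
  have h2 := e_kap m0 mt.
  have -> : (2 * n * tau - m = n * tau + (n * tau - m))%N by lia.
  have := @monA_tau _ _ _ _ o s_gt0 _ _ actP n (n * tau - m) 'X^(n * NN) 'X^(j - n * NN).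
  rewrite -exprD subnKC; last by lia.
  move=> <-; rewrite ?size_polyXn //; last by nia.
  by have := Om_van l n ord0 (monA (n * tau - m) 'X^(j - n * NN)); rewrite (xs_exp s_gt0).
rewrite coef_poly ltnS; case: leqP => [ck|kc].
  have E1 := @Om_step l n m ((n * NN).-1 - j)%N m0 mn ck.
  rewrite subKn // in E1; rewrite (E1 _ je (nm m)); last by lia.
  rewrite [(n + nm m)%N]addnC.
  have hn := e_kap m0 (nm_tau m); have hN := nm_NN m.
  rewrite -(@Om_step l (nm m) m ((n * NN).-1 - j)%N m0 (nm_tau m) ck) //; nia.
have mt : (m <= n * tau)%N by apply: mle; lia.
have h2 := e_kap m0 mt.
have -> : (2 * n * tau - m = n * tau + (n * tau - m))%N by lia.
have := @monA_tau _ _ _ _ o s_gt0 _ _ actP n (n * tau - m) 1 'X^j; rewrite mul1r => <-.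
- by have := Om_van l n ord_max (monA (n * tau - m) 'X^j); rewrite (xs_exp s_gt0).
- by rewrite size_poly1.
- rewrite size_polyXn; lia.
Qed.

(** From degree 2 n tau on, every monomial is a multiple of the n-th power of one of the parameters.
    This is the vanishing of the canonical module in degrees at most 0. *)
Lemma Om_monX_hi l n k j : (2 * n * tau <= k)%N -> (j <= e_ k)%N -> l n (monA k 'X^j) = 0.
Proof.
move=> nk jk.
have kE : k = (2 * n * tau + (k - 2 * n * tau))%N by lia.
have kE1 : k = (n * tau + (k - n * tau))%N by lia.
have eE := e_tau s o (2 * n) (k - 2 * n * tau); have eE1 := e_tau s o n (k - n * tau).
rewrite -kE in eE; rewrite -kE1 in eE1.
have [jn|nj] := leqP (n * NN) j.
  have := @monA_tau _ _ _ _ o s_gt0 _ _ actP n (k - n * tau) 'X^(n * NN) 'X^(j - n * NN).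
  rewrite -exprD -kE1 (subnKC jn) => <-; rewrite ?size_polyXn //; last by lia.
  by have := Om_van l n ord0 (monA (k - n * tau) 'X^(j - n * NN)); rewrite (xs_exp s_gt0).
have := @monA_tau _ _ _ _ o s_gt0 _ _ actP n (k - n * tau) 1 'X^j; rewrite mul1r -kE1 => <-.
- by have := Om_van l n ord_max (monA (k - n * tau) 'X^j); rewrite (xs_exp s_gt0).
- by rewrite size_poly1.
- rewrite size_polyXn; lia.
Qed.

Lemma Om_eval l n k r : (size r <= (e_ k).+1)%N -> l n (monA k r) =
  if (k < 2 * n * tau)%N then (Qf l (2 * n * tau - k) * r)`_(n * NN).-1 else 0.
Proof.
move=> sr; rewrite (polyE_size sr) linear_sum mulr_sumr coef_sum.
have -> : l n (\sum_(i < (e_ k).+1) monA k (r`_i *: 'X^i))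
    = \sum_(i < (e_ k).+1) r`_i * l n (monA k 'X^i).
  elim/big_rec2: _ => [|i y1 y2 _ <-]; first exact: Om0.
  by rewrite OmD linearZ OmZ.
case: ltnP => hk; last first.
  by rewrite big1 // => i _; rewrite Om_monX_hi ?mulr0 // -ltnS.
apply: eq_bigr => i _; rewrite -scalerAr coefZ; congr (_ * _).
have h := @Om_monX l n (2 * n * tau - k) i; rewrite (subKn (ltnW hk)) in h.
by apply: h; [lia|lia|rewrite -ltnS].
Qed.

End CanonicalModuleOfInvariants.

(** * Embedding the canonical module in the ring *)

Section AnticanonicalModule.
Variables (K : numClosedFieldType) (t s : 'I_3 -> nat) (V : 'I_3 -> P1 K).
Variable o : klein_forms t V.
Hypothesis s_gt0 : forall i, (0 < s i)%N.
Variables (gT : finGroupType) (act : graded_action K 2 gT).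
Hypothesis actP : forall f,
  (forall a, act a f = f) <-> (forall g, stab s o g -> sub g f = f).
Local Notation e_ := (e_ t s).
Local Notation d_ := (d_ s o).
Local Notation fl := (fl t s).
Local Notation lw := (lw V).
Local Notation cr := (cr t s).
Local Notation A := (invariant_ring act).
Local Notation monA := (monA actP).
Local Notation rho := (rho s_gt0 actP).
Local Notation tau := (tau t).
Local Notation NN := (NN t s).
Local Notation xsop := (xsop s_gt0 actP).
Local Notation Om := (omega xsop).
Local Notation ce := (ce t s).
Local Notation kap := (kap t s).
Local Notation nm := (nm t s).
Implicit Types (p q r : {poly K}) (n m k j : nat) (a b : A) (l : Om).

Let d0 : (0 < d_)%N := d_gt0 o s_gt0.
Let tau0 : (0 < tau)%N := tau_gt0 o.
Let N0 : (0 < NN)%N := NN_gt0 o s_gt0.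
Let t0 i : (0 < t i)%N := kt_gt0 o i.

Lemma Qf_coef l m c : (c <= kap m)%N ->
  (Qf l m)`_c = l (nm m) (monA (2 * nm m * tau - m) 'X^((nm m * NN).-1 - c)).
Proof. by move=> ck; rewrite coef_poly ltnS ck. Qed.

Lemma Qf_eqP l m q : (size q <= (kap m).+1)%N ->
  (forall c, (c <= kap m)%N ->
     l (nm m) (monA (2 * nm m * tau - m) 'X^((nm m * NN).-1 - c)) = q`_c) -> Qf l m = q.
Proof.
move=> sq h; apply/polyP => c; have [ck|kc] := leqP c (kap m); first by rewrite Qf_coef // h.
by rewrite !nth_default // (leq_trans _ kc) // size_Qf.
Qed.

Lemma QfD l l' m : Qf (l + l') m = Qf l m + Qf l' m.
Proof.
apply: Qf_eqP => [|c ck].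
  by apply: leq_trans (size_polyD _ _) _; rewrite geq_max !size_Qf.
by rewrite coefD !Qf_coef.
Qed.

Lemma ce_add i k m : (fl i k + ce i m <= ce i (k + m))%N.
Proof.
have h : (k + m <= (k + m) * tau)%N by nia.
have h1 : (m <= (k + m) * tau)%N by lia.
have := ce_fl o s_gt0 i h; have := ce_fl o s_gt0 i h1.
have := fl_add s o i k ((k + m) * tau - (k + m)).
have -> : (k + ((k + m) * tau - (k + m)) = (k + m) * tau - m)%N by lia.
lia.
Qed.

(** The carry for the module structure, when a section of k D multiplies one of K + ceil(m D). *)
Definition act_exp k m i := (ce i (k + m) - fl i k - ce i m)%N.

Lemma cr_act_exp j k m i : (k + m <= j * tau)%N ->
  cr k (j * tau - (k + m)) i = act_exp k m i.
Proof.
move=> h; have h1 : (m <= j * tau)%N by lia.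
have := ce_fl o s_gt0 i h; have := ce_fl o s_gt0 i h1.
rewrite /cr /act_exp.
have -> : (k + (j * tau - (k + m)) = j * tau - m)%N by lia.
lia.
Qed.

Lemma sum_act_exp k m : (0 < m)%N ->
  (\sum_i act_exp k m i + e_ k + kap m = kap (k + m))%N.
Proof.
move=> m0; have km0 : (0 < k + m)%N by lia.
have [h1 _] := kapE o s_gt0 m0; have [h2 _] := kapE o s_gt0 km0.
suff : (\sum_i act_exp k m i + e_ k + \sum_i ce i m = \sum_i ce i (k + m))%N by lia.
rewrite /e_ -!big_split /=; apply: eq_bigr => i _.
by have := ce_add i k m; rewrite /act_exp; lia.
Qed.

Lemma size_lw c : (size (lw c) <= (\sum_i c i).+1)%N. Proof. exact: (lw_hm o c).1. Qed.

Lemma size_act k r m p : (0 < m)%N -> (size r <= (e_ k).+1)%N -> (size p <= (kap m).+1)%N ->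
  (size (lw (act_exp k m) * (r * p))%R <= (kap (k + m)).+1)%N.
Proof.
move=> m0 sr sp; apply: leq_trans (size_polyMleq _ _) _.
have := size_polyMleq r p; have := size_lw (act_exp k m); have := sum_act_exp k m0; lia.
Qed.

Lemma Qf_exp_le m c : (0 < m)%N -> ((nm m * NN).-1 - c <= e_ (2 * nm m * tau - m))%N.
Proof.
move=> m0; have := e_kap o s_gt0 m0 (nm_tau o s_gt0 m); have := nm_NN o s_gt0 m; lia.
Qed.

Lemma Qf_act k r l m : (0 < m)%N -> (size r <= (e_ k).+1)%N ->
  Qf (monA k r *: l) (k + m) = lw (act_exp k m) * (r * Qf l m).
Proof.
move=> m0 sr; have km0 : (0 < k + m)%N by lia.
apply: Qf_eqP => [|c ck]; first by apply: size_act => //; exact: size_Qf.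
have nt := nm_tau o s_gt0 (k + m); have nN := nm_NN o s_gt0 (k + m).
set n := nm (k + m) in nt nN *; set j := ((n * NN).-1 - c)%N.
have sX : (size ('X^j : {poly K})%R <= (e_ (2 * n * tau - (k + m))).+1)%N.
  by rewrite size_polyXn ltnS; exact: Qf_exp_le.
transitivity (l n (monA k r * monA (2 * n * tau - (k + m)) 'X^j)); first by [].
rewrite monAM //; have sz := size_monM (s := s) o sr sX.
have E : (k + (2 * n * tau - (k + m)) = 2 * n * tau - m)%N by lia.
rewrite E in sz *; rewrite Om_eval //.
have -> : (2 * n * tau - m < 2 * n * tau)%N by lia.
have -> : (2 * n * tau - (2 * n * tau - m) = m)%N by lia.
rewrite (eq_lw V (fun i => cr_act_exp i nt)).
set L := lw _; set Q := Qf l m.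
have -> : Q * (L * (r * 'X^j)) = (L * (r * Q)) * 'X^j.
  by rewrite mulrCA [Q * _]mulrA [Q * r]mulrC !mulrA.
rewrite coefMXn /j; have -> : ((n * NN).-1 < (n * NN).-1 - c)%N = false by lia.
by rewrite subKn //; lia.
Qed.

Lemma Qf_act_lo k r l m : (0 < m)%N -> (m <= k)%N -> (size r <= (e_ k).+1)%N ->
  Qf (monA k r *: l) m = 0.
Proof.
move=> m0 mk sr; apply: Qf_eqP => [|c ck]; first by rewrite size_poly0.
have nt := nm_tau o s_gt0 m; rewrite coef0.
set n := nm m in nt *; set j := ((n * NN).-1 - c)%N.
have sX : (size ('X^j : {poly K})%R <= (e_ (2 * n * tau - m)).+1)%N.
  by rewrite size_polyXn ltnS; exact: Qf_exp_le.
transitivity (l n (monA k r * monA (2 * n * tau - m) 'X^j)); first by [].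
rewrite monAM //; have sz := size_monM (s := s) o sr sX.
rewrite Om_eval //; by have -> : (k + (2 * n * tau - m) < 2 * n * tau)%N = false by lia.
Qed.

Lemma Qf_lOm m q (m0 : (0 < m)%N) (sq : (size q <= (kap m).+1)%N) m' : (0 < m')%N ->
  Qf (lOm s_gt0 actP m0 sq) m' = if m' == m then q else 0.
Proof.
move=> m'0; apply: Qf_eqP => [|c ck].
  by case: eqP => [->|_]; rewrite ?size_poly0.
have nt := nm_tau o s_gt0 m'; have nN := nm_NN o s_gt0 m'; have je := Qf_exp_le c m'0.
set n := nm m' in nt nN je *; set j := ((n * NN).-1 - c)%N in je *.
transitivity (lfun s_gt0 actP m q n (monA (2 * n * tau - m') 'X^j)); first by [].
rewrite /lfun (rho_monA s_gt0) ?size_polyXn //.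
case: (eqVneq m' m) => [mE|ne].
  rewrite -mE nt eqxx coefMXn /j.
  have -> : ((n * NN).-1 < (n * NN).-1 - c)%N = false by lia.
  by rewrite subKn //; lia.
case: ifP => h; last by rewrite coef0.
have -> : (2 * n * tau - m == 2 * n * tau - m')%N = false by apply/eqP; lia.
by rewrite mulr0 !coef0.
Qed.

Lemma Qf_bound l : exists B : nat, forall m, (B <= m)%N -> (0 < m)%N -> Qf l m = 0.
Proof.
have [B hB] := Om_deg l; exists B.+1 => m Bm m0.
apply: Qf_eqP => [|c ck]; first by rewrite size_poly0.
have nt := nm_tau o s_gt0 m; rewrite coef0; set n := nm m in nt *.
apply: (hB n ((2 * n * tau - m) * d_)%N); first exact: monA_gr.
rewrite total_deg; have -> : (n * (2 * (tau * d_)) = (2 * n * tau - m) * d_ + m * d_)%N.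
  by rewrite -mulnDl subnK //; lia.
rewrite PoszD opprD addrA subrr sub0r normrN ltz_nat; nia.
Qed.

Definition bound l : nat := projT1 (cid (Qf_bound l)).
Lemma boundP l m : (bound l <= m)%N -> (0 < m)%N -> Qf l m = 0.
Proof. by have h := projT2 (cid (Qf_bound l)); apply: h. Qed.

Lemma ce_le i m : (ce i m <= (fl i m).+1)%N.
Proof.
rewrite /ce /fl -ltnS ltn_divLR ?t0 //.
have := divn_eq (m * s i) (t i); have := ltn_pmod (m * s i) (t0 i); have := t0 i.
by rewrite !mulSn; lia.
Qed.

(* The divisor of the points at which [m D] is integral: floor(m D) + V minus
   ceil(m D), where V is the sum of the three points. *)
Definition lam m i := ((fl i m).+1 - ce i m)%N.

Lemma sum_lam m : (0 < m)%N -> (\sum_i lam m i + kap m = e_ m + 1)%N.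
Proof.
move=> m0; have [h _] := kapE o s_gt0 m0.
suff : (\sum_i lam m i + \sum_i ce i m = e_ m + 3)%N by lia.
have -> : (e_ m + 3 = \sum_i (fl i m + 1))%N by rewrite big_split /= sum_nat_const card_ord.
rewrite -big_split /=; apply: eq_bigr => i _.
by have := ce_le i m; rewrite /lam; lia.
Qed.

Lemma eT1 m : e_ (tau + m) = (NN + e_ m)%N.
Proof. by have := e_tau s o 1 m; rewrite !mul1n. Qed.

(** The factor [lw (lam m)] turns sections of K + ceil(m D) into sections of K + floor(m D) + V, of
    degree [e_ m + 1]; the power of z raises this to [NN + e_ m], the degree for (tau + m) D. *)
Definition thpoly m p : {poly K} := 'X^(NN.-1) * (p * lw (lam m)).
Definition th m p : A := monA (tau + m) (thpoly m p).

Lemma size_thpoly m p : (0 < m)%N -> (size p <= (kap m).+1)%N ->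
  (size (thpoly m p) <= (e_ (tau + m)).+1)%N.
Proof.
move=> m0 sp; rewrite eT1 /thpoly; apply: leq_trans (size_polyMleq _ _) _.
rewrite size_polyXn; have := size_polyMleq p (lw (lam m)); have := size_lw (lam m).
have := sum_lam m0; have := N0; lia.
Qed.

Lemma th_is_linear m : linear (th m).
Proof.
move=> c p q; rewrite /th -linearP /thpoly; congr monA.
by rewrite mulrDl mulrDr -scalerAl -scalerAr.
Qed.
HB.instance Definition _ m := GRing.isLinear.Build K {poly K} A _ (th m) (th_is_linear m).

Lemma th_eq0 m p : (0 < m)%N -> (size p <= (kap m).+1)%N -> th m p = 0 -> p = 0.
Proof.
move=> m0 sp /(monA_eq0 (size_thpoly m0 sp))/eqP; rewrite /thpoly !mulf_eq0.
by rewrite (negbTE (lw_neq0 _ _)) expf_eq0 polyX_eq0 andbF orbF => /eqP.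
Qed.

Lemma th_mul k r m p : (0 < m)%N -> (size r <= (e_ k).+1)%N -> (size p <= (kap m).+1)%N ->
  monA k r * th m p = th (k + m) (lw (act_exp k m) * (r * p)).
Proof.
move=> m0 sr sp; rewrite /th monAM ?size_thpoly //.
have -> : (k + (tau + m) = tau + (k + m))%N by lia.
congr monA; rewrite /thpoly.
(* At each point both exponents equal fl(k + m) + 1 - fl(k) - ce(m). *)
have E : lw (cr k (tau + m)) * lw (lam m) = lw (act_exp k m) * lw (lam (k + m)).
  rewrite -!lwD; apply: eq_lw => i; rewrite /cr /lam /act_exp.
  have := ce_le i m; have := ce_le i (k + m); have := ce_add i k m.
  have := fl_add s o i k m; have := fl_tau s o i 1 m; have := fl_tau s o i 1 (k + m).
  rewrite !mul1n; have -> : (k + (tau + m) = tau + (k + m))%N by lia.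
  lia.
move: E; set L1 := lw _; set L2 := lw _; set L3 := lw _; set L4 := lw _ => E.
transitivity ('X^(NN.-1) * (r * p) * (L1 * L2)); first by ring.
by rewrite E; ring.
Qed.

(* Multiplication by a fixed section identifies omega with an ideal, with a shift of
   the grading by [tau]. *)
Definition Theta l : A := \sum_(m < bound l) th m.+1 (Qf l m.+1).

Lemma Theta_wide l B : (bound l <= B)%N -> Theta l = \sum_(m < B) th m.+1 (Qf l m.+1).
Proof.
move=> lB; rewrite /Theta (big_ord_widen B (fun m => th m.+1 (Qf l m.+1))) // big_mkcond /=.
apply: eq_bigr => m _; case: ifP => // /negbT; rewrite -leqNgt => le.
by rewrite boundP ?linear0 // leqW.
Qed.

Lemma ThetaD l l' : Theta (l + l') = Theta l + Theta l'.
Proof.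
pose B := maxn (bound (l + l')) (maxn (bound l) (bound l')).
rewrite !(@Theta_wide _ B) /B ?leq_max ?leqnn ?orbT // -big_split.
by apply: eq_bigr => m _; rewrite QfD linearD.
Qed.

Lemma Theta_scale b l : Theta (b *: l) = b * Theta l.
Proof.
apply: (monA_ind s_gt0 (actP := actP) (P := fun b => Theta (b *: l) = b * Theta l))
  => [a b' IHa IHb|k r sr].
  by rewrite scalerDl ThetaD IHa IHb mulrDl.
pose B := maxn (bound (monA k r *: l)) (bound l).
rewrite (@Theta_wide _ (k + B)); last by rewrite (leq_trans _ (leq_addl _ _)) // leq_maxl.
rewrite (@Theta_wide l B) ?leq_maxr // big_split_ord /= big1 => [|m _].
  rewrite add0r mulr_sumr; apply: eq_bigr => m _.
  by rewrite th_mul ?size_Qf // addnS -Qf_act // addnS.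
by rewrite Qf_act_lo ?linear0.
Qed.

Lemma Theta_is_linear : linear_for (GRing.scale : A -> A^o -> A^o) (Theta : Om -> A^o).
Proof. by move=> b l l'; rewrite ThetaD Theta_scale. Qed.

(** The summands lie in distinct degrees, so each [Qf l m] vanishes, and by [Om_eval] these
    polynomials determine [l]. *)
Lemma Theta_inj l : Theta l = 0 -> l = 0.
Proof.
move=> h; have Q0 m : (0 < m)%N -> Qf l m = 0.
  case: m => // m _; have [le|lt] := leqP (bound l) m; first by rewrite boundP // leqW.
  have := congr1 (rho (tau + m.+1)) h; rewrite linear0 /Theta linear_sum (bigD1 (Ordinal lt)) //=.
  rewrite big1 => [|i ne].
    rewrite addr0 (rho_monA s_gt0) ?size_thpoly ?size_Qf // eqxx => h0.
    by apply: (@th_eq0 m.+1) => //; rewrite ?size_Qf // /th h0 linear0.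
  rewrite (rho_monA s_gt0) ?size_thpoly ?size_Qf // eqn_add2l eqSS.
  by have -> : (m == i :> nat) = false by apply: contraNF ne => /eqP e; apply/eqP/val_inj.
apply: val_inj; apply/funext => n; apply/funext => a.
change (l n a = 0); apply: (monA_ind s_gt0 (actP := actP) (P := fun a => l n a = 0)) => [a' b IHa IHb|k r sr].
  by rewrite OmD IHa IHb addr0.
by rewrite Om_eval //; case: ifP => // lt; rewrite Q0 ?mul0r ?coef0 // subn_gt0.
Qed.

Lemma Theta_lOm m q (m0 : (0 < m)%N) (sq : (size q <= (kap m).+1)%N) :
  Theta (lOm s_gt0 actP m0 sq) = th m q.
Proof.
set l := lOm _ _ _ _; pose B := maxn (bound l) m.
case: m m0 sq @l @B => // m m0 sq l B.
have mB : (m < B)%N by rewrite leq_max leqnn orbT.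
rewrite (@Theta_wide l B) ?leq_maxl // (bigD1 (Ordinal mB)) //= big1 => [|i ne].
  by rewrite Qf_lOm // eqxx addr0.
rewrite Qf_lOm // eqSS; have -> : (i == m :> nat) = false by apply: contraNF ne => /eqP e; apply/eqP/val_inj.
by rewrite linear0.
Qed.

End AnticanonicalModule.

(** * Positivity of b *)

Section PositiveB.
Variables (K : numClosedFieldType) (t s : 'I_3 -> nat) (V : 'I_3 -> P1 K).
Variable o : klein_forms t V.
Hypothesis s_gt0 : forall i, (0 < s i)%N.
Hypothesis nts : forall i, ~~ (t i %| s i)%N.
Variables (gT : finGroupType) (act : graded_action K 2 gT).
Hypothesis actP : forall f,
  (forall a, act a f = f) <-> (forall g, stab s o g -> sub g f = f).
Local Notation e_ := (e_ t s).
Local Notation d_ := (d_ s o).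
Local Notation fl := (fl t s).
Local Notation A := (invariant_ring act).
Local Notation gr := (invariant_grading act).
Local Notation monA := (monA actP).
Local Notation tau := (tau t).
Local Notation NN := (NN t s).
Local Notation xsop := (xsop s_gt0 actP).
Local Notation Om := (omega xsop).
Local Notation Theta := (@Theta K t s V o s_gt0 gT act actP).
Local Notation ce := (ce t s).
Local Notation kap := (kap t s).
Local Notation nm := (nm t s).
Local Notation lOm := (lOm s_gt0 actP).
Implicit Types (p q r : {poly K}) (n m k : nat) (a b : A) (l : Om) (i j : int).

Let d0 : (0 < d_)%N := d_gt0 o s_gt0.

HB.instance Definition _ := GRing.isLinear.Build A Om A^o _
  (Theta : Om -> A^o) (@Theta_is_linear K t s V o s_gt0 gT act actP).

Lemma zpiece_zero i : zpiece gr i 0.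
Proof. by case: i => n //=; exact: invariant_piece0. Qed.

Lemma zpiece_add i a b : zpiece gr i a -> zpiece gr i b -> zpiece gr i (a + b).
Proof.
case: i => n /=; last by move=> -> ->; rewrite addr0.
by move=> ha hb; have := invariant_piece_lin 1 ha hb; rewrite scale1r.
Qed.

Lemma Qf_piece j l m : omega_piece j l -> (0 < m)%N -> (m * d_)%:Z != j -> Qf l m = 0.
Proof.
move=> hl m0 ne; apply: Qf_eqP => [|c ck]; first by rewrite size_poly0.
have nt := nm_tau o s_gt0 m; rewrite coef0; set n := nm m in nt *.
apply: (hl n ((2 * n * tau - m) * d_)%N); first exact: monA_gr.
rewrite total_deg; have -> : (n * (2 * (tau * d_)) = (2 * n * tau - m) * d_ + m * d_)%N.
  by rewrite -mulnDl subnK //; lia.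
by rewrite PoszD opprD addrA subrr sub0r eqr_opp.
Qed.

Lemma Theta_piece : omega_inv_piece (x := xsop) (tau * d_)%N%:Z Theta.
Proof.
move=> j l hl; rewrite /Theta; apply: (big_ind (zpiece gr _)) => [||m _];
  [exact: zpiece_zero|exact: zpiece_add|].
have [e|ne] := eqVneq (m.+1 * d_)%N%:Z j; last by rewrite (Qf_piece hl) ?linear0 //; exact: zpiece_zero.
by rewrite -e -PoszD -mulnDl; exact: monA_gr.
Qed.

Lemma lOm_piece m q (m0 : (0 < m)%N) (sq : (size q <= (kap m).+1)%N) :
  omega_piece (m * d_)%N%:Z (lOm m0 sq).
Proof.
move=> n k a ha hk; change (lfun s_gt0 actP m q n a = 0); rewrite /lfun; case: ifP => // le.
have [->|[k' [r [kE sr ->]]]] := gr_monA s_gt0 actP ha; first by rewrite linear0 mulr0 coef0.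
rewrite (rho_monA s_gt0) //; case: eqP => [e|_]; last by rewrite mulr0 coef0.
exfalso; move: hk; rewrite kE -e total_deg.
have -> : (n * (2 * (tau * d_)) = (2 * n * tau - m) * d_ + m * d_)%N.
  by rewrite -mulnDl subnK //; lia.
by rewrite PoszD opprD addrA subrr sub0r eqxx.
Qed.

(** This is where it matters that no coefficient of D is an integer; it gives K + ceil(D) a degree
    one more than floor(D). *)
Lemma ce1 x : ce x 1 = (fl x 1).+1.
Proof.
have t1 := kt_gt0 o x; rewrite /ce /fl mul1n.
have r0 : (0 < s x %% t x)%N by rewrite lt0n; exact: nts.
have h := divn_eq (s x) (t x); have h2 := ltn_pmod (s x) t1.
have -> : (s x + (t x).-1 = (s x %/ t x).+1 * t x + (s x %% t x).-1)%N by rewrite mulSn; lia.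
by rewrite divnMDl // [(_.-1 %/ _)%N]divn_small ?addn0 // (leq_ltn_trans (leq_pred _)).
Qed.

Lemma kap1 : kap 1 = (e_ 1).+1.
Proof.
have [h _] := kapE o s_gt0 (ltn0Sn 0); suff : (\sum_x ce x 1 = e_ 1 + 3)%N by lia.
rewrite (eq_bigr (fun x => fl x 1 + 1)%N) => [|x _]; last by rewrite ce1 addn1.
by rewrite big_split /= sum_nat_const card_ord.
Qed.

Lemma thpoly1 p : thpoly t s V 1 p = 'X^(NN.-1) * p.
Proof. by rewrite /thpoly lw1 ?mulr1 // => x; rewrite /lam ce1 subnn. Qed.

Lemma sq1 : (size (1 : {poly K})%R <= (kap 1).+1)%N. Proof. by rewrite size_poly1. Qed.
Lemma sqX : (size ('X^(kap 1) : {poly K})%R <= (kap 1).+1)%N. Proof. by rewrite size_polyXn. Qed.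

Local Notation l0 := (lOm (ltn0Sn 0) sq1).
Local Notation l1 := (lOm (ltn0Sn 0) sqX).

(** Rank one: the injective map [Theta] sends both sides to the product of [Theta l] and
    [Theta l']. *)
Lemma Theta_comm l l' : Theta l *: l' = Theta l' *: l.
Proof.
apply/eqP; rewrite -subr_eq0; apply/eqP/Theta_inj.
by rewrite -scaleNr ThetaD !Theta_scale mulNr [X in _ - X]mulrC subrr.
Qed.

Lemma phi_comm (phi : {linear Om -> A^o}) l l' : Theta l * phi l' = Theta l' * phi l.
Proof.
have h (a : A) (x : Om) : a * phi x = phi (a *: x) by rewrite linearZ.
by rewrite !h Theta_comm.
Qed.

Lemma Theta_l0_neq0 : Theta l0 != 0.
Proof. by rewrite Theta_lOm; apply/eqP => /(th_eq0 s_gt0 (ltn0Sn 0) sq1)/eqP; rewrite oner_eq0. Qed.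

Lemma invariant_mul_eq0 a b : a * b = 0 -> a != 0 -> b = 0.
Proof.
move=> ab0 n0; have /eqP : val a * val b = 0 by have := congr1 val ab0; rewrite [RHS]raddf0.
rewrite mulf_eq0 => /orP[] /eqP h.
  by case/eqP: n0; apply: val_inj; rewrite [RHS]raddf0.
by apply: val_inj; rewrite [RHS]raddf0.
Qed.

Lemma phi_l0_eq0 i (phi : {linear Om -> A^o}) : omega_inv_piece i phi -> i <= 0 -> phi l0 = 0.
Proof.
move=> hphi i0; have := hphi _ _ (lOm_piece (ltn0Sn 0) sq1); have := hphi _ _ (lOm_piece (ltn0Sn 0) sqX).
have := phi_comm phi l0 l1; move: (phi l0) (phi l1) => a0 a1; rewrite mul1n !Theta_lOm => e.
(* In a negative degree the piece is zero by definition, so only 0 <= i + d <= d remains. *)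
case E: (i + d_%:Z) => [p|p] /= h1 h0 //.
have hp : (p <= d_)%N by rewrite -lez_nat -E gerDr.
have [//|[k [r0 [kE sr0 a0E]]]] := gr_monA s_gt0 actP h0.
have k1 : (k <= 1)%N by rewrite -(leq_pmul2r d0) mul1n -kE.
have [r1 sr1 a1E] : exists2 r1 : {poly K}, (size r1 <= (e_ k).+1)%N & a1 = monA k r1.
  have [->|[k' [r1 [kE' sr1 ->]]]] := gr_monA s_gt0 actP h1.
    by exists 0; rewrite ?size_poly0 ?linear0.
  have -> : k = k' by apply/eqP; rewrite -(eqn_pmul2r d0) -kE kE'.
  by exists r1.
move: e; rewrite a0E a1E /th !monAM ?size_thpoly //; try exact: sq1; try exact: sqX.
move/(monA_inj (size_monM o (size_thpoly o s_gt0 (ltn0Sn 0) sq1) sr1)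
                (size_monM o (size_thpoly o s_gt0 (ltn0Sn 0) sqX) sr0)).
move/(mulfI (lw_neq0 _ _)); rewrite !thpoly1 -!mulrA => /(mulfI (monic_neq0 (monicXn _ _))).
(* After cancelling carries and the common power of z, r1 is z^(e_1 + 1) times r0, too large for a
   polynomial of degree at most e_k with k <= 1 unless r0 = 0. *)
rewrite mul1r => r1E; have [->|rn0] := eqVneq r0 0; first by rewrite linear0.
have := sr1; rewrite r1E size_monicM ?monicXn // size_polyXn kap1.
have := e_mono t s k1; move: rn0; rewrite -size_poly_gt0; lia.
Qed.

Lemma inv_piece_gt0 i : omega_inv_piece_neq0 xsop i -> 0 < i.
Proof.
move=> [phi hphi [l /eqP nz]]; rewrite ltNge; apply/negP => i0; apply: nz.
apply: (invariant_mul_eq0 _ Theta_l0_neq0).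
by rewrite (phi_comm phi) (phi_l0_eq0 hphi i0) mulr0.
Qed.

(** [Theta] is a nonzero homogeneous element of degree tau d, and all such degrees are positive, so
    a least one exists among the natural numbers. *)
Lemma invariants_b_gt0 : exists b : int, is_b gr b /\ 0 < b.
Proof.
have h0 : exists n : nat, `[< omega_inv_piece_neq0 xsop n%:Z >].
  exists (tau * d_)%N; apply/asboolP; exists (Theta : {linear Om -> A^o}); first exact: Theta_piece.
  by exists l0; exact: Theta_l0_neq0.
have := ex_minnP h0; case=> b /asboolP hb min; exists b%:Z; split; last exact: inv_piece_gt0.
exists xsop; split=> // i hi; have i0 := inv_piece_gt0 hi.
case: i i0 hi => // n _ hn; rewrite lez_nat; apply: min; exact/asboolP.
Qed.

End PositiveB.

Lemma coprime_ndvd t s : (1 < t)%N -> coprime s t -> ~~ (t %| s)%N.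
Proof. by move=> t1 co; apply: contraL co => /gcdn_idPr ts; rewrite /coprime ts gtn_eqF. Qed.

Theorem theorem2p11 (R : realType) (V1 V2 V3 : P1 R[i])
  (t1 t2 t3 s1 s2 s3 : nat)
  (V12 : V1 != V2) (V13 : V1 != V3) (V23 : V2 != V3)
  (ht : (exists m : nat, (2 <= m)%N /\ (t1, t2, t3) = (2, 2, m)%N) \/
        (exists m : nat, (3 <= m <= 5)%N /\ (t1, t2, t3) = (2, 3, m)%N))
  (hs1 : (0 < s1)%N) (hs2 : (0 < s2)%N) (hs3 : (0 < s3)%N)
  (hst1 : coprime s1 t1) (hst2 : coprime s2 t2) (hst3 : coprime s3 t3) :
  let D : Qdivisor R[i] :=
    << (s1%:R / t1%:R : rat) *g V1 >> + << (s2%:R / t2%:R : rat) *g V2 >>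
      + << (s3%:R / t3%:R : rat) *g V3 >> in
  exists (d : nat) (gT : finGroupType) (act : graded_action R[i] d gT),
    (exists (r : nat) (phi : {lrmorphism section_ring D -> invariant_ring act}),
       [/\ (0 < r)%N, bijective phi &
           forall n : nat,
             phi @` section_grading D n = invariant_grading act (r * n)%N]) /\
    (exists b : int, is_b (invariant_grading act) b /\ 0 < b).
Proof.
move=> D; pose t := tri t1 t2 t3; pose s := tri s1 s2 s3; pose V := tri V1 V2 V3.
have [t1g t2g t3g] : [/\ 1 < t1, 1 < t2 & 1 < t3]%N.
  by case: ht => [[m [hm [-> -> ->]]]|[m [/andP[hm _] [-> -> ->]]]]; split=> //; exact: leq_trans hm.
have tP : polyhedral R[i] t.
  case: ht => [[m [hm [e1 e2 e3]]]|[m [/andP[hm hm5] [e1 e2 e3]]]]; rewrite /t e1 e2 e3.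
    exact: polyhedral_dihedral.
  case: m hm hm5 {e3} => [|[|[|[|[|[|m]]]]]] // _ _.
  - exact: polyhedral_tetrahedral.
  - exact: polyhedral_octahedral.
  - exact: polyhedral_icosahedral.
have t_gt0 i : (0 < t i)%N by move: i; apply: ord3P => /=; apply: ltnW.
have s_gt0 i : (0 < s i)%N by move: i; apply: ord3P.
have V_inj : injective V.
  apply: ord3P; apply: ord3P => //= /eqP; rewrite ?(negbTE V12) ?(negbTE V13) ?(negbTE V23) //;
    by rewrite eq_sym ?(negbTE V12) ?(negbTE V13) ?(negbTE V23).
have ts i : ~~ (t i %| s i)%N by move: i; apply: ord3P; apply: coprime_ndvd.
have DE P : coeff P D = \sum_i (s i)%:R / (t i)%:R * (V i == P)%:R.
  by rewrite sum_ord3 /D !coeffD !coeffU.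
have [o] := klein_forms_exist t_gt0 V_inj tP.
have [gT [act actP]] := klein_action o s_gt0.
exists 2%N, gT, act; split; last exact: (invariants_b_gt0 s_gt0 ts actP).
have [phi [phi_bij phi_gr]] := section_ring_iso s_gt0 DE actP.
by exists (d_ s o), phi; split; first exact: d_gt0.
Qed.
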